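(* Let $F(q)=\sum_{n=-1}^\infty f(n)q^n$ be a normalized $q$-series ($f(-1)=1$, $f(0)=0$, $f(n)\in\mathbb Z$ for $n\ge1$), let $\mathfrak L(F)=\bigoplus_{(m,n)\in II_{1,1}}\mathfrak L(F)_{(m,n)}$ be the associated Monstrous Lie superalgebra, and let $V=\bigoplus_{n=-1}^\infty V_n$ with $V_n=\mathfrak L(F)_{(-1,-n)}$. Suppose a group $G$ acts on $\mathfrak L(F)$ by Lie superalgebra automorphisms of $\mathfrak L(F)_\pm$ preserving the $II_{1,1}$-gradation. Assume further that $\mathrm{str}(g|\mathfrak L(F)_{(m,n)})=\mathrm{str}(g|\mathfrak L(F)_{(-m,-n)})$ for all $g\in G$, $m,n>0$, and that $g\cdot f_{-1}=f_{-1}$, $g\cdot e_{-1}=e_{-1}$ for all $g\in G$. Then for all $g\in G$ and $m,n>0$, $$\mathrm{str}(g|\mathfrak L(F)_{(m,n)})=\mathrm{str}(g|\mathfrak L(F)_{(-m,-n)})=\sum_{d|(m,n)}\frac1d\mu(d)\sum_{s\in T(\frac md,\frac nd)}\frac{(|s|-1)!}{s!}\prod_{i,j\ge1}f_{g^d}(i+j-1)^{s_{ij}},$$ where $\mu$ is the classical Möbius function, $f_g(i)=\mathrm{str}(g|V_i)$ for $g\in G$, $i\ge1$, and $T(k,l)$ is the set of families $s=(s_{ij})_{i,j\ge1}$ of nonnegative integers with $\sum s_{ij}(i,j)=(k,l)$, $|s|=\sum s_{ij}$, $s!=\prod s_{ij}!$.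
   Context: The Monstrous Lie superalgebra $\mathfrak L(F)$: let $I=\{-1\}\cup\{1,2,3,\dots\}$, $a_{ij}=-(i+j)$ for $i,j\in I$, $m_i=|f(i)|$ (no generators $e_{ik},f_{ik}$ if $f(i)=0$), and let $C=(\theta_{ij})_{i,j\in I}$ be a complex matrix with $\theta_{ij}\theta_{ji}=1$, $\theta_{ii}=1$ if $f(i)>0$ and $\theta_{ii}=-1$ if $f(i)<0$. Let $Q=\bigoplus_{i\in I}\mathbb Z\alpha_i$ and let $\theta:Q\times Q\to\mathbb C^\times$ be bimultiplicative with $\theta(\alpha_i,\alpha_j)=\theta_{ij}$; $\psi(\alpha)=\theta(\alpha,\alpha)=\pm1$ is the parity sign. $\mathfrak L(F)=\mathfrak g(A,\underline m,C)$ is the $\theta$-colored $Q$-graded Lie superalgebra (bracket with $[x,y]=-\theta(\alpha,\beta)[y,x]$, $[x,[y,z]]=[[x,y],z]+\theta(\alpha,\beta)[y,[x,z]]$ for $x,y$ of degrees $\alpha,\beta$) generated by $h_i,d_i$ ($i\in I$), $e_{ik},f_{ik}$ ($1\le k\le m_i$), of degrees $0,0,\alpha_i,-\alpha_i$, with relations $[h_i,h_j]=[h_i,d_j]=[d_i,d_j]=0$, $[h_i,e_{jl}]=a_{ij}e_{jl}$, $[h_i,f_{jl}]=-a_{ij}f_{jl}$, $[d_i,e_{jl}]=\delta_{ij}e_{jl}$, $[d_i,f_{jl}]=-\delta_{ij}f_{jl}$, $[e_{ik},f_{jl}]=\delta_{ij}\delta_{kl}h_i$, $(\mathrm{ad}\,e_{ik})^{1-a_{ij}}(e_{jl})=(\mathrm{ad}\,f_{ik})^{1-a_{ij}}(f_{jl})=0$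 if $a_{ii}=2$ (i.e. $i=-1$) and $i\ne j$, and $[e_{ik},e_{jl}]=[f_{ik},f_{jl}]=0$ if $a_{ij}=0$. Write $e_{-1}=e_{-1,1}$, $f_{-1}=f_{-1,1}$. Grading: identifying $\alpha_{i}$ with $(1,i)\in II_{1,1}=\mathbb Z^2$ for $i\in I$ makes $\mathfrak L(F)$ $II_{1,1}$-graded; $\mathfrak L(F)_\pm$ are the subalgebras spanned by the root spaces of positive, resp. negative, roots (first coordinate positive, resp. negative). $V_{-1}=\mathbb Cf_{-1}$ and $V_i=\mathbb Cf_{i,1}\oplus\cdots\oplus\mathbb Cf_{i,|f(i)|}$ for $i\ge1$. The supertrace is the trace on the even part minus the trace on the odd part (parity given by $\psi$). *)

(* Defs.v *)
From HB Require Import structures.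
From mathcomp Require Import all_boot all_order all_algebra.
From mathcomp Require Import finmap monalg generic_quotient ring_quotient.
From mathcomp Require Import boolp classical_sets functions cardinality.
From mathcomp Require Import fsbigop reals complex.

Set Implicit Arguments.
Unset Strict Implicit.
Unset Printing Implicit Defensive.

Import Order.TTheory GRing.Theory Num.Theory.

Local Open Scope ring_scope.

Inductive magma (X : Type) : Type :=
| Leaf of X
| Node of magma X & magma X.

Section MagmaChoice.
Variable X : choiceType.

Fixpoint magma_encode (w : magma X) : GenTree.tree X :=
  match w with
  | Leaf x => GenTree.Leaf x
  | Node a b => GenTree.Node 0 [:: magma_encode a; magma_encode b]
  end.

Fixpoint magma_decode (t : GenTree.tree X) : option (magma X) :=
  match t with
  | GenTree.Leaf x => Some (Leaf x)
  | GenTree.Node _ [:: a; b] =>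
    if (magma_decode a, magma_decode b) is (Some a', Some b')
    then Some (Node a' b') else None
  | _ => None
  end.

Lemma magma_encodeK : pcancel magma_encode magma_decode.
Proof. by elim=> [x|a IHa b IHb] //=; rewrite IHa IHb. Qed.

HB.instance Definition _ := Choice.copy (magma X) (pcan_type magma_encodeK).
End MagmaChoice.

Section FreeBracket.
Variables (K : fieldType) (X : choiceType).
Local Notation FA := {malg K[magma X]}.
Implicit Types u v w : FA.

Definition fbr u v : FA :=
  \sum_(a <- msupp u) \sum_(b <- msupp v) << u@_a * v@_b *g Node a b >>.

Lemma fbrEw (d1 d2 : {fset magma X}) u v :
  (msupp u `<=` d1)%fset -> (msupp v `<=` d2)%fset ->
  fbr u v = \sum_(a <- d1) \sum_(b <- d2) << u@_a * v@_b *g Node a b >>.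
Proof.
move=> le1 le2; rewrite /fbr (big_fset_incl _ le1) /=; last first.
  move=> a _ /mcoeff_outdom ua.
  by rewrite big1 // => b _; rewrite ua mul0r monalgU0.
apply: eq_bigr => a _; apply: big_fset_incl => // b _ /mcoeff_outdom ->.
by rewrite mulr0 monalgU0.
Qed.

Lemma fbrP c u1 u2 v : fbr (c *: u1 + u2) v = c *: fbr u1 v + fbr u2 v.
Proof.
pose d := (msupp (c *: u1 + u2) `|` (msupp u1 `|` msupp u2))%fset.
have h0 : (msupp (c *: u1 + u2) `<=` d)%fset by rewrite fsubsetUl.
have h1 : (msupp u1 `<=` d)%fset.
  by apply: fsubset_trans (fsubsetUr _ _); rewrite fsubsetUl.
have h2 : (msupp u2 `<=` d)%fset.
  by apply: fsubset_trans (fsubsetUr _ _); rewrite fsubsetUr.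
have hv := fsubset_refl (msupp v).
rewrite (fbrEw h0 hv) (fbrEw h1 hv) (fbrEw h2 hv).
rewrite scaler_sumr -big_split /=; apply: eq_bigr => a _.
rewrite scaler_sumr -big_split /=; apply: eq_bigr => b _.
apply/malgP => k; rewrite !(mcoeffD, mcoeffZ, mcoeffU).
by case: eqP => _; rewrite ?mulr1n ?mulr0n ?mulr0 ?addr0 // mulrDl mulrA.
Qed.

Lemma fbrPr c u v1 v2 : fbr u (c *: v1 + v2) = c *: fbr u v1 + fbr u v2.
Proof.
pose d := (msupp (c *: v1 + v2) `|` (msupp v1 `|` msupp v2))%fset.
have h0 : (msupp (c *: v1 + v2) `<=` d)%fset by rewrite fsubsetUl.
have h1 : (msupp v1 `<=` d)%fset.
  by apply: fsubset_trans (fsubsetUr _ _); rewrite fsubsetUl.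
have h2 : (msupp v2 `<=` d)%fset.
  by apply: fsubset_trans (fsubsetUr _ _); rewrite fsubsetUr.
have hu := fsubset_refl (msupp u).
rewrite (fbrEw hu h0) (fbrEw hu h1) (fbrEw hu h2).
rewrite scaler_sumr -big_split /=; apply: eq_bigr => a _.
rewrite scaler_sumr -big_split /=; apply: eq_bigr => b _.
apply/malgP => k; rewrite !(mcoeffD, mcoeffZ, mcoeffU).
by case: eqP => _; rewrite ?mulr1n ?mulr0n ?mulr0 ?addr0 // mulrDr mulrCA.
Qed.

End FreeBracket.

Section Presentation.
Variables (K : fieldType) (Q : zmodType) (theta : Q -> Q -> K).
Variables (X : choiceType) (dg : X -> Q) (rel : {malg K[magma X]} -> Prop).
Local Notation FA := {malg K[magma X]}.

Fixpoint mdeg (w : magma X) : Q :=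
  match w with Leaf x => dg x | Node a b => mdeg a + mdeg b end.

Definition supported (P : Q -> Prop) (u : FA) : Prop :=
  forall w, w \in msupp u -> P (mdeg w).

(* The smallest two-sided ideal containing the given relators together with the
   colored skew-symmetry and Jacobi relators; the bracket being bilinear, the
   last argument of the Jacobi relator need not be homogeneous. *)
Inductive pres_ideal : FA -> Prop :=
| pres_rel u : rel u -> pres_ideal u
| pres_skew a b x y :
    supported (eq^~ a) x -> supported (eq^~ b) y ->
    pres_ideal (fbr x y + theta a b *: fbr y x)
| pres_jacobi a b x y z :
    supported (eq^~ a) x -> supported (eq^~ b) y ->
    pres_ideal (fbr x (fbr y z)
                - (fbr (fbr x y) z + theta a b *: fbr y (fbr x z)))
| pres_0 : pres_ideal 0
| pres_lin c u v : pres_ideal u -> pres_ideal v -> pres_ideal (c *: u + v)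
| pres_brl u v : pres_ideal u -> pres_ideal (fbr v u)
| pres_brr u v : pres_ideal u -> pres_ideal (fbr u v).

Definition pres_pred : {pred FA} := fun u => `[< pres_ideal u >].

Lemma pres_predE u : (u \in pres_pred) = `[< pres_ideal u >].
Proof. by []. Qed.

Lemma pres_zmod_closed : zmod_closed pres_pred.
Proof.
split=> [|u v]; rewrite !pres_predE; first by apply/asboolP; exact: pres_0.
move=> /asboolP hu /asboolP hv; apply/asboolP.
by rewrite -[u - v]addrC -scaleN1r; exact: pres_lin.
Qed.

HB.instance Definition _ := GRing.isZmodClosed.Build FA pres_pred
  pres_zmod_closed.

Definition presented : Type := Quotient.quot pres_pred.
HB.instance Definition _ := GRing.Zmodule.on presented.

Definition pr (u : FA) : presented := \pi_(Quotient.quot pres_pred)%qT u.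
Definition rp (x : presented) : FA := repr (x : Quotient.quot pres_pred).

Lemma rpK x : pr (rp x) = x.
Proof. exact: reprK. Qed.

Lemma pr_eq u v : pr u = pr v <-> pres_ideal (u - v).
Proof.
split=> [/eqP|] h; last first.
  by apply/eqP; rewrite -Quotient.idealrBE pres_predE; apply/asboolP.
by move: h; rewrite -Quotient.idealrBE pres_predE => /asboolP.
Qed.

Lemma prD u v : pr (u + v) = pr u + pr v.
Proof. exact: (Quotient.pi_add pres_pred u v). Qed.

Definition pres_scale c (x : presented) : presented := pr (c *: rp x).

Lemma prZ_subproof c u : pr (c *: u) = pres_scale c (pr u).
Proof.
apply/pr_eq; rewrite -scalerBr -[_ *: _]addr0; apply: pres_lin; last first.
  exact: pres_0.
by apply/pr_eq; rewrite rpK.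
Qed.

Lemma pres_scaleA a b x : pres_scale a (pres_scale b x) = pres_scale (a * b) x.
Proof. by rewrite -[x]rpK -!prZ_subproof scalerA. Qed.

Lemma pres_scale1 : left_id 1 pres_scale.
Proof. by move=> x; rewrite -[x]rpK -!prZ_subproof scale1r. Qed.

Lemma pres_scaleDr : right_distributive pres_scale +%R.
Proof.
move=> a x y; rewrite -[x]rpK -[y]rpK -prD -!prZ_subproof -prD.
by rewrite scalerDr.
Qed.

Lemma pres_scaleDl x : {morph pres_scale^~ x : a b / a + b}.
Proof. by move=> a b; rewrite -[x]rpK -!prZ_subproof -prD scalerDl. Qed.

HB.instance Definition _ := GRing.Zmodule_isLmodule.Build K presented
  pres_scaleA pres_scale1 pres_scaleDr pres_scaleDl.

Lemma prZ c u : pr (c *: u) = c *: pr u.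
Proof. exact: prZ_subproof. Qed.

Definition bracket (x y : presented) : presented := pr (fbr (rp x) (rp y)).

Lemma pr_bracket u v : pr (fbr u v) = bracket (pr u) (pr v).
Proof.
have I1 w : pres_ideal (w - rp (pr w)) by apply/pr_eq; rewrite rpK.
have -> : pr (fbr u v) = pr (fbr (rp (pr u)) v).
  apply/pr_eq; rewrite addrC -scaleN1r -fbrP.
  by apply: pres_brr; rewrite scaleN1r addrC; exact: I1.
apply/pr_eq; rewrite addrC -scaleN1r -fbrPr.
by apply: pres_brl; rewrite scaleN1r addrC; exact: I1.
Qed.

Lemma bracketPl c x1 x2 y :
  bracket (c *: x1 + x2) y = c *: bracket x1 y + bracket x2 y.
Proof.
rewrite -[x1]rpK -[x2]rpK -[y]rpK -prZ -prD -!pr_bracket -prZ -prD.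
by rewrite fbrP.
Qed.

Lemma bracketPr c x y1 y2 :
  bracket x (c *: y1 + y2) = c *: bracket x y1 + bracket x y2.
Proof.
rewrite -[x]rpK -[y1]rpK -[y2]rpK -prZ -prD -!pr_bracket -prZ -prD.
by rewrite fbrPr.
Qed.

Lemma pr0 u : rel u -> pr u = 0.
Proof.
move=> ru; have h0 : pr 0 = 0 by rewrite -[0 in LHS](scale0r 0) prZ scale0r.
by rewrite -h0; apply/pr_eq; rewrite subr0; exact: pres_rel.
Qed.

(* The sum of the homogeneous components of degrees in P. *)
Definition graded_part (P : Q -> Prop) : set presented :=
  [set x | exists2 u, supported P u & x = pr u].

Lemma bracket_skew a b x y :
  graded_part (eq^~ a) x -> graded_part (eq^~ b) y ->
  bracket x y = - (theta a b *: bracket y x).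
Proof.
move=> [u hu ->] [v hv ->]; rewrite -!pr_bracket -prZ -scaleN1r -prZ.
by apply/pr_eq; rewrite scaleN1r opprK; exact: pres_skew.
Qed.

Lemma bracket_jacobi a b x y z :
  graded_part (eq^~ a) x -> graded_part (eq^~ b) y ->
  bracket x (bracket y z) =
  bracket (bracket x y) z + theta a b *: bracket y (bracket x z).
Proof.
move=> [u hu ->] [v hv ->]; rewrite -[z]rpK -!pr_bracket -prZ -prD.
by apply/pr_eq; exact: pres_jacobi.
Qed.

End Presentation.

Section ColoredBKM.
Variables (K : fieldType) (I : choiceType).
Variables (A : I -> I -> int) (m : I -> nat) (C : I -> I -> K).

Definition rootlattice : zmodType := {malg int[I]}.
Definition sroot (i : I) : rootlattice := << 1 *g i >>.

(* The bimultiplicative extension of C to the root lattice. *)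
Definition theta (a b : {malg int[I]}) : K :=
  \prod_(i <- msupp a) \prod_(j <- msupp b) C i j ^ (a@_i * b@_j).

Definition psi (a : {malg int[I]}) : K := theta a a.

Inductive gen : Type :=
| GenH of I
| GenD of I
| GenE (i : I) of 'I_(m i)
| GenF (i : I) of 'I_(m i).

Definition gen_encode (x : gen) : I + I + {i & 'I_(m i)} + {i & 'I_(m i)} :=
  match x with
  | GenH i => inl (inl (inl i))
  | GenD i => inl (inl (inr i))
  | GenE i k => inl (inr (Tagged (fun i => 'I_(m i)) k))
  | GenF i k => inr (Tagged (fun i => 'I_(m i)) k)
  end.

Definition gen_decode (x : I + I + {i & 'I_(m i)} + {i & 'I_(m i)}) : gen :=
  match x with
  | inl (inl (inl i)) => GenH i
  | inl (inl (inr i)) => GenD i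
  | inl (inr p) => GenE (tagged p)
  | inr p => GenF (tagged p)
  end.

Lemma gen_encodeK : cancel gen_encode gen_decode.
Proof. by case. Qed.

HB.instance Definition _ := Choice.copy gen (can_type gen_encodeK).

Definition gdeg (x : gen) : rootlattice :=
  match x with
  | GenH _ | GenD _ => 0
  | GenE i _ => sroot i
  | GenF i _ => - sroot i
  end.

Local Notation FA := {malg K[magma gen]}.
Local Notation h i := (<< 1 *g Leaf (GenH i) >> : FA).
Local Notation d i := (<< 1 *g Leaf (GenD i) >> : FA).
Local Notation e k := (<< 1 *g Leaf (GenE k) >> : FA).
Local Notation f k := (<< 1 *g Leaf (GenF k) >> : FA).

Inductive bkm_rel : FA -> Prop :=
| bkm_hh i j : bkm_rel (fbr (h i) (h j))
| bkm_hd i j : bkm_rel (fbr (h i) (d j))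
| bkm_dd i j : bkm_rel (fbr (d i) (d j))
| bkm_he i j (l : 'I_(m j)) :
    bkm_rel (fbr (h i) (e l) - (A i j)%:~R *: e l)
| bkm_hf i j (l : 'I_(m j)) :
    bkm_rel (fbr (h i) (f l) + (A i j)%:~R *: f l)
| bkm_de i j (l : 'I_(m j)) :
    bkm_rel (fbr (d i) (e l) - (i == j)%:R *: e l)
| bkm_df i j (l : 'I_(m j)) :
    bkm_rel (fbr (d i) (f l) + (i == j)%:R *: f l)
| bkm_ef i (k : 'I_(m i)) j (l : 'I_(m j)) :
    bkm_rel (fbr (e k) (f l) - ((i == j) && (k == l :> nat))%:R *: h i)
| bkm_serre_e i (k : 'I_(m i)) j (l : 'I_(m j)) :
    A i i = 2 -> i != j ->
    bkm_rel (iter `|1 - A i j|%N (fbr (e k)) (e l))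
| bkm_serre_f i (k : 'I_(m i)) j (l : 'I_(m j)) :
    A i i = 2 -> i != j ->
    bkm_rel (iter `|1 - A i j|%N (fbr (f k)) (f l))
| bkm_orth_e i (k : 'I_(m i)) j (l : 'I_(m j)) :
    A i j = 0 -> bkm_rel (fbr (e k) (e l))
| bkm_orth_f i (k : 'I_(m i)) j (l : 'I_(m j)) :
    A i j = 0 -> bkm_rel (fbr (f k) (f l)).

Definition bkm : lmodType K := presented theta gdeg bkm_rel.

Definition bkm_br (x y : bkm) : bkm := @bracket K _ theta gen gdeg bkm_rel x y.

Definition bkm_e i (k : 'I_(m i)) : bkm := pr theta gdeg bkm_rel (e k).
Definition bkm_f i (k : 'I_(m i)) : bkm := pr theta gdeg bkm_rel (f k).

Definition bkm_part (P : {malg int[I]} -> Prop) : set bkm :=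
  @graded_part K _ theta gen gdeg bkm_rel P.

Definition bkm_even : set bkm := bkm_part (fun a => psi a = 1).
Definition bkm_odd : set bkm := bkm_part (fun a => psi a = -1).

Lemma thetaEw (d1 d2 : {fset I}) a b :
  (msupp a `<=` d1)%fset -> (msupp b `<=` d2)%fset ->
  theta a b = \prod_(i <- d1) \prod_(j <- d2) C i j ^ (a@_i * b@_j).
Proof.
move=> le1 le2; rewrite /theta (big_fset_incl _ le1) /=; last first.
  move=> i _ /mcoeff_outdom ai.
  by rewrite big1 // => j _; rewrite ai mul0r expr0z.
apply: eq_bigr => i _; apply: big_fset_incl => // j _ /mcoeff_outdom ->.
by rewrite mulr0 expr0z.
Qed.

Lemma theta_sroot i j : theta (sroot i) (sroot j) = C i j.
Proof.
rewrite (thetaEw (d1 := [fset i]%fset) (d2 := [fset j]%fset)) ?msuppU_le //.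
by rewrite !big_seq_fset1 !mcoeffUU mulr1 expr1z.
Qed.

Lemma thetaDl (C_neq0 : forall i j, C i j != 0) a1 a2 b :
  theta (a1 + a2) b = theta a1 b * theta a2 b.
Proof.
pose d := (msupp (a1 + a2) `|` (msupp a1 `|` msupp a2))%fset.
have h0 : (msupp (a1 + a2) `<=` d)%fset by rewrite fsubsetUl.
have h1 : (msupp a1 `<=` d)%fset.
  by apply: fsubset_trans (fsubsetUr _ _); rewrite fsubsetUl.
have h2 : (msupp a2 `<=` d)%fset.
  by apply: fsubset_trans (fsubsetUr _ _); rewrite fsubsetUr.
have hb := fsubset_refl (msupp b).
rewrite (thetaEw h0 hb) (thetaEw h1 hb) (thetaEw h2 hb) -big_split /=.
apply: eq_bigr => i _; rewrite -big_split /=; apply: eq_bigr => j _.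
by rewrite mcoeffD mulrDl expfzDr.
Qed.

Lemma thetaDr (C_neq0 : forall i j, C i j != 0) a b1 b2 :
  theta a (b1 + b2) = theta a b1 * theta a b2.
Proof.
pose d := (msupp (b1 + b2) `|` (msupp b1 `|` msupp b2))%fset.
have h0 : (msupp (b1 + b2) `<=` d)%fset by rewrite fsubsetUl.
have h1 : (msupp b1 `<=` d)%fset.
  by apply: fsubset_trans (fsubsetUr _ _); rewrite fsubsetUl.
have h2 : (msupp b2 `<=` d)%fset.
  by apply: fsubset_trans (fsubsetUr _ _); rewrite fsubsetUr.
have ha := fsubset_refl (msupp a).
rewrite (thetaEw ha h0) (thetaEw ha h1) (thetaEw ha h2) -big_split /=.
apply: eq_bigr => i _; rewrite -big_split /=; apply: eq_bigr => j _.
by rewrite mcoeffD mulrDr expfzDr.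
Qed.

End ColoredBKM.

Section Trace.
Variables (K : fieldType) (L : lmodType K).
Local Open Scope classical_set_scope.

Definition is_basis (W : set L) n (b : 'I_n -> L) : Prop :=
  (forall i, W (b i)) /\
  (forall x, W x -> exists! c : 'I_n -> K, x = \sum_i c i *: b i).

Definition is_trace (W : set L) (phi : L -> L) (t : K) : Prop :=
  exists n (b : 'I_n -> L) (M : 'M[K]_n),
    [/\ is_basis W b, forall j, phi (b j) = \sum_i M i j *: b i & t = \tr M].

(* The value is 0 when W is infinite-dimensional or not stable under phi. *)
Definition trace (W : set L) (phi : L -> L) : K := xget 0 (is_trace W phi).

Lemma is_trace_uniq W (phi : {linear L -> L}) t1 t2 :
  is_trace W phi t1 -> is_trace W phi t2 -> t1 = t2.
Proof.
move=> [n [b [M [[Wb ub] Mb ->]]]] [p [b' [N [[Wb' ub'] Nb ->]]]].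
have /choice [P hP] : forall j, exists c : 'I_n -> K,
    b' j = \sum_i c i *: b i.
  by move=> j; have [c [hc _]] := ub _ (Wb' j); exists c.
have /choice [S hS] : forall i, exists c : 'I_p -> K,
    b i = \sum_j c j *: b' j.
  by move=> i; have [c [hc _]] := ub' _ (Wb i); exists c.
have inj k (bb : 'I_k -> L) : (forall x, W x -> exists! c : 'I_k -> K,
    x = \sum_i c i *: bb i) -> forall x (c c' : 'I_k -> K), W x ->
    x = \sum_i c i *: bb i -> x = \sum_i c' i *: bb i -> c = c'.
  by move=> ubb x c c' Wx hc hc'; have [c0 [_ u]] := ubb _ Wx;
     rewrite -(u _ hc) -(u _ hc').
have comp k1 k2 (b1 : 'I_k1 -> L) (b2 : 'I_k2 -> L) (c : 'I_k2 -> K) U :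
    (forall j, b2 j = \sum_i U j i *: b1 i) ->
    \sum_j c j *: b2 j = \sum_i (\sum_j U j i * c j) *: b1 i.
  move=> hU; under eq_bigr => j _ do rewrite hU scaler_sumr.
  rewrite exchange_big /=; apply: eq_bigr => i _.
  by rewrite scaler_suml; apply: eq_bigr => j _; rewrite scalerA mulrC.
pose MP : 'M[K]_(n, p) := \matrix_(i, j) P j i.
pose MS : 'M[K]_(p, n) := \matrix_(j, i) S i j.
have PS : MP *m MS = 1%:M.
  apply/matrixP => i k; rewrite !mxE; under eq_bigr do rewrite !mxE.
  have bk : b k = \sum_i (i == k)%:R *: b i.
    rewrite (bigD1 k) //= eqxx scale1r big1 ?addr0 // => i' /negPf ->.
    by rewrite scale0r.
  have E := inj _ _ ub _ _ _ (Wb k) bk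
    (etrans (hS k) (comp _ _ _ _ _ _ hP)).
  by have /= <- := congr1 (fun c => c i) E.
have NE : N = MS *m M *m MP.
  apply/matrixP => j k; rewrite !mxE.
  have h1 : phi (b' k) = \sum_i (\sum_l M i l * P k l) *: b i.
    rewrite {1}hP linear_sum /=; under eq_bigr do rewrite linearZ /=.
    rewrite (comp _ _ b (fun i => phi (b i)) (P k) (fun l i => M i l)) //.
  have h2 := comp _ _ b' b (fun i => \sum_l M i l * P k l) S hS.
  have h3 : \sum_i N i k *: b' i =
    \sum_i (\sum_j S j i * (\sum_l M j l * P k l)) *: b' i.
    by rewrite -Nb h1 h2.
  suff /(congr1 (fun c => c j)) /= -> :
      (fun i => N i k) = (fun i => \sum_j S j i * (\sum_l M j l * P k l)).
    under [RHS]eq_bigr do rewrite !mxE mulr_suml.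
    rewrite exchange_big /=; apply: eq_bigr => i _.
    rewrite mulr_sumr; apply: eq_bigr => l _; rewrite !mxE; exact: mulrA.
  apply: functional_extensionality_dep => i.
  pose T := N.
  have inj0 (c c' : 'I_p -> K) :
      \sum_i c i *: b' i = \sum_i c' i *: b' i -> c = c'.
    move=> E; apply: functional_extensionality_dep => q.
    have bq : b' q = \sum_i (i == q)%:R *: b' i.
      rewrite (bigD1 q) //= eqxx scale1r big1 ?addr0 // => i' /negPf ->.
      by rewrite scale0r.
    have bq' : b' q = \sum_i ((i == q)%:R + (c i - c' i)) *: b' i.
      under eq_bigr do rewrite scalerDl scalerBl.
      by rewrite big_split /= -bq sumrB E subrr addr0.
    have := congr1 (fun c => c q) (inj _ _ ub' _ _ _ (Wb' q) bq bq').
    by rewrite /= -[X in X = _]addr0 => /addrI /esym/eqP; rewrite subr_eq0 => /eqP.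
  by have /(congr1 (fun c => c i)) := inj0 _ _ h3.
by rewrite NE -mulmxA mxtrace_mulC -mulmxA PS mulmx1.
Qed.

Lemma traceE W (phi : {linear L -> L}) t : is_trace W phi t -> trace W phi = t.
Proof.
by move=> ht; apply: (is_trace_uniq _ ht); apply: xgetPex; exists t.
Qed.

End Trace.

Record qseries := QSeries {
  qcoef :> int -> int;
  qcoef_lt : forall n, n < -1 -> qcoef n = 0;
  qcoefN1 : qcoef (-1) = 1;
  qcoef0 : qcoef 0 = 0
}.

Definition idx := {i : int | (i == -1) || (1 <= i)}.
Definition idxN1 : idx := exist _ (-1) isT.

Definition monster_A (i j : idx) : int := - (val i + val j).
Definition monster_m (F : qseries) (i : idx) : nat := `|F (val i)|%N.

Lemma monster_mN1 (F : qseries) : (0 < monster_m F idxN1)%N.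
Proof. by rewrite /monster_m qcoefN1. Qed.

Definition coloring (K : fieldType) (F : qseries) (C : idx -> idx -> K) : Prop :=
  (forall i j, C i j * C j i = 1) /\
  (forall i, (0 < F (val i) -> C i i = 1) /\ (F (val i) < 0 -> C i i = -1)).

(* The additive map sending the simple root of index i to (1, i). *)
Definition IIdeg (a : {malg int[idx]}) : int * int :=
  (\sum_(i <- msupp a) a@_i, \sum_(i <- msupp a) a@_i * val i).

Section Monstrous.
Variables (K : fieldType) (F : qseries) (C : idx -> idx -> K).
Local Open Scope classical_set_scope.

Definition monstrous : lmodType K := bkm monster_A (monster_m F) C.

Definition mbr (x y : monstrous) : monstrous := bkm_br x y.

Definition eN1 : monstrous := bkm_e monster_A C (Ordinal (monster_mN1 F)).
Definition fN1 : monstrous := bkm_f monster_A C (Ordinal (monster_mN1 F)).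

Definition root_space (m n : int) : set monstrous :=
  bkm_part (fun a => IIdeg a = (m, n)).

Definition monstrous_pos : set monstrous :=
  bkm_part (fun a => 0 < (IIdeg a).1).
Definition monstrous_neg : set monstrous :=
  bkm_part (fun a => (IIdeg a).1 < 0).

Definition monstrous_even : set monstrous :=
  @bkm_even K idx monster_A (monster_m F) C.
Definition monstrous_odd : set monstrous :=
  @bkm_odd K idx monster_A (monster_m F) C.

Definition superaut (S : set monstrous) (phi : monstrous -> monstrous) : Prop :=
  [/\ set_bij S S phi,
      (forall x y, S x -> S y -> phi (mbr x y) = mbr (phi x) (phi y)),
      (forall x, S x -> monstrous_even x -> monstrous_even (phi x)) &
      (forall x, S x -> monstrous_odd x -> monstrous_odd (phi x))].

Definition supertrace (phi : monstrous -> monstrous) (W : set monstrous) : K :=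
  trace (W `&` monstrous_even) phi - trace (W `&` monstrous_odd) phi.

Definition Vspace (n : int) : set monstrous := root_space (-1) (- n).

End Monstrous.

(* Meaningful for 0 < n only. *)
Definition moebius (n : nat) : int :=
  if all (fun p => logn p n == 1%N) (primes n)
  then (-1) ^+ size (primes n) else 0.

(* Only the values at pairs with positive entries matter: Tset forces the
   support of a family into such pairs. *)
Definition fam := {fsfun nat * nat -> nat with 0%N}.

Definition Tset (k l : nat) : set fam :=
  [set s : fam | (forall p, p \in finsupp s -> (0 < p.1)%N && (0 < p.2)%N) /\
    (\sum_(p <- finsupp s) s p * p.1 = k)%N /\
    (\sum_(p <- finsupp s) s p * p.2 = l)%N]%classic.

Definition fam_size (s : fam) : nat := (\sum_(p <- finsupp s) s p)%N.
Definition fam_fact (s : fam) : nat := (\prod_(p <- finsupp s) (s p)`!)%N.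

Lemma finite_Tset k l : finite_set (Tset k l).
Proof.
pose D : {fset nat * nat} :=
  seq_fset tt [seq (i, j) | i <- iota 0 k.+1, j <- iota 0 l.+1].
pose g (h : {ffun 'I_k.+1 * 'I_l.+1 -> 'I_k.+1}) : fam :=
  [fsfun p in D => nat_of_ord (h (inord p.1, inord p.2))].
apply: (sub_finite_set _ (finite_image g (@finite_finset _ setT))).
move=> s [pos [sk sl]]; pose h := [ffun q : 'I_k.+1 * 'I_l.+1 =>
  inord (s (nat_of_ord q.1, nat_of_ord q.2)) : 'I_k.+1].
have bnd p : p \in finsupp s -> [/\ (p.1 <= k)%N, (p.2 <= l)%N & (s p <= k)%N].
  move=> ps; have /andP[p1 p2] := pos _ ps.
  have sp : (0 < s p)%N by rewrite lt0n -mem_finsupp.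
  have h1 : (s p * p.1 <= k)%N by rewrite -sk (big_fsetD1 p) //= leq_addr.
  have h2 : (s p * p.2 <= l)%N by rewrite -sl (big_fsetD1 p) //= leq_addr.
  by split; [apply: leq_trans h1; rewrite leq_pmull
            |apply: leq_trans h2; rewrite leq_pmull
            |apply: leq_trans h1; rewrite leq_pmulr].
exists h => //; apply/fsfunP => p; rewrite fsfun_fun.
have [ps|ps] := boolP (p \in finsupp s).
  have [b1 b2 b3] := bnd _ ps; rewrite seq_fsetE ifT.
    by rewrite ffunE /= !inordK ?ltnS -?surjective_pairing ?ltnS.
  by apply/allpairsPdep; exists p.1, p.2;
     rewrite !mem_iota /= !add0n !ltnS -surjective_pairing.
rewrite fsfun_dflt //; case: ifP => // pD.
move: pD; rewrite seq_fsetE => /allpairsPdep [i [j []]].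
rewrite !mem_iota !add0n /= !ltnS => hi hj E.
by rewrite ffunE /= E /= !inordK // -E fsfun_dflt.
Qed.

(* Main.v *)
(* By [rho_str] only the negative part matters.  Write f = f_{-1}.  By the Serre
   relations the negative part is the sum of C f and of the subalgebra L' generated
   by the letters (ad f)^l f_{jk} with j >= 1 and l < j, and L' is free on these
   letters as a colored Lie superalgebra.  That it contains the rest of the
   negative part follows from the triangular decomposition.  For freeness, let the
   whole algebra act on the tensor algebra T of the span of the letters: f_{jk} by
   left multiplication, f and e_{-1} by derivations (sl_2 acting on the letters),
   e_{ik} by a derivation sending the letter f_{ik} to h_i.

   Lazard elimination splits off the letters one at a time and gives, in bounded
   degree, a basis of L' made of iterated brackets and, for odd ones, of half
   their squares; independence holds because the ordered monomials in these
   elements span T degreewise and are as many as the words.  An automorphism that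
   fixes f acts on the letters through the f_{jk}, hence triangularly in a
   suitable basis, and the basis of L' inherits this.  Writing t_d(m, n) for the
   supertrace of g^d in degree -(m, n), comparing logarithmic derivatives of
   1 / (1 - v_d) and of its factorization by elimination gives

     sum_{k | (m, n)} (1 / k) t_{k d}(m / k, n / k) = [x^m y^n] (- log (1 - v_d)),

   where v_d is the series of the supertraces of g^d on the letters.  The
   right-hand side is the sum over T(m, n) by the multinomial theorem, and
   Moebius inversion yields the formula. *)

Require Import Defs.
From HB Require Import structures.
From mathcomp Require Import all_boot all_order all_algebra.
From mathcomp Require Import spectral.
From mathcomp Require Import finmap monalg generic_quotient ring_quotient.
From mathcomp Require Import boolp classical_sets functions cardinality.
From mathcomp Require Import fsbigop reals complex.
From mathcomp Require Import ring zify.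

Set Implicit Arguments.
Unset Strict Implicit.
Unset Printing Implicit Defensive.

Import Order.TTheory GRing.Theory Num.Theory.

Local Open Scope ring_scope.

(** * Power series in two variables, truncated by total degree *)

(** The obstacle is that a quotient by relators shows no basis: its graded pieces, even its even and
    odd parts, might overlap. The relations give spanning sets; all independence is read off from
    the action, through values at the empty word. Odd letters are allowed all their powers in the
    ordered monomials, so that both parities contribute the same geometric series to the count.

    Everything is truncated at a height N, the height of -(m, n) being m + n. The letter (ad f)^l
    f_{jk} has bidegree (l + 1, j - l) and height j + 1, so finitely many letters matter; f itself
    has height 0, which is why it stays outside the elimination. The letters of bidegree (a, b) are
    those with j = a + b - 1 and l = a - 1: this is the origin of the index i + j - 1 in the
    formula.

    As g need not be diagonalizable, each V_j gets a basis that is triangular for g, hence for all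
    g^d at once, the eigenvalues being raised to the power d. A weight that is additive under
    brackets records the triangularity. All powers of g are treated together because Moebius
    inversion mixes them. *)

Section GenSeries.
Variable K : fieldType.
Implicit Types (p q r v x : {poly {poly K}}) (m n k : nat).

(* [mono i j c] stands for c x^i y^j, the outer indeterminate being y. *)
Definition mono i j (c : K) : {poly {poly K}} := (c *: 'X^i)%:P * 'X^j.

Definition cf m n p : K := p`_n`_m.

Lemma cfD m n p q : cf m n (p + q) = cf m n p + cf m n q.
Proof. by rewrite /cf !coefD. Qed.

Lemma cfB m n p q : cf m n (p - q) = cf m n p - cf m n q.
Proof. by rewrite /cf !coefB. Qed.

Lemma cf0 m n : cf m n 0 = 0.
Proof. by rewrite /cf !coef0. Qed.

Lemma cf1 m n : cf m n 1 = ((m == 0) && (n == 0))%:R.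
Proof. by rewrite /cf coef1; case: n => [|n]; rewrite ?coef1 ?coef0 ?andbT ?andbF. Qed.

Lemma cf_sum m n (I : Type) (s : seq I) (P : pred I) (f : I -> {poly {poly K}}) :
  cf m n (\sum_(i <- s | P i) f i) = \sum_(i <- s | P i) cf m n (f i).
Proof. by rewrite /cf !coef_sum. Qed.

Lemma cf_monoM i j c p m n :
  cf m n (mono i j c * p) =
  if (i <= m)%N && (j <= n)%N then c * cf (m - i) (n - j) p else 0.
Proof.
rewrite /cf /mono -mulrA coefCM coefXnM ltnNge.
case: leqP => _ /=; last by rewrite mulr0 coef0 andbF.
rewrite andbT -scalerAl coefZ coefXnM ltnNge.
by case: leqP => _ /=; rewrite ?mulr0.
Qed.

Lemma cf_mono i j c m n : cf m n (mono i j c) = c *+ ((m == i) && (n == j)).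
Proof.
rewrite -[mono _ _ _]mulr1 cf_monoM cf1 !subn_eq0.
rewrite [(m == i)]eqn_leq [(n == j)]eqn_leq.
by case: (i <= m)%N; case: (j <= n)%N; case: (m <= i)%N; case: (n <= j)%N;
  rewrite //= ?mulr0 ?mulr1.
Qed.

Lemma monoM i j c i' j' c' :
  mono i j c * mono i' j' c' = mono (i + i') (j + j') (c * c').
Proof.
rewrite /mono !exprD mulrACA -polyCM; congr (polyC _ * _).
by rewrite -scalerAl -scalerAr scalerA.
Qed.

Lemma mono1 : mono 0 0 1 = 1.
Proof. by rewrite /mono scale1r !expr0 mulr1. Qed.

Lemma monoX i j c k : mono i j c ^+ k = mono (k * i) (k * j) (c ^+ k).
Proof. by elim: k => [|k IH]; rewrite ?mono1 // !exprS IH monoM !mulSn. Qed.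

Definition vanish k p := forall m n, (m + n < k)%N -> cf m n p = 0.

Lemma vanish0 k : vanish k 0.
Proof. by move=> m n _; rewrite cf0. Qed.

Lemma vanishD k p q : vanish k p -> vanish k q -> vanish k (p + q).
Proof. by move=> hp hq m n h; rewrite cfD hp ?hq ?addr0. Qed.

Lemma vanishN k p : vanish k p -> vanish k (- p).
Proof. by move=> hp m n h; rewrite -sub0r cfB cf0 hp ?subr0. Qed.

Lemma vanishB k p q : vanish k p -> vanish k q -> vanish k (p - q).
Proof. by move=> hp hq; apply: vanishD => //; apply: vanishN. Qed.

Lemma vanishM k l p q : vanish k p -> vanish l q -> vanish (k + l) (p * q).
Proof.
move=> hp hq m n h; rewrite /cf coefM coef_sum big1 // => -[j /= jn] _.
rewrite coefM big1 // => -[i /= im] _; rewrite !ltnS in im jn.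
have [ij|ij] := ltnP (i + j)%N k; first by rewrite [p`_j`_i]hp ?mul0r.
have hb : (i + j + (m - i + (n - j)) = m + n)%N by rewrite addnACA !subnKC.
rewrite [q`__`__]hq ?mulr0 // -(ltn_add2l (i + j)) hb (leq_trans h) //.
by rewrite leq_add2r.
Qed.

Lemma vanishMl k p q : vanish k p -> vanish k (p * q).
Proof. by move=> hp; rewrite -[k]addn0; apply: vanishM. Qed.

Lemma vanishMr k p q : vanish k p -> vanish k (q * p).
Proof. by move=> hp; rewrite mulrC; apply: vanishMl. Qed.

Lemma vanishX p k : vanish 1 p -> vanish k (p ^+ k).
Proof.
by move=> hp; elim: k => [|k IH] //; rewrite exprS -add1n; apply: vanishM.
Qed.

Lemma vanish_sum k (I : Type) (s : seq I) (P : pred I) (f : I -> {poly {poly K}}) :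
  (forall i, P i -> vanish k (f i)) -> vanish k (\sum_(i <- s | P i) f i).
Proof.
by move=> h; elim/big_rec: _ => [|i p Pi]; [exact: vanish0 | apply: vanishD; exact: h].
Qed.

Lemma vanish_mono i j c k : (k <= i + j)%N -> vanish k (mono i j c).
Proof.
move=> h m n mn; rewrite cf_mono; case: eqP => //= em; case: eqP => //= en.
by move: mn; rewrite em en ltnNge h.
Qed.

(* y d/dy *)
Definition euler p : {poly {poly K}} := 'X * p^`().

Lemma cf_euler m n p : cf m n (euler p) = n%:R * cf m n p.
Proof.
rewrite /cf /euler coefXM; case: n => [|n] /=; first by rewrite coef0 mul0r.
by rewrite coef_deriv coefMn mulr_natl.
Qed.

Lemma euler_mono i j c : euler (mono i j c) = j%:R * mono i j c.
Proof.
rewrite /euler /mono -mul_polyC derivM derivC mul0r add0r derivXn.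
case: j => [|j] /=; first by rewrite mulr0n !mulr0 mul0r.
by rewrite !mulrnAr mulrCA -exprS mulr_natl.
Qed.

Lemma eulerD p q : euler (p + q) = euler p + euler q.
Proof. by rewrite /euler derivD mulrDr. Qed.

Lemma eulerM p q : euler (p * q) = euler p * q + p * euler q.
Proof. by rewrite /euler derivM; ring. Qed.

Lemma vanish_euler k p : vanish k p -> vanish k (euler p).
Proof. by move=> hp m n mn; rewrite cf_euler hp ?mulr0. Qed.

Variable N : nat.
Definition geo p := \sum_(i < N.+1) p ^+ i.
Definition dlog p := euler p * geo p.
(* Equality up to terms of total degree above [N], where [geo p] is 1 / (1 - p)
   and [dlog p] is y d/dy (- log (1 - p)). *)
Definition eqtr p q := vanish N.+1 (p - q).

Lemma eqtr_cf p q m n : eqtr p q -> (m + n <= N)%N -> cf m n p = cf m n q.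
Proof. by move=> h mn; apply/eqP; rewrite -subr_eq0 -cfB h. Qed.

(** The product telescopes to 1 - p^(N+1), and p has no constant term. *)
Lemma geoP p : vanish 1 p -> eqtr ((1 - p) * geo p) 1.
Proof.
move=> hp; rewrite /eqtr /geo.
have -> : (1 - p) * (\sum_(i < N.+1) p ^+ i) = 1 - p ^+ N.+1.
  by rewrite -[RHS]opprB subrX1 -mulNr opprB.
by rewrite addrAC subrr add0r; apply/vanishN/vanishX.
Qed.

Lemma eqtr_trans p q r : eqtr p q -> eqtr q r -> eqtr p r.
Proof. by move=> h1 h2; rewrite /eqtr -(subrK q p) -addrA; apply: vanishD. Qed.

Lemma eqtr_sym p q : eqtr p q -> eqtr q p.
Proof. by move=> h; rewrite /eqtr -opprB; apply: vanishN. Qed.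

Lemma eqtr_refl p : eqtr p p.
Proof. by rewrite /eqtr subrr; apply: vanish0. Qed.

Lemma eqtrD p q p' q' : eqtr p p' -> eqtr q q' -> eqtr (p + q) (p' + q').
Proof.
move=> h1 h2; rewrite /eqtr (_ : _ - _ = (p - p') + (q - q')); last by ring.
exact: vanishD.
Qed.

Lemma eqtrMl p q r : eqtr p q -> eqtr (r * p) (r * q).
Proof. by move=> h; rewrite /eqtr -mulrBr; apply: vanishMr. Qed.

Lemma eqtrM p q p' q' : eqtr p p' -> eqtr q q' -> eqtr (p * q) (p' * q').
Proof.
move=> h1 h2; apply: eqtr_trans (eqtrMl _ h2) _.
by rewrite ![_ * q']mulrC; apply: eqtrMl.
Qed.

Lemma eqtr_inv u p q : eqtr (u * p) 1 -> eqtr (u * q) 1 -> eqtr p q.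
Proof.
move=> hp hq.
rewrite /eqtr (_ : _ - _ = q * (u * p - 1) - p * (u * q - 1)); last by ring.
by apply: vanishB; apply: vanishMr.
Qed.

(* One elimination step: 1 - x - y = (1 - x) (1 - y / (1 - x)). *)
Section Step.
Variables (x vY vA : {poly {poly K}}).
Hypotheses (hx : vanish 1 x) (hY : vanish 1 vY) (hA : vanish 1 vA).
Hypothesis H : eqtr (vA * (1 - x)) vY.

Lemma geo_step : eqtr (geo (x + vY)) (geo x * geo vA).
Proof.
apply: (@eqtr_inv (1 - (x + vY))); first by apply/geoP/vanishD.
have -> : (1 - (x + vY)) * (geo x * geo vA) =
  ((1 - x) * geo x) * ((1 - vA) * geo vA) +
  (vA * (1 - x) - vY) * (geo x * geo vA) by ring.
rewrite /eqtr addrAC; apply: vanishD; last exact: vanishMl.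
by rewrite -[X in _ - X](mulr1 1); apply: eqtrM; apply: geoP.
Qed.

(** With W the inverse of 1 - x - vY, the factorization gives 1 / (1 - x) = (1 - vA) W and 1 / (1 -
    vA) = (1 - x) W. Over the common factor W the numerators agree by the derivative of [H]. *)
Lemma dlog_step : eqtr (dlog (x + vY)) (dlog x + dlog vA).
Proof.
set W := geo (x + vY).
have hW := geo_step; rewrite -/W in hW.
have h1 : eqtr (geo vA) ((1 - x) * W).
  apply: eqtr_sym; apply: eqtr_trans (eqtrMl _ hW) _.
  rewrite mulrA -[X in eqtr _ X]mul1r; apply: eqtrM (geoP hx) _.
  exact: eqtr_refl.
have h2 : eqtr (geo x) ((1 - vA) * W).
  apply: eqtr_sym; apply: eqtr_trans (eqtrMl _ hW) _.
  rewrite mulrCA -[X in eqtr _ X]mulr1; apply: eqtrMl; exact: geoP.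
have h3 : vanish N.+1 (euler vA * (1 - x) - vA * euler x - euler vY).
  have := vanish_euler H; rewrite -[- vY]mulN1r eulerD eulerM.
  have e1 : euler 1 = 0 by rewrite /euler -polyC1 derivC mulr0.
  have eN p : euler (- p) = - euler p by rewrite /euler derivN mulrN.
  by rewrite eulerD e1 add0r eN mulrN mulN1r eN.
rewrite /eqtr /dlog -/W eulerD.
rewrite (_ : _ - _ =
  - ((euler vA * (1 - x) - vA * euler x - euler vY) * W)
  - euler x * (geo x - (1 - vA) * W)
  - euler vA * (geo vA - (1 - x) * W)); last by ring.
apply: vanishB; last exact: vanishMr.
apply: vanishB; last exact: vanishMr.
exact/vanishN/vanishMl.
Qed.
End Step.

End GenSeries.

(** * Spans and independent families *)

Section LinearSpan.
Variables (K : fieldType) (V : lmodType K).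
Implicit Types (P : V -> Prop) (s : seq V).

(** The spanning families are given by predicates and may be infinite; an inductive closure lets
    arguments run by induction instead of through finite sums. *)
Inductive lspan P : V -> Prop :=
| lspan_in z : P z -> lspan P z
| lspan_0 : lspan P 0
| lspan_lin c y z : lspan P y -> lspan P z -> lspan P (c *: y + z).

Lemma lspan_sub P P' z : (forall y, P y -> P' y) -> lspan P z -> lspan P' z.
Proof.
move=> h; elim=> [y /h||c y y' _ h1 _ h2]; [exact: lspan_in|exact: lspan_0|].
exact: lspan_lin.
Qed.

Lemma lspanZ P c z : lspan P z -> lspan P (c *: z).
Proof. by move=> h; rewrite -[_ *: _]addr0; apply: lspan_lin => //; apply: lspan_0. Qed.

Lemma lspan_bind P P' z : (forall y, P y -> lspan P' y) -> lspan P z -> lspan P' z.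
Proof.
move=> h; elim=> [y /h//||c y y' _ h1 _ h2]; first exact: lspan_0.
exact: lspan_lin.
Qed.

(** The length is a separate variable so that the coefficients can be indexed by the positions of
    another list of the same size. *)
Lemma lspan_seq s n z : n = size s -> lspan (fun y => y \in s) z ->
  exists c : 'I_n -> K, z = \sum_i c i *: s`_i.
Proof.
move=> ->; elim=> [y ys||a y1 y2 _ [c1 ->] _ [c2 ->]].
- have si : (index y s < size s)%N by rewrite index_mem.
  exists (fun i => (i == Ordinal si)%:R); rewrite (bigD1 (Ordinal si)) //=.
  rewrite eqxx scale1r nth_index // big1 ?addr0 // => i /negPf ->.
  by rewrite scale0r.
- by exists (fun=> 0); rewrite big1 // => i _; rewrite scale0r.
- exists (fun i => a * c1 i + c2 i); rewrite scaler_sumr -big_split /=.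
  by apply: eq_bigr => i _; rewrite scalerA scalerDl.
Qed.

(** Lists instead of sets: a repetition is a relation, so sizes can be compared like dimensions. *)
Definition indep s : Prop := forall c : 'I_(size s) -> K,
  \sum_i c i *: s`_i = 0 -> forall i, c i = 0.

Definition lcomb (c : seq K) s := \sum_(i < size s) c`_i *: s`_i.

Lemma lcomb_cons a c y s : lcomb (a :: c) (y :: s) = a *: y + lcomb c s.
Proof. by rewrite /lcomb big_ord_recl. Qed.

Lemma indepP s : indep s <->
  (forall c, size c = size s -> lcomb c s = 0 -> all (fun a => a == 0) c).
Proof.
split=> h c; last first.
  move=> e i; have := h [seq c j | j <- enum 'I_(size s)].
  rewrite size_map size_enum_ord => /(_ erefl).
  have nE (j : 'I_(size s)) : [seq c j | j <- enum 'I_(size s)]`_j = c j.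
    by rewrite (nth_map i) ?size_enum_ord // nth_ord_enum.
  have -> : lcomb [seq c j | j <- enum 'I_(size s)] s = 0.
    by rewrite -[RHS]e; apply: eq_bigr => j _; rewrite nE.
  move=> /(_ erefl) /allP /(_ (c i)) /(_ _)/eqP; apply.
  by apply: map_f; rewrite mem_enum.
move=> sz e; apply/(all_nthP 0) => i; rewrite sz => si.
by have := h (fun i => c`_i) e (Ordinal si) => /= ->.
Qed.

Lemma lcomb_subseq s1 s2 c1 : subseq s1 s2 -> size c1 = size s1 ->
  exists c2, [/\ size c2 = size s2, lcomb c2 s2 = lcomb c1 s1 &
    all (fun a => a == 0) c2 -> all (fun a => a == 0) c1].
Proof.
elim: s2 s1 c1 => [|y s2 IH] [|x s1] c1 //=.
- by move=> _ /size0nil ->; exists [::].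
- move=> _ /size0nil ->; have [c [h1 h2 h3]] := IH [::] [::] (sub0seq _) erefl.
  exists (0 :: c); split=> //=; first by rewrite h1.
  by rewrite lcomb_cons scale0r add0r h2.
case: eqP => [->|_] ss.
  case: c1 => [|a c1] //= [sz]; have [c [h1 h2 h3]] := IH _ _ ss sz.
  exists (a :: c); split=> //=; first by rewrite h1.
    by rewrite !lcomb_cons h2.
  by move=> /andP[-> /h3].
move=> sz; have [c [h1 h2 h3]] := IH _ _ ss sz.
exists (0 :: c); split=> //=; first by rewrite h1.
  by rewrite lcomb_cons scale0r add0r h2.
by move=> /andP[_ /h3].
Qed.

Lemma indep_subseq s1 s2 : subseq s1 s2 -> indep s2 -> indep s1.
Proof.
move=> ss /indepP h; apply/indepP => c1 sz e.
by have [c2 [h1 h2 h3]] := lcomb_subseq ss sz; apply/h3/h => //; rewrite h2.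
Qed.

(** Write s1 = M s2. The square matrix M has trivial left kernel because s1 is independent, so it is
    invertible, and a relation d of s2 becomes the relation d M^-1 of s1. This is how a count turns
    spanning into independence. *)
Lemma indep_span s1 s2 : indep s1 -> size s1 = size s2 ->
  (forall z, z \in s1 -> lspan (fun y => y \in s2) z) -> indep s2.
Proof.
move=> + e12; rewrite /indep -e12 => ind sp d hd.
have /choice [C hC] : forall i : 'I_(size s1), exists c : 'I_(size s1) -> K,
    s1`_i = \sum_j c j *: s2`_j.
  by move=> i; apply/(lspan_seq e12)/sp/mem_nth.
pose M : 'M[K]_(size s1) := \matrix_(i, j) C i j.
have Mu : M \in unitmx.
  rewrite -row_free_unit -kermx_eq0; apply/eqP/row_matrixP => i.
  set v := row i _; have vM : v *m M = 0 by apply/sub_kermxP; rewrite row_sub.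
  rewrite row0; apply/rowP => j; rewrite [RHS]mxE; move: j; apply: ind.
  under eq_bigr do rewrite hC scaler_sumr.
  rewrite exchange_big /= big1 // => j _.
  under eq_bigr do rewrite scalerA.
  rewrite -scaler_suml (_ : \sum_k _ = (v *m M) 0 j).
    by rewrite vM mxE scale0r.
  by rewrite [RHS]mxE; apply: eq_bigr => k _; rewrite [M _ _]mxE.
pose dv : 'rV[K]_(size s1) := \row_j d j.
pose w := dv *m invmx M.
have w0 : w = 0.
  apply/rowP => j; rewrite [RHS]mxE; move: j; apply: ind.
  under eq_bigr do rewrite hC scaler_sumr.
  rewrite exchange_big /= -[RHS]hd; apply: eq_bigr => j _.
  under eq_bigr do rewrite scalerA.
  rewrite -scaler_suml; congr (_ *: _).
  transitivity ((w *m M) 0 j); last by rewrite mulmxKV // mxE.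
  by rewrite [RHS]mxE; apply: eq_bigr => k _; rewrite [M _ _]mxE.
move=> i; have : dv = 0 by rewrite -[dv](mulmxKV Mu) -/w w0 mul0mx.
by move=> /rowP/(_ i); rewrite !mxE.
Qed.

End LinearSpan.

(** * Lazard elimination in a colored Lie superalgebra *)

Section Letters.
Variables (K : numFieldType) (Q : zmodType) (L : lmodType K).

(* An element [el] of degree [qd] and bidegree ([dm], [dn]); an automorphism is
   to multiply it by [lam], up to elements of weight higher than [wt]. *)
Record letter := Letter {
  el : L; qd : Q; dm : nat; dn : nat; wt : nat; lam : K }.

HB.instance Definition _ := gen_eqMixin letter.
HB.instance Definition _ := gen_choiceMixin letter.

Variables (br : L -> L -> L) (th : Q -> Q -> K).
Implicit Types (x y a : letter) (A Y E : seq letter).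

Definition ht a := (dm a + dn a)%N.

Definition lcom x y := Letter (br (el x) (el y)) (qd x + qd y)
  (dm x + dm y) (dn x + dn y) (wt x + wt y) (lam x * lam y).

(** The half makes this element act, for odd x, as the square of the action of x. *)
Definition sq x := Letter (2^-1 *: br (el x) (el x)) (qd x + qd x)
  (dm x + dm x) (dn x + dn x) (wt x + wt x) (lam x * lam x).

Definition is_odd x := th (qd x) (qd x) == -1.

Definition fresh N x Y :=
  [seq z <- [seq iter k (lcom x) y | k <- iota 1 N, y <- Y] | (ht z <= N)%N].

(* Lazard elimination, truncated at height [N]: the free Lie superalgebra on
   [x] and [Y] is the sum of the one on [x] and of the one on all
   [(ad x)^k y]. *)
Inductive elimination N : seq letter -> seq letter -> Prop :=
| elim_nil : elimination N [::] [::]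
| elim_cons x Y E :
    elimination N (Y ++ fresh N x Y) E -> elimination N (x :: Y) (x :: E).

(** For even x the bracket [x, x] vanishes, so only odd letters bring a square. Later letters come
    first, in the order in which [mon] lists the matching monomials; this makes [subseq_mon]
    possible. *)
Fixpoint plus E : seq letter :=
  if E is x :: E' then
    plus E' ++ x :: (if is_odd x then [:: sq x] else [::])
  else [::].

Lemma ht_lcom x y : ht (lcom x y) = (ht x + ht y)%N.
Proof. by rewrite /ht /= addnACA. Qed.

Lemma ht_iter k x y : ht (iter k (lcom x) y) = (k * ht x + ht y)%N.
Proof. by elim: k => [|k IH] //; rewrite iterS ht_lcom IH mulSn addnA. Qed.

Lemma mem_fresh N x Y y k : (0 < ht x)%N -> y \in Y ->
  (ht (iter k (lcom x) y) <= N)%N ->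
  iter k (lcom x) y \in Y ++ fresh N x Y.
Proof.
move=> x0 yY hN; rewrite mem_cat; case: k hN => [|k] hN; first by rewrite yY.
apply/orP; right; rewrite mem_filter hN /=; apply/allpairsP.
exists (k.+1, y); split=> //=; rewrite mem_iota /= add1n ltnS.
by move: hN; rewrite ht_iter; nia.
Qed.

Lemma freshP N x Y z : z \in Y ++ fresh N x Y ->
  exists k y, y \in Y /\ z = iter k (lcom x) y.
Proof.
rewrite mem_cat => /orP[zY|]; first by exists 0, z.
by rewrite mem_filter => /andP[_ /allpairsP [[k y] [_ yY ->]]]; exists k, y.
Qed.

(** Removing a letter of height at least D creates only letters of height above D. In the induction,
    [B] holds letters still to be removed and [R] the strictly higher ones, which the fresh letters
    join; once [B] is empty, D increases, until it exceeds N. *)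
Lemma elimination_ex N A : all (fun a => (0 < ht a <= N)%N) A ->
  exists E, elimination N A E.
Proof.
suff H q : forall D B R, (N < D + q)%N -> (0 < D)%N ->
    all (fun a => (D <= ht a <= N)%N) B -> all (fun a => (D < ht a <= N)%N) R ->
    exists E, elimination N (B ++ R) E.
  by move=> hA; have := @H N 1%N A [::]; rewrite cats0; apply.
elim: q => [|q IHq] D B R hD D0.
  have emp (C : seq letter) : all (fun a => (D <= ht a <= N)%N) C -> C = [::].
    by case: C => // a C /= /andP[]; lia.
  move=> /emp -> hR; rewrite (emp R) ?cats0; first by exists [::]; apply: elim_nil.
  by apply: sub_all hR => a; lia.
elim: B R => [|x B IH] R hB hR.
  have [||||E] := IHq D.+1 R [::] => //; first by lia.
  by rewrite cats0 => hE; exists E.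
move: hB => /= /andP[hx hB].
have [||E hE] := IH (R ++ fresh N x (B ++ R)) => //.
  rewrite all_cat hR /=; apply/allP => z; rewrite mem_filter => /andP[zN].
  move=> /allpairsP [[k y] /= [ki yY ez]]; rewrite zN andbT ez ht_iter.
  have k0 : (0 < k)%N by move: ki; rewrite mem_iota; lia.
  have : (0 < ht y)%N.
    by move: yY; rewrite mem_cat => /orP[/(allP hB)|/(allP hR)]; lia.
  by move: k0 hx; nia.
by exists (x :: E); apply: elim_cons; rewrite -catA.
Qed.

Lemma elimination_all N (P : letter -> Prop) A E :
  (forall x y, P x -> P y -> P (lcom x y)) ->
  elimination N A E -> (forall a, a \in A -> P a) -> forall e, e \in E -> P e.
Proof.
move=> Pl; elim=> // x Y E' _ IH hA e; rewrite inE => /orP[/eqP ->|].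
  by apply: hA; rewrite mem_head.
move: e; apply: IH => z /freshP [k [y [yY ->]]].
elim: k => [|k IHk] /=; first by apply: hA; rewrite inE yY orbT.
by apply: Pl => //; apply: hA; rewrite mem_head.
Qed.

Lemma mem_plus E z : z \in plus E ->
  exists2 e, e \in E & z = e \/ (is_odd e /\ z = sq e).
Proof.
elim: E => [//|x E IH] /=; rewrite mem_cat => /orP[/IH [e eE h]|].
  by exists e => //; rewrite inE eE orbT.
rewrite inE => /orP[/eqP ->|]; first by exists x; [rewrite mem_head|left].
case: ifP => // xo; rewrite inE => /eqP ->.
by exists x; [rewrite mem_head|right].
Qed.

Lemma sum_plus E (f : letter -> K) :
  \sum_(z <- plus E) f z =
  \sum_(e <- E) (f e + if is_odd e then f (sq e) else 0).
Proof.
elim: E => [|x E IH] /=; first by rewrite !big_nil.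
rewrite big_cat /= IH !big_cons addrC; congr (_ + _ + _).
by case: ifP; rewrite ?big_cons big_nil ?addr0.
Qed.

End Letters.

Record colored_lie (K : numFieldType) (Q : zmodType) (L : lmodType K)
    (br : L -> L -> L) (th : Q -> Q -> K) (hom : Q -> L -> Prop) : Prop :=
  ColoredLie {
  cl_brPl : forall c x1 x2 y, br (c *: x1 + x2) y = c *: br x1 y + br x2 y;
  cl_brPr : forall c x y1 y2, br x (c *: y1 + y2) = c *: br x y1 + br x y2;
  cl_hom0 : forall q, hom q 0;
  cl_hom_lin : forall q c x y, hom q x -> hom q y -> hom q (c *: x + y);
  cl_hom_br : forall a b x y, hom a x -> hom b y -> hom (a + b) (br x y);
  cl_skew : forall a b x y, hom a x -> hom b y -> br x y = - (th a b *: br y x);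
  cl_jacobi : forall a b x y z, hom a x -> hom b y ->
    br x (br y z) = br (br x y) z + th a b *: br y (br x z);
  cl_thDl : forall a b c, th (a + b) c = th a c * th b c;
  cl_thDr : forall a b c, th a (b + c) = th a b * th a c;
  cl_thC : forall a b, th a b * th b a = 1
}.

Section ColoredLie.
Variables (K : numFieldType) (Q : zmodType) (L : lmodType K).
Variables (br : L -> L -> L) (th : Q -> Q -> K) (hom : Q -> L -> Prop).
Hypothesis CL : colored_lie br th hom.

Let brPl := cl_brPl CL.
Let brPr := cl_brPr CL.
Let hom0 := cl_hom0 CL.
Let hom_lin := cl_hom_lin CL.
Let hom_br := cl_hom_br CL.
Let skew := cl_skew CL.
Let jacobi := cl_jacobi CL.
Let thDl := cl_thDl CL.
Let thDr := cl_thDr CL.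
Let thC := cl_thC CL.

Lemma br0l y : br 0 y = 0.
Proof. by have := brPl (-1) 0 0 y; rewrite scaler0 addr0 scaleN1r addNr. Qed.

Lemma br0r x : br x 0 = 0.
Proof. by have := brPr (-1) x 0 0; rewrite scaler0 addr0 scaleN1r addNr. Qed.

Lemma brZl c x y : br (c *: x) y = c *: br x y.
Proof. by have := brPl c x 0 y; rewrite !addr0 br0l addr0. Qed.

Lemma homZ q c x : hom q x -> hom q (c *: x).
Proof. by move=> h; rewrite -[_ *: _]addr0; apply: hom_lin. Qed.

Lemma th_neq0 a b : th a b != 0.
Proof.
by apply/eqP => e; have := thC a b; rewrite e mul0r => /esym/eqP; rewrite oner_eq0.
Qed.

Lemma th_self a : th a a = 1 \/ th a a = -1.
Proof.
have /eqP := thC a a; rewrite -expr2 -subr_eq0 subr_sqr_1 mulf_eq0.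
by rewrite subr_eq0 addr_eq0 => /orP[/eqP|/eqP]; [left|right].
Qed.

Lemma th_double a b : th (a + b) (a + b) = th a a * th b b.
Proof.
rewrite thDl 2!thDr [th b a * _]mulrC mulrACA.
by rewrite thC mulr1.
Qed.

Lemma th_opp a : th (- a) (- a) = th a a.
Proof.
have th0 : th 0 0 = 1.
  by apply: (mulfI (th_neq0 0 0)); rewrite -thDl addr0 mulr1.
have := th_double a (- a); rewrite subrr th0.
by case: (th_self a) => ->; rewrite ?mul1r // mulN1r => ->; rewrite opprK.
Qed.

Lemma br_assoc a b x y z : hom a x -> hom b y ->
  br (br x y) z = br x (br y z) - th a b *: br y (br x z).
Proof. by move=> hx hy; rewrite (jacobi z hx hy) addrK. Qed.

Lemma br_even a x : hom a x -> th a a != -1 -> br x x = 0.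
Proof.
move=> hx ne; have e : th a a = 1 by case: (th_self a) ne => // ->; rewrite eqxx.
have := skew hx hx; rewrite e scale1r => /eqP.
by rewrite -addr_eq0 -mulr2n -scaler_nat scaler_eq0 pnatr_eq0 /= => /eqP.
Qed.

Lemma br_sq_ad a x z : hom a x ->
  br (br x x) z = (1 - th a a) *: br x (br x z).
Proof. by move=> hx; rewrite (br_assoc _ hx hx) scalerBl scale1r. Qed.

(** For odd x, skew-symmetry and Jacobi give [x, [x, x]] = -2 [x, [x, x]], and 3 is invertible in
    characteristic 0. *)
Lemma br_cube a x : hom a x -> br x (br x x) = 0.
Proof.
move=> hx; have [e|e] := eqVneq (th a a) (-1); last first.
  by rewrite (br_even hx e) br0r.
have h1 := skew hx (hom_br hx hx).
rewrite (br_sq_ad _ hx) thDr e in h1.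
move: h1; rewrite opprK mulrNN mulr1 scale1r scalerDl scale1r => /eqP.
rewrite -addr_eq0 -mulr2n -mulrS -scaler_nat scaler_eq0 pnatr_eq0 /=.
by move/eqP.
Qed.

Local Notation letter := (letter Q L).
Local Notation lcom := (lcom br).
Local Notation sq := (sq br).
Local Notation is_odd := (is_odd th).
Local Notation fresh := (fresh br).
Local Notation elimination := (elimination br).
Local Notation plus := (plus br th).

Variables (N : nat) (htq : Q -> int).
Hypothesis htqD : forall a b, htq (a + b) = htq a + htq b.

Definition wf (a : letter) :=
  [/\ hom (qd a) (el a), htq (qd a) = (ht a)%:Z & (0 < ht a)%N].

Lemma wf_lcom a b : wf a -> wf b -> wf (lcom a b).
Proof.
move=> [h1 h2 h3] [k1 k2 k3]; split; first exact: hom_br.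
  by rewrite /= htqD h2 k2 ht_lcom PoszD.
by rewrite ht_lcom addn_gt0 h3.
Qed.

(* The span of the iterated brackets of letters of [A] of degree [q] and weight
   at least [w]; everything of height above [N] is thrown in, which makes the
   truncation in [elimination] harmless. *)
Inductive fil (A : seq letter) : Q -> nat -> L -> Prop :=
| fil_let a w : a \in A -> (w <= wt a)%N -> fil A (qd a) w (el a)
| fil_ad a q w w1 z : a \in A -> fil A q w1 z -> (w <= wt a + w1)%N ->
    fil A (qd a + q) w (br (el a) z)
| fil_lin c q w z1 z2 : fil A q w z1 -> fil A q w z2 -> fil A q w (c *: z1 + z2)
| fil_0 q w : fil A q w 0
| fil_big q w z : hom q z -> N%:Z < htq q -> fil A q w z.

Lemma filZ A c q w z : fil A q w z -> fil A q w (c *: z).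
Proof. by move=> h; rewrite -[_ *: _]addr0; apply: fil_lin => //; apply: fil_0. Qed.

Lemma filD A q w z1 z2 : fil A q w z1 -> fil A q w z2 -> fil A q w (z1 + z2).
Proof. by move=> h1 h2; rewrite -[z1]scale1r; apply: fil_lin. Qed.

Section Base.
Variable A : seq letter.
Hypothesis wfA : forall a, a \in A -> wf a.

Lemma fil_hom q w z : fil A q w z -> hom q z.
Proof.
elim=> {q w z} //.
- by move=> a w /wfA[].
- by move=> a q w w1 z /wfA[h _ _] _ hz _; apply: hom_br.
- by move=> c q w z1 z2 _ h1 _ h2; apply: hom_lin.
Qed.

(** This keeps the truncation consistent: bracketing an element of height above N with a nonzero
    element of [fil] stays above N. *)
Lemma fil_pos q w z : fil A q w z -> z = 0 \/ 0 < htq q.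
Proof.
elim=> {q w z}.
- by move=> a w /wfA[_ -> h] _; right.
- move=> a q w w1 z /wfA[_ h1 h2] _ [->|h] _; first by rewrite br0r; left.
  by right; rewrite htqD h1; lia.
- move=> c q w z1 z2 _ [->|h] _ [->|h']; try by right.
  by left; rewrite scaler0 addr0.
- by left.
- by move=> q w z _ h; right; lia.
Qed.

(** Induction on the left factor: Jacobi rewrites [[a, z1], z2] through [a, [z1, z2]] and [z1,
    [a, z2]], so right-normed brackets suffice, and the weights add up. *)
Lemma fil_br q1 w1 z1 q2 w2 z2 w : fil A q1 w1 z1 -> fil A q2 w2 z2 ->
  (w <= w1 + w2)%N -> fil A (q1 + q2) w (br z1 z2).
Proof.
move=> h1; elim: h1 q2 w2 z2 w => {q1 w1 z1}.
- by move=> a w1 aA hw q2 w2 z2 w h2 h; apply: (fil_ad aA h2); lia.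
- move=> a q1 w1 w1' z1 aA h1 IH hw q2 w2 z2 w h2 h.
  have [ha _ _] := wfA aA; rewrite (br_assoc _ ha (fil_hom h1)) -scaleNr.
  rewrite [X in fil _ _ _ X]addrC.
  apply: fil_lin.
    rewrite -addrA addrCA; apply: (IH _ (wt a + w2)%N).
      by apply: (fil_ad aA h2).
    lia.
  rewrite -addrA; apply: (fil_ad aA (w1 := (w1' + w2)%N)); first exact: (IH _ w2).
  lia.
- move=> c q w1 z1 z1' _ IH1 _ IH2 q2 w2 z2 w h2 h.
  by rewrite brPl; apply: fil_lin; [apply: (IH1 _ w2)|apply: (IH2 _ w2)].
- by move=> q1 w1 q2 w2 z2 w _ _; rewrite br0l; apply: fil_0.
- move=> q1 w1 z1 hz hq q2 w2 z2 w h2 _.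
  have [->|h] := fil_pos h2; first by rewrite br0r; apply: fil_0.
  by apply: fil_big; [apply: hom_br => //; apply: fil_hom h2|rewrite htqD; lia].
Qed.

End Base.

(** * One elimination step inside the Lie superalgebra *)

Section Step.
Variables (x : letter) (Y : seq letter).
Hypothesis wfx : wf x.
Hypothesis wfY : forall y, y \in Y -> wf y.
Local Notation A' := (Y ++ fresh N x Y).

Lemma wf_iter k y : wf y -> wf (iter k (lcom x) y).
Proof. by move=> hy; elim: k => //= k IH; apply: wf_lcom. Qed.

Lemma wf_fresh z : z \in A' -> wf z.
Proof. by move=> /freshP [k [y [/wfY hy ->]]]; apply: wf_iter. Qed.

Lemma fil_iter k y w : y \in Y -> (w <= wt (iter k (lcom x) y))%N ->
  fil A' (qd (iter k (lcom x) y)) w (el (iter k (lcom x) y)).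
Proof.
move=> yY hw; have [hN|hN] := leqP (ht (iter k (lcom x) y)) N.
  by apply: fil_let => //; apply: mem_fresh => //; case: wfx.
have [h1 h2 _] := wf_iter k (wfY yY).
by apply: fil_big => //; rewrite h2.
Qed.

(** On a letter (ad x)^k y the exponent grows by one, and a letter that leaves the truncation is
    covered by [fil_big]; Jacobi extends this to brackets. So the subalgebra of the new letters is
    stable under ad x. *)
Lemma fil_ad_elim q w1 w z : fil A' q w1 z -> (w <= wt x + w1)%N ->
  fil A' (qd x + q) w (br (el x) z).
Proof.
have [hx hqx hx0] := wfx.
move=> h; elim: h w => {q w1 z}.
- move=> a w1 /freshP[k [y [yY ->]]] h w hw.
  by apply: (@fil_iter k.+1 y) => //=; lia.
- move=> a q w1 w2 z aA hz IH h w hw.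
  have [ha _ _] := wf_fresh aA; have [k [y [yY ea]]] := freshP aA.
  rewrite (jacobi _ hx ha) [X in fil _ _ _ X]addrC addrA; apply: fil_lin; last first.
    apply: (fil_br wf_fresh (w1 := (wt x + wt a)%N) (w2 := w2)) => //; last by lia.
    by rewrite ea; apply: (@fil_iter k.+1 y).
  rewrite [qd x + qd a]addrC -addrA.
  by apply: (fil_ad aA (w1 := (wt x + w2)%N)); [apply: IH|lia].
- by move=> c q w1 z1 z2 _ IH1 _ IH2 w hw; rewrite brPr; apply: fil_lin;
    [apply: IH1|apply: IH2].
- by move=> *; rewrite br0r; apply: fil_0.
- move=> q w1 z hz hq w _; apply: fil_big; first exact: hom_br.
  by rewrite htqD hqx; lia.
Qed.

(** What x generates alone is spanned by x and, for odd x, [x, x], since the next bracket [x,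
    [x, x]] is 0. *)
Inductive split : Q -> nat -> L -> Prop :=
| split_x w : (w <= wt x)%N -> split (qd x) w (el x)
| split_xx w : is_odd x -> (w <= wt x + wt x)%N ->
    split (qd x + qd x) w (br (el x) (el x))
| split_fil q w z : fil A' q w z -> split q w z
| split_lin c q w z1 z2 : split q w z1 -> split q w z2 -> split q w (c *: z1 + z2).

Lemma split_ad a q w1 w z : a \in x :: Y -> split q w1 z -> (w <= wt a + w1)%N ->
  split (qd a + q) w (br (el a) z).
Proof.
have [hx hqx hx0] := wfx.
rewrite inE => + h; elim: h w => {q w1 z}.
- move=> w1 h w /orP[/eqP ->|aY] hw.
    have [xo|xo] := boolP (is_odd x); first by apply: split_xx => //; lia.
    by rewrite (br_even hx xo); apply/split_fil/fil_0.
  (* [y, x] is a multiple of the new letter with exponent 1; in the next case [y, [x, x]] is a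
     multiple of the one with exponent 2. *)
  have [ha _ _] := wfY aY; rewrite (skew ha hx) -scaleNr addrC.
  by apply/split_fil/filZ; apply: (@fil_iter 1 a) => //=; lia.
- move=> w1 xo h w /orP[/eqP ->|aY] hw.
    by rewrite (br_cube hx); apply/split_fil/fil_0.
  have [ha _ _] := wfY aY; rewrite (skew ha (hom_br hx hx)) -scaleNr.
  rewrite (br_sq_ad _ hx) addrC -addrA.
  by apply/split_fil/filZ/filZ; apply: (@fil_iter 2 a) => //=; lia.
- move=> q w1 z hz w /orP[/eqP ->|aY] hw; apply: split_fil.
    exact: (fil_ad_elim hz).
  by apply: (fil_ad (w1 := w1)) => //; rewrite mem_cat aY.
- move=> c q w1 z1 z2 _ IH1 _ IH2 w ha hw.
  by rewrite brPr; apply: split_lin; [apply: IH1|apply: IH2].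
Qed.

Lemma fil_split q w z : fil (x :: Y) q w z -> split q w z.
Proof.
elim=> {q w z}.
- move=> a w; rewrite inE => /orP[/eqP ->|aY] h; first exact: split_x.
  by apply/split_fil/fil_let => //; rewrite mem_cat aY.
- by move=> a q w w1 z aA _ IH h; apply: (split_ad aA IH).
- by move=> c q w z1 z2 _ h1 _ h2; apply: split_lin.
- by move=> q w; apply/split_fil/fil_0.
- by move=> q w z hz hq; apply/split_fil/fil_big.
Qed.

End Step.

Definition from E q w (z : L) :=
  exists2 e, e \in plus E & [/\ qd e = q, (w <= wt e)%N & z = el e].

(** The bound on the weight has to survive the passage to the basis elements: the error terms of the
    automorphism are known only as members of [fil] of higher weight. *)
Lemma fil_span A E : elimination N A E -> (forall a, a \in A -> wf a) ->
  forall q w z, fil A q w z -> htq q <= N%:Z -> lspan (from E q w) z.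
Proof.
elim=> [|x Y E' _ IH] hA q w z.
  move=> h; elim: h => {q w z} //.
  - move=> c q w z1 z2 _ h1 _ h2 hq; apply: lspan_lin; [exact: h1|exact: h2].
  - by move=> q w _; apply: lspan_0.
  - by move=> q w z _; lia.
have wx : wf x by apply: hA; rewrite mem_head.
have wY y : y \in Y -> wf y by move=> h; apply: hA; rewrite inE h orbT.
move=> /(fil_split wx wY); elim=> {q w z}.
- move=> w h _; apply: lspan_in; exists x; last by split.
  by rewrite /= mem_cat mem_head orbT.
- move=> w xo h _.
  rewrite -[br _ _]scale1r -(divff (x := 2)) ?pnatr_eq0 // -scalerA.
  apply/lspanZ/lspan_in; exists (sq x); last by split.
  by rewrite /= xo mem_cat !inE eqxx !orbT.
- move=> q w z h hq; have := IH (wf_fresh wx wY) _ _ _ h hq.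
  apply: lspan_sub => y [e eE he]; exists e => //.
  by rewrite /= mem_cat eE.
- by move=> c q w z1 z2 _ h1 _ h2 hq; apply: lspan_lin; [apply: h1|apply: h2].
Qed.

(** * Automorphisms that are triangular for the weight *)

Section Triangular.
Variables (A : seq letter) (phi : {linear L -> L}) (d : nat) (neg : L -> Prop).
Hypothesis wfA : forall a, a \in A -> wf a.
Hypothesis neg_br : forall x y, neg x -> neg y -> neg (br x y).
Hypothesis phi_br : forall x y, neg x -> neg y ->
  phi (br x y) = br (phi x) (phi y).

Definition triangular (a : letter) :=
  [/\ neg (el a), fil A (qd a) (wt a) (el a) &
      fil A (qd a) (wt a).+1 (phi (el a) - lam a ^+ d *: el a)].

(** With phi a = s a + a' and phi b = t b + b', every term of [phi a, phi b] except s t [a, b]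
    contains a' or b', hence has weight above the sum of the two weights. *)
Lemma triangular_lcom a b : triangular a -> triangular b -> triangular (lcom a b).
Proof.
move=> [na fa ta] [nb fb tb]; split; first exact: neg_br.
  exact: (fil_br wfA fa fb).
rewrite /= phi_br // exprMn.
set a' := _ - _ in ta; set b' := _ - _ in tb.
have ea : phi (el a) = lam a ^+ d *: el a + a' by rewrite addrC subrK.
have eb : phi (el b) = lam b ^+ d *: el b + b' by rewrite addrC subrK.
rewrite ea eb brPl !brPr scalerDr scalerA addrAC [X in X - _]addrC addrK.
apply: filD; first by apply/filZ/(fil_br wfA fa tb); lia.
apply: filD; first by apply/filZ/(fil_br wfA ta fb); lia.
by apply: (fil_br wfA ta tb); lia.
Qed.

Lemma triangular_sq a : triangular a ->
  fil A (qd (sq a)) (wt (sq a)).+1 (phi (el (sq a)) - lam (sq a) ^+ d *: el (sq a)).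
Proof.
move=> ta; have [_ _ h] := triangular_lcom ta ta.
rewrite /= linearZ /= scalerA mulrC -scalerA -scalerBr; apply: filZ; exact: h.
Qed.

Lemma triangular_plus E : elimination N A E -> (forall a, a \in A -> triangular a) ->
  forall e, e \in plus E ->
  fil A (qd e) (wt e).+1 (phi (el e) - lam e ^+ d *: el e).
Proof.
move=> hE hA z /mem_plus [e eE he].
have te := elimination_all triangular_lcom hE hA eE.
case: he => [->|[_ ->]]; first by case: te.
exact: triangular_sq.
Qed.

End Triangular.

Lemma plus_wf A E : elimination N A E -> (forall a, a \in A -> wf a) ->
  forall e, e \in plus E -> hom (qd e) (el e).
Proof.
move=> hE hA z /mem_plus [e eE he].
have [h _ _] := elimination_all wf_lcom hE hA eE.
by case: he => [->|[_ ->]] //; apply/homZ/hom_br.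
Qed.

(** * Ordered monomials acting on a vector *)

Section Module.
Variables (T : lmodType K) (act : L -> T -> T) (v0 : T).
Hypothesis actPl : forall c x y t, act (c *: x + y) t = c *: act x t + act y t.
Hypothesis actPr : forall c x s t, act x (c *: s + t) = c *: act x s + act x t.
Hypothesis act_br : forall a b x y t, hom a x -> hom b y ->
  act (br x y) t = act x (act y t) - th a b *: act y (act x t).

Inductive prods (A : seq letter) : nat -> nat -> T -> Prop :=
| prods_1 : prods A 0 0 v0
| prods_act a m n t : a \in A -> prods A m n t ->
    prods A (dm a + m)%N (dn a + n)%N (act (el a) t)
| prods_0 m n : prods A m n 0
| prods_lin c m n s t : prods A m n s -> prods A m n t ->
    prods A m n (c *: s + t).

(** The letter eliminated first stands leftmost. Odd letters take all exponents too: their squares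
    are the action of the elements [sq], which therefore are no factors of their own. Exponents up
    to N suffice, the height of a letter being positive. *)
Fixpoint mon (E : seq letter) m n : seq T :=
  if E is x :: E' then
    flatten [seq [seq iter k (act (el x)) z
                  | z <- mon E' (m - k * dm x)%N (n - k * dn x)%N]
             | k <- iota 0 N.+1 & (k * dm x <= m)%N && (k * dn x <= n)%N]
  else if (m == 0)%N && (n == 0)%N then [:: v0] else [::].

Lemma act0r x : act x 0 = 0.
Proof. by have := actPr (-1) x 0 0; rewrite scaler0 addr0 scaleN1r addNr. Qed.

Lemma act0l t : act 0 t = 0.
Proof. by have := actPl (-1) 0 0 t; rewrite scaler0 addr0 scaleN1r addNr. Qed.

Lemma actZl c x t : act (c *: x) t = c *: act x t.
Proof. by have := actPl c x 0 t; rewrite !addr0 act0l addr0. Qed.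

Section Step.
Variables (x : letter) (Y : seq letter).
Hypothesis wfx : wf x.
Hypothesis wfY : forall y, y \in Y -> wf y.
Local Notation A' := (Y ++ fresh N x Y).

Inductive xprods : nat -> nat -> T -> Prop :=
| xprods_in m n t : prods A' m n t -> xprods m n t
| xprods_x m n t : xprods m n t ->
    xprods (dm x + m)%N (dn x + n)%N (act (el x) t)
| xprods_lin c m n s t : xprods m n s -> xprods m n t ->
    xprods m n (c *: s + t).

(** The letter a is moved to the right past x: a x = th(x, a)^-1 (x a - [x, a]), and [x, a] is again
    an iterated bracket with one more x. The bound on the total height keeps all letters met on the
    way within the truncation. *)
Lemma xprods_iter y m n t : y \in Y -> xprods m n t -> forall k a,
  a = iter k (lcom x) y -> (ht a + m + n <= N)%N ->
  xprods (dm a + m)%N (dn a + n)%N (act (el a) t).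
Proof.
have [hx _ hx0] := wfx.
move=> yY; elim=> {m n t}.
- move=> m n t h k a ea hN; apply/xprods_in/prods_act => //.
  by rewrite ea; apply: mem_fresh => //; rewrite -ea; lia.
- move=> m n t h IH k a ea hN.
  have [ha _ _] : wf a by rewrite ea; apply: wf_iter => //; apply: wfY.
  have e : act (el a) (act (el x) t) = (th (qd x) (qd a))^-1 *:
      (act (el x) (act (el a) t) - act (el (lcom x a)) t).
    rewrite (act_br _ hx ha) opprB addrC subrK scalerA mulVf ?scale1r //.
    exact: th_neq0.
  have x0 : xprods (dm a + (dm x + m))%N (dn a + (dn x + n))%N 0.
    exact/xprods_in/prods_0.
  rewrite e -[_ *: _]addr0; apply: xprods_lin => //.
  rewrite addrC -scaleN1r; apply: xprods_lin.
    rewrite addnA [(dm a + _)%N]addnC [in X in xprods _ X]addnA.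
    rewrite [(dn a + dn x)%N]addnC.
    apply: (IH k.+1 (lcom x a)); first by rewrite ea.
    by rewrite ht_lcom; move: hN; rewrite /ht; lia.
  rewrite addnCA [(dn a + _)%N]addnCA.
  by apply/xprods_x/(IH k a) => //; lia.
- move=> c m n s t _ IH1 _ IH2 k a ea hN; rewrite actPr.
  by apply: xprods_lin; [apply: (IH1 k)|apply: (IH2 k)].
Qed.

Lemma prods_xprods m n t : prods (x :: Y) m n t -> (m + n <= N)%N ->
  xprods m n t.
Proof.
elim=> {m n t}.
- by move=> _; apply/xprods_in/prods_1.
- move=> a m n t; rewrite inE => /orP[/eqP ->|aY] _ IH hN.
    by apply/xprods_x/IH; lia.
  apply: (xprods_iter aY _ (k := 0)) => //; first by apply: IH; lia.
  by move: hN; rewrite /ht; lia.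
- by move=> m n _; apply/xprods_in/prods_0.
- by move=> c m n s t _ IH1 _ IH2 hN; apply: xprods_lin; [apply: IH1|apply: IH2].
Qed.

Lemma mem_mon E k m n z : (0 < ht x)%N -> (k * dm x <= m)%N -> (k * dn x <= n)%N ->
  (m + n <= N)%N -> z \in mon E (m - k * dm x)%N (n - k * dn x)%N ->
  iter k (act (el x)) z \in mon (x :: E) m n.
Proof.
move=> x0 hm hn hN hz; apply/flatten_mapP; exists k; last exact: map_f.
by rewrite mem_filter hm hn mem_iota /=; move: x0; rewrite /ht; nia.
Qed.

Lemma xprods_mon E m n t :
  (forall m n t, prods A' m n t -> (m + n <= N)%N ->
     lspan (fun z => z \in mon E m n) t) ->
  xprods m n t -> (m + n <= N)%N -> lspan (fun z => z \in mon (x :: E) m n) t.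
Proof.
have [_ _ hx0] := wfx.
move=> hE; elim=> {m n t}.
- move=> m n t /hE h hN; apply: lspan_sub (h hN) => z hz.
  by apply: (@mem_mon E 0 m n z); rewrite ?subn0.
- move=> m n t _ IH hN.
  have {}IH : lspan (fun z => z \in mon (x :: E) m n) t by apply: IH; lia.
  elim: IH => [z||c y z _ h1 _ h2].
  + move=> /flatten_mapP [k]; rewrite mem_filter => /andP[/andP[h1 h2] _].
    move=> /mapP [z' hz' ->]; rewrite -iterS.
    by apply/lspan_in/mem_mon => //; rewrite ?mulSn ?leq_add2l // !subnDl.
  + by rewrite act0r; apply: lspan_0.
  + by rewrite actPr; apply: lspan_lin.
- by move=> c m n s t _ h1 _ h2 hN; apply: lspan_lin; [exact: h1|exact: h2].
Qed.

End Step.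

Lemma prods_mon A E : elimination N A E -> (forall a, a \in A -> wf a) ->
  forall m n t, prods A m n t -> (m + n <= N)%N ->
  lspan (fun z => z \in mon E m n) t.
Proof.
elim=> [|x Y E' _ IH] hA m n t.
  elim=> {m n t} //.
  - by move=> _; apply/lspan_in; rewrite /= mem_head.
  - by move=> m n _; apply: lspan_0.
  - by move=> c m n s t _ h1 _ h2 hN; apply: lspan_lin; [exact: h1|exact: h2].
have wx : wf x by apply: hA; rewrite mem_head.
have wY y : y \in Y -> wf y by move=> h; apply: hA; rewrite inE h orbT.
move=> h hN; apply: (xprods_mon (Y := Y)) => //; last exact: prods_xprods.
exact/IH/wf_fresh.
Qed.

Lemma mon00 E : (forall e, e \in E -> (0 < ht e)%N) -> mon E 0 0 = [:: v0].
Proof.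
elim: E => //= x E IH hE; rewrite !sub0n map_id IH; last first.
  by move=> e eE; apply: hE; rewrite inE eE orbT.
rewrite (_ : [seq k <- iota 1 N | _] = [::]) //.
apply/eqP; rewrite -[_ == _]negbK -has_filter; apply/hasPn => k.
have := hE x (mem_head _ _); rewrite mem_iota /ht; nia.
Qed.

(** The monomials with a single letter at exponent 1, or an odd one at exponent 2, are the values of
    the basis elements at [v0]. Independence of all monomials thus passes to the basis. *)
Lemma subseq_mon E m n : (m + n <= N)%N -> (0 < m + n)%N ->
  (forall e, e \in E -> wf e) ->
  subseq [seq act (el e) v0 | e <- plus E & (dm e == m) && (dn e == n)] (mon E m n).
Proof.
move=> hN h0; elim: E => [|x E IH] hE; first by rewrite sub0seq.
have [hx _ x0] := hE x (mem_head _ _).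
have {}hE e : e \in E -> wf e by move=> eE; apply: hE; rewrite inE eE orbT.
have hE' e : e \in E -> (0 < ht e)%N by move=> /hE[].
rewrite [plus _]/= filter_cat map_cat.
have -> : mon (x :: E) m n = mon E m n ++
  flatten [seq [seq iter k (act (el x)) z
                  | z <- mon E (m - k * dm x)%N (n - k * dn x)%N]
             | k <- iota 1 N & (k * dm x <= m)%N && (k * dn x <= n)%N].
  by rewrite /= !subn0 map_id.
apply: cat_subseq; first exact: IH.
have memk k : (0 < k)%N -> m = (k * dm x)%N -> n = (k * dn x)%N ->
   k \in [seq k <- iota 1 N | (k * dm x <= m)%N && (k * dn x <= n)%N].
  move=> k0 em en; rewrite mem_filter em en !leqnn mem_iota k0 /=.
  by move: x0; rewrite /ht; nia.
have sub k : (0 < k)%N -> m = (k * dm x)%N -> n = (k * dn x)%N ->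
  subseq [:: iter k (act (el x)) v0]
   (flatten [seq [seq iter k (act (el x)) z
                  | z <- mon E (m - k * dm x)%N (n - k * dn x)%N]
             | k <- iota 1 N & (k * dm x <= m)%N && (k * dn x <= n)%N]).
  move=> k0 em en; rewrite sub1seq; apply/flatten_mapP; exists k; first exact: memk.
  by rewrite -em -en !subnn mon00 //= mem_head.
rewrite [filter _ _]/=; case: ifP => [/andP[/eqP em /eqP en]|_].
  (* A letter and its square never share a bidegree, the height being positive. *)
  rewrite (_ : filter _ _ = [::]); first by apply: (sub 1%N); rewrite ?mul1n.
  case: ifP => //= _; case: andP => // -[/eqP em2 /eqP en2].
  by move: x0 em2 en2; rewrite /ht -em -en; lia.
case: ifP => xo; last by rewrite sub0seq.
rewrite /=; case: andP => [[/eqP em /eqP en]|_]; last by rewrite sub0seq.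
(* For odd x the bracket [x, x] acts as twice the square of x, which the factor 1/2 in [sq]
   compensates. *)
rewrite /= actZl (act_br _ hx hx) (eqP xo) scaleN1r opprK -mulr2n.
rewrite -scaler_nat scalerA mulVf ?pnatr_eq0 // scale1r.
by apply: (sub 2%N) => //; lia.
Qed.

End Module.

(** * Generating functions under elimination *)

Section Series.
Variable nu : letter -> K.
Hypothesis nuM : forall x y, nu (lcom x y) = nu x * nu y.

Definition mu a := mono (dm a) (dn a) (nu a).
Definition gf A := \sum_(a <- A) mu a.

Lemma mu_lcom x y : mu (lcom x y) = mu x * mu y.
Proof. by rewrite /mu monoM nuM. Qed.

Lemma mu_iter k x y : mu (iter k (lcom x) y) = mu x ^+ k * mu y.
Proof. by elim: k => [|k IH]; rewrite ?mul1r // iterS mu_lcom IH exprS mulrA. Qed.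

Lemma vanish_gf A : (forall a, a \in A -> (0 < ht a)%N) -> vanish 1 (gf A).
Proof.
move=> hA; rewrite /gf big_seq; apply: vanish_sum => a aA.
by apply: vanish_mono; apply: hA.
Qed.

Lemma gf_fresh x Y : eqtr N (gf (Y ++ fresh N x Y)) (geo N (mu x) * gf Y).
Proof.
rewrite /gf big_cat /= big_filter.
have e : eqtr N (\sum_(z <- [seq iter k (lcom x) y | k <- iota 1 N, y <- Y]
                         | (ht z <= N)%N) mu z)
  (\sum_(z <- [seq iter k (lcom x) y | k <- iota 1 N, y <- Y]) mu z).
  rewrite /eqtr [X in _ - X](bigID (fun z => (ht z <= N)%N)) /= opprD addrA.
  rewrite subrr add0r; apply/vanishN/vanish_sum => z; rewrite -ltnNge => h.
  exact: vanish_mono.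
apply: eqtr_trans (eqtrD (eqtr_refl _) e) _.
rewrite big_allpairs_dep /= /geo big_ord_recl mulrDl mul1r.
apply: eqtrD (eqtr_refl _) _.
rewrite mulr_suml.
have -> : \sum_(i < N) mu x ^+ lift ord0 i * \sum_(y <- Y) mu y =
    \sum_(1 <= k < N.+1) mu x ^+ k * \sum_(y <- Y) mu y.
  by rewrite big_add1 /= big_mkord.
rewrite /index_iota subn1 /=.
have -> : \sum_(k <- iota 1 N) \sum_(y <- Y) mu (iter k (lcom x) y) =
    \sum_(k <- iota 1 N) mu x ^+ k * \sum_(y <- Y) mu y.
  apply: eq_bigr => k _; rewrite mulr_sumr; apply: eq_bigr => y _.
  exact: mu_iter.
exact: eqtr_refl.
Qed.

(** The product formula will count the ordered monomials, with all [nu] equal to 1; the sum of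
    logarithmic derivatives will carry the supertraces. *)
Lemma gf_elimination A E : elimination N A E ->
  (forall a, a \in A -> (0 < ht a)%N) ->
  eqtr N (geo N (gf A)) (\prod_(e <- E) geo N (mu e)) /\
  eqtr N (dlog N (gf A)) (\sum_(e <- E) dlog N (mu e)).
Proof.
elim=> [|x Y E' _ IH] hA.
  rewrite !big_nil /gf big_nil /geo /dlog; split.
    rewrite big_ord_recl big1 ?addr0; first exact: eqtr_refl.
    by move=> i _; rewrite exprS mul0r.
  rewrite /euler deriv0 mulr0 mul0r; exact: eqtr_refl.
have x0 : (0 < ht x)%N by apply: hA; rewrite mem_head.
have hY y : y \in Y -> (0 < ht y)%N by move=> h; apply: hA; rewrite inE h orbT.
have hA' z : z \in Y ++ fresh N x Y -> (0 < ht z)%N.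
  by move=> /freshP[k [y [yY ->]]]; rewrite ht_iter; have := hY _ yY; lia.
have [h1 h2] := IH hA'.
have vx : vanish 1 (mu x) by apply: vanish_mono.
have step : eqtr N (gf (Y ++ fresh N x Y) * (1 - mu x)) (gf Y).
  apply: eqtr_trans (eqtrM (gf_fresh x Y) (eqtr_refl _)) _.
  rewrite mulrAC -[X in eqtr _ _ X]mul1r [geo _ _ * _]mulrC.
  by apply: eqtrM (eqtr_refl _); apply: geoP.
have := geo_step vx (vanish_gf hY) (vanish_gf hA') step.
have := dlog_step vx (vanish_gf hY) (vanish_gf hA') step.
have <- : gf (x :: Y) = mu x + gf Y by rewrite /gf big_cons.
rewrite !big_cons => e2 e1; split.
  exact: eqtr_trans e1 (eqtrM (eqtr_refl _) h1).
exact: eqtr_trans e2 (eqtrD (eqtr_refl _) h2).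
Qed.

End Series.

End ColoredLie.

(** * Modules over a presented algebra *)

Section Lin.
Variables (K : fieldType) (U V W : lmodType K).

Definition lin (g : U -> V) := forall c u v, g (c *: u + v) = c *: g u + g v.

Lemma lin_0 : lin (fun=> 0).
Proof. by move=> c u v; rewrite scaler0 addr0. Qed.

Lemma lin_comb a g1 g2 : lin g1 -> lin g2 -> lin (fun x => a *: g1 x + g2 x).
Proof.
move=> h1 h2 c u v; rewrite h1 h2 scalerDr addrACA scalerA.
by rewrite [in RHS]scalerDr scalerA [c * a]mulrC.
Qed.

Lemma lin_eq (g g' : U -> V) (S : U -> Prop) u : lin g -> lin g' -> lspan S u ->
  (forall v, S v -> g v = g' v) -> g u = g' u.
Proof.
move=> lg lg' hu h; elim: hu => [v /h//||c y z _ h1 _ h2]; last by rewrite lg lg' h1 h2.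
have z0 (f : U -> V) : lin f -> f 0 = 0.
  by move=> lf; have := lf (-1) 0 0; rewrite scaler0 addr0 scaleN1r addNr.
by rewrite !z0.
Qed.

End Lin.

Lemma lin_comp (K : fieldType) (U V W : lmodType K) (f : V -> W) (g : U -> V) :
  lin f -> lin g -> lin (fun x => f (g x)).
Proof. by move=> lf lg c u v; rewrite lg lf. Qed.

Section Lift.
Variables (K : fieldType) (X : choiceType) (V : lmodType K).
Implicit Types (u v : {malg K[X]}) (h : X -> V).

Definition lift h u : V := \sum_(w <- msupp u) u@_w *: h w.

Lemma liftEw h (d : {fset X}) u : (msupp u `<=` d)%fset ->
  lift h u = \sum_(w <- d) u@_w *: h w.
Proof.
move=> le; rewrite /lift (big_fset_incl _ le) //= => w _ /mcoeff_outdom ->.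
by rewrite scale0r.
Qed.

Lemma lift_lin h c u v : lift h (c *: u + v) = c *: lift h u + lift h v.
Proof.
pose d := (msupp (c *: u + v) `|` (msupp u `|` msupp v))%fset.
have h0 : (msupp (c *: u + v) `<=` d)%fset by rewrite fsubsetUl.
have h1 : (msupp u `<=` d)%fset.
  by apply: fsubset_trans (fsubsetUr _ _); rewrite fsubsetUl.
have h2 : (msupp v `<=` d)%fset.
  by apply: fsubset_trans (fsubsetUr _ _); rewrite fsubsetUr.
rewrite (liftEw _ h0) (liftEw _ h1) (liftEw _ h2) scaler_sumr -big_split /=.
apply: eq_bigr => w _.
by rewrite [X in X *: _]mcoeffD [X in (X + _) *: _]mcoeffZ scalerDl scalerA.
Qed.

Lemma liftU h w : lift h << 1 *g w >> = h w.
Proof.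
rewrite (liftEw _ (d := [fset w]%fset)) ?msuppU_le // big_seq_fset1.
by rewrite mcoeffUU scale1r.
Qed.

Lemma lift0 h : lift h 0 = 0.
Proof. by rewrite /lift msupp0 big_seq_fset0. Qed.

End Lift.

Section Monomials.
Variables (K : fieldType) (X : choiceType).
Implicit Types (u v : {malg K[X]}).

Lemma malg_lspan u :
  lspan (fun z => exists2 w, w \in msupp u & z = << 1 *g w >>) u.
Proof.
set P := fun z => _.
have -> : u = \sum_(w <- msupp u) u@_w *: << 1 *g w >>.
  rewrite {1}[u]monalgE; apply: eq_bigr => w _; apply/malgP => k.
  by rewrite mcoeffZ 2!mcoeffU; case: eqP; rewrite ?mulr1n ?mulr0n ?mulr1 ?mulr0.
rewrite big_seq; elim/big_rec: _ => [|w z wu hz]; first exact: lspan_0.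
by apply: lspan_lin => //; apply: lspan_in; exists w.
Qed.

Lemma malg_lspanT u : lspan (fun z => exists w, z = << 1 *g w >>) u.
Proof. by apply: lspan_sub (malg_lspan u) => z [w _ ->]; exists w. Qed.

Lemma lift_ext (V : lmodType K) (f g : {malg K[X]} -> V) :
  (forall c u v, f (c *: u + v) = c *: f u + f v) ->
  (forall c u v, g (c *: u + v) = c *: g u + g v) ->
  (forall w, f << 1 *g w >> = g << 1 *g w >>) -> f =1 g.
Proof.
move=> lf lg h u.
have f0 : f 0 = 0 by have := lf (-1) 0 0; rewrite scaler0 addr0 scaleN1r addNr.
have g0 : g 0 = 0 by have := lg (-1) 0 0; rewrite scaler0 addr0 scaleN1r addNr.
elim: (malg_lspanT u) => [z [w ->]||c y z _ h1 _ h2]; first exact: h.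
  by rewrite f0 g0.
by rewrite lf lg h1 h2.
Qed.

End Monomials.

Section FreeMonomials.
Variables (K : fieldType) (X : choiceType).
Local Notation FA := {malg K[magma X]}.

Lemma fbrUU (a b : magma X) :
  fbr (<< 1 *g a >> : FA) << 1 *g b >> = << 1 *g Node a b >>.
Proof.
rewrite (fbrEw (d1 := [fset a]%fset) (d2 := [fset b]%fset)) ?msuppU_le //.
by rewrite !big_seq_fset1 !mcoeffUU mulr1.
Qed.

Lemma iter_fbrUU n (a b : magma X) :
  iter n (fbr (<< 1 *g a >> : FA)) << 1 *g b >> = << 1 *g iter n (Node a) b >>.
Proof. by elim: n => //= n ->; rewrite fbrUU. Qed.

End FreeMonomials.

(** The Jacobi identity for colored commutators of A, B, C: the vectors stand for ABC, ACB, BCA,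
    CBA, BAC, CAB in this order, and x, x', y, z for the colors th(a, b), th(b, a), th(a, c), th(b,
    c). *)
Lemma jacobi_vectors (K : comNzRingType) (V : lmodType K) (x x' y z : K)
    (v1 v2 v3 v4 v5 v6 : V) : x * x' = 1 ->
  (v1 - z *: v2) - (x * y) *: (v3 - z *: v4) =
  ((v1 - x *: v5) - (y * z) *: (v6 - x *: v4)) +
  x *: ((v5 - y *: v3) - (x' * z) *: (v2 - y *: v6)).
Proof.
move=> e; rewrite !scalerBr !scalerA [x * (_ * _)]mulrA e mul1r.
rewrite [y * z * x]mulrC [x * (y * z)]mulrA [z * y]mulrC !opprB.
rewrite [RHS]addrACA [X in _ = X + _]addrA subrK.
rewrite [X in _ = _ + X]addrA subrK [RHS]addrACA [LHS]addrACA.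
by congr (_ + _); apply: addrC.
Qed.

Section Presented.
Variables (K : numFieldType) (Q : zmodType) (theta : Q -> Q -> K).
Variables (X : choiceType) (dg : X -> Q) (rel : {malg K[magma X]} -> Prop).
Local Notation FA := {malg K[magma X]}.
Local Notation L := (presented theta dg rel).
Local Notation br := (@bracket K Q theta X dg rel).
Local Notation mdeg := (Defs.mdeg dg).
Hypothesis thDl : forall a b c, theta (a + b) c = theta a c * theta b c.
Hypothesis thDr : forall a b c, theta a (b + c) = theta a b * theta a c.
Hypothesis thC : forall a b, theta a b * theta b a = 1.

Definition pmon (w : magma X) : L := pr theta dg rel << 1 *g w >>.

Lemma pmon_br a b : br (pmon a) (pmon b) = pmon (Node a b).
Proof. by rewrite /pmon -pr_bracket fbrUU. Qed.

Lemma pr_lin c u v : pr theta dg rel (c *: u + v) =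
  c *: pr theta dg rel u + pr theta dg rel v.
Proof. by rewrite prD prZ. Qed.

Lemma pr_0 : pr theta dg rel 0 = 0.
Proof.
have h : pr theta dg rel (0 *: 0) = 0 *: pr theta dg rel 0 by apply: prZ.
by rewrite scaler0 scale0r in h.
Qed.

Lemma supportedP (P : Q -> Prop) (u : FA) : supported dg P u <->
  lspan (fun z => exists2 w, P (mdeg w) & z = << 1 *g w >>) u.
Proof.
split=> [h|]; first by apply: lspan_sub (malg_lspan u) => z [w /h]; exists w.
elim=> [z [w hw ->]||c y z _ h1 _ h2] w'.
- by move=> /(fsubsetP msuppU_le); rewrite inE => /eqP ->.
- by rewrite msupp0 inE.
- move=> /(fsubsetP (msuppD_le _ _)); rewrite inE => /orP[|]; last exact: h2.
  by move=> /(fsubsetP (msuppZ_le _ _)); apply: h1.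
Qed.

Lemma gradedP (P : Q -> Prop) (x : L) : graded_part P x <->
  lspan (fun z => exists2 w, P (mdeg w) & z = pmon w) x.
Proof.
split=> [[u /supportedP h ->]|h].
  elim: h => [z [w hw ->]||c y z _ h1 _ h2].
  - by apply: lspan_in; exists w.
  - by rewrite pr_0; apply: lspan_0.
  - by rewrite pr_lin; apply: lspan_lin.
suff [u hu ->] : exists2 u, lspan (fun z => exists2 w, P (mdeg w) & z = << 1 *g w >>) u
   & x = pr theta dg rel u by exists u => //; apply/supportedP.
elim: h => [z [w hw ->]||c y z _ [u hu ->] _ [v hv ->]].
- by exists << 1 *g w >> => //; apply: lspan_in; exists w.
- by exists 0; [apply: lspan_0|rewrite pr_0].
- by exists (c *: u + v); [apply: lspan_lin|rewrite pr_lin].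
Qed.

Lemma graded_sub (P P' : Q -> Prop) (x : L) : (forall q, P q -> P' q) ->
  graded_part P x -> graded_part P' x.
Proof.
move=> h /gradedP hx; apply/gradedP; apply: lspan_sub hx => z [w /h hw ->].
by exists w.
Qed.

Lemma graded_pmon w : graded_part (eq^~ (mdeg w)) (pmon w).
Proof. by apply/gradedP/lspan_in; exists w. Qed.

Lemma graded_br (P1 P2 P3 : Q -> Prop) (x y : L) :
  (forall a b, P1 a -> P2 b -> P3 (a + b)) ->
  graded_part P1 x -> graded_part P2 y -> graded_part P3 (br x y).
Proof.
move=> h /gradedP hx /gradedP hy; apply/gradedP.
have b0l z : br 0 z = 0.
  by have := bracketPl (-1) (0 : L) 0 z; rewrite scaler0 addr0 scaleN1r addNr.
have b0r z : br z 0 = 0.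
  by have := bracketPr (-1) z (0 : L) 0; rewrite scaler0 addr0 scaleN1r addNr.
elim: hx => [z [w hw ->]||c z1 z2 _ h1 _ h2].
- elim: hy => [z' [w' hw' ->]||c z1 z2 _ h1 _ h2].
  + by rewrite pmon_br; apply: lspan_in; exists (Node w w') => //=; apply: h.
  + by rewrite b0r; apply: lspan_0.
  + by rewrite bracketPr; apply: lspan_lin.
- by rewrite b0l; apply: lspan_0.
- by rewrite bracketPl; apply: lspan_lin.
Qed.

Lemma presented_colored :
  colored_lie br theta (fun q => graded_part (eq^~ q) : set L).
Proof.
split=> //.
- exact: bracketPl.
- exact: bracketPr.
- by move=> q; apply/gradedP/lspan_0.
- by move=> q c x y /gradedP hx /gradedP hy; apply/gradedP/lspan_lin.
- by move=> a b x y; apply: graded_br => _ _ -> ->.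
- exact: bracket_skew.
- exact: bracket_jacobi.
Qed.

Lemma presented_lspan (x : L) : lspan (fun z => exists w, z = pmon w) x.
Proof.
rewrite -[x]rpK; elim: (malg_lspanT (rp x)) => [z [w ->]||c y z _ h1 _ h2].
- by apply: lspan_in; exists w.
- by rewrite pr_0; apply: lspan_0.
- by rewrite pr_lin; apply: lspan_lin.
Qed.

(** * From operators for the generators to an action of the presented algebra *)

Section Action.
Variables (T : lmodType K) (opg : X -> T -> T).
Hypothesis opg_lin : forall g c s t, opg g (c *: s + t) = c *: opg g s + opg g t.

Fixpoint op (w : magma X) (t : T) : T :=
  match w with
  | Leaf g => opg g t
  | Node a b => op a (op b t) - theta (mdeg a) (mdeg b) *: op b (op a t)
  end.

Lemma op_lin w c s t : op w (c *: s + t) = c *: op w s + op w t.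
Proof.
elim: w c s t => [g|a IHa b IHb] c s t /=; first exact: opg_lin.
rewrite IHb !IHa IHb scalerDr opprD scalerBr !scalerA addrACA.
by rewrite [_ * c]mulrC.
Qed.

Lemma op_0 w : op w 0 = 0.
Proof. by have := op_lin w (-1) 0 0; rewrite scaler0 addr0 scaleN1r addNr. Qed.

Lemma opZ w c t : op w (c *: t) = c *: op w t.
Proof. by have := op_lin w c t 0; rewrite !addr0 op_0 addr0. Qed.

Lemma opB w s t : op w (s - t) = op w s - op w t.
Proof. by rewrite -scaleN1r addrC op_lin scaleN1r addrC. Qed.

(* The action twisted by a function of the degree; it is for all twists at once
   that the defining ideal is seen to act by zero. *)
Definition top (f : Q -> K) (u : FA) (t : T) : T :=
  lift (fun w => f (mdeg w) *: op w t) u.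

Lemma top_lin f c u v t : top f (c *: u + v) t = c *: top f u t + top f v t.
Proof. exact: lift_lin. Qed.

Lemma topU f w t : top f << 1 *g w >> t = f (mdeg w) *: op w t.
Proof. exact: liftU. Qed.

(** The color of the commutator depends on the degree inside u, which need not be homogeneous; it is
    absorbed into the twist. Hence an induction for one fixed twist would not close. *)
Lemma top_brl f a u t : top f (fbr << 1 *g a >> u) t =
  op a (top (fun q => f (mdeg a + q)) u t) -
  top (fun q => f (mdeg a + q) * theta (mdeg a) q) u (op a t).
Proof.
move: u; apply: lift_ext => [c u v|c u v|b].
- by rewrite fbrPr top_lin.
- by rewrite 2!top_lin op_lin scalerBr opprD addrACA.
- rewrite fbrUU !topU /= scalerBr scalerA.
  by rewrite opZ.
Qed.

Lemma top_brr f u b t : top f (fbr u << 1 *g b >>) t =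
  top (fun q => f (q + mdeg b)) u (op b t) -
  op b (top (fun q => f (q + mdeg b) * theta q (mdeg b)) u t).
Proof.
move: u; apply: lift_ext => [c u v|c u v|a].
- by rewrite fbrP top_lin.
- by rewrite 2!top_lin op_lin scalerBr opprD addrACA.
- rewrite fbrUU !topU /= scalerBr scalerA; by rewrite opZ.
Qed.

Hypothesis rel0 : forall u f t, rel u -> top f u t = 0.

Lemma top_0 f t : top f 0 t = 0.
Proof. exact: lift0. Qed.

Lemma op_skew a b s : op (Node a b) s + theta (mdeg a) (mdeg b) *: op (Node b a) s = 0.
Proof. by rewrite /= scalerBr scalerA thC scale1r addrA subrK subrr. Qed.

Lemma op_jacobi a b c s :
  op (Node a (Node b c)) s = op (Node (Node a b) c) s +
    theta (mdeg a) (mdeg b) *: op (Node b (Node a c)) s.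
Proof.
rewrite /= !opB !opZ thDl 2!thDr; apply: jacobi_vectors; exact: thC.
Qed.

Lemma top_is_lin f t : lin (fun u : FA => top f u t).
Proof. by move=> c u v; apply: top_lin. Qed.

Lemma fbr_linl (y : FA) : lin (fun x => fbr x y).
Proof. by move=> c u v; exact: fbrP. Qed.

Lemma fbr_linr (x : FA) : lin (fun y => fbr x y).
Proof. by move=> c u v; exact: fbrPr. Qed.

(** The skew and Jacobi relators are multilinear, so [lin_eq] reduces them to monomials. The
    monomials that remain all have the same degree, the twist becomes a common scalar, and [op_skew]
    and [op_jacobi] apply. *)
Lemma top_ideal u : pres_ideal theta dg rel u -> forall f t, top f u t = 0.
Proof.
elim=> {u}.
- by move=> u ru f t; apply: rel0.
- move=> a b x y /supportedP hx /supportedP hy f t.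
  rewrite addrC top_lin.
  have l1 z : lin (fun x => theta a b *: top f (fbr z x) t + top f (fbr x z) t).
    by apply: lin_comb; apply: (lin_comp (top_is_lin f t));
      [apply: fbr_linr|apply: fbr_linl].
  have l2 z : lin (fun y => theta a b *: top f (fbr y z) t + top f (fbr z y) t).
    by apply: lin_comb; apply: (lin_comp (top_is_lin f t));
      [apply: fbr_linl|apply: fbr_linr].
  apply: (lin_eq (l1 y) (@lin_0 _ _ _)) hx _ => _ [v hv ->].
  apply: (lin_eq (l2 _) (@lin_0 _ _ _)) hy _ => _ [w hw ->].
  rewrite (fbrUU _ v w) (fbrUU _ w v) 2!topU.
  rewrite -[mdeg (Node v w)]/(mdeg v + mdeg w) -[mdeg (Node w v)]/(mdeg w + mdeg v).
  rewrite -hv -hw [mdeg w + _]addrC scalerA mulrC -scalerA -scalerDr.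
  by rewrite [X in _ *: X]addrC op_skew scaler0.
- move=> a b x y z /supportedP hx /supportedP hy f t.
  rewrite -scaleN1r addrC top_lin scaleN1r addrC [X in _ - top f X t]addrC top_lin.
  apply/eqP; rewrite subr_eq0; apply/eqP.
  have lT := top_is_lin f t.
  have lx y' z' : lin (fun x => theta a b *: top f (fbr y' (fbr x z')) t +
      top f (fbr (fbr x y') z') t).
    apply: lin_comb; apply: (lin_comp lT).
      by apply: (lin_comp (fbr_linr _)); apply: fbr_linl.
    by apply: (lin_comp (fbr_linl _)); apply: fbr_linl.
  have ly x' z' : lin (fun y => theta a b *: top f (fbr y (fbr x' z')) t +
      top f (fbr (fbr x' y) z') t).
    apply: lin_comb; apply: (lin_comp lT); first exact: fbr_linl.
    by apply: (lin_comp (fbr_linl _)); apply: fbr_linr.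
  have lz x' y' : lin (fun z => theta a b *: top f (fbr y' (fbr x' z)) t +
      top f (fbr (fbr x' y') z) t).
    apply: lin_comb; apply: (lin_comp lT); last exact: fbr_linr.
    by apply: (lin_comp (fbr_linr _)); apply: fbr_linr.
  apply: (lin_eq (lin_comp lT (fbr_linl _)) (lx y z)) hx _ => _ [u hu ->].
  have ly' x' : lin (fun y => top f (fbr x' (fbr y z)) t).
    by apply: (lin_comp lT); apply: (lin_comp (fbr_linr x')); apply: fbr_linl.
  apply: (lin_eq (ly' _) (ly _ z)) hy _ => _ [v hv ->].
  have lz' x' y' : lin (fun z => top f (fbr x' (fbr y' z)) t).
    by apply: (lin_comp lT); apply: (lin_comp (fbr_linr x')); apply: fbr_linr.
  apply: (lin_eq (lz' _ _) (lz _ _)) (malg_lspanT z) _ => _ [w ->].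
  rewrite (fbrUU _ v w) (fbrUU _ u (Node v w)) (fbrUU _ u v) (fbrUU _ (Node u v) w).
  rewrite (fbrUU _ u w) (fbrUU _ v (Node u w)) 3!topU -hu -hv.
  have e1 : mdeg (Node (Node u v) w) = mdeg (Node u (Node v w)) by rewrite /= addrA.
  have e2 : mdeg (Node v (Node u w)) = mdeg (Node u (Node v w)) by rewrite /= addrCA.
  by rewrite e1 e2 [in LHS]op_jacobi scalerDr scalerA mulrC -scalerA [LHS]addrC.
- by move=> f t; apply: top_0.
- by move=> c u v _ h1 _ h2 f t; rewrite top_lin h1 h2 scaler0 addr0.
- move=> u v _ IH f t.
  apply: (lin_eq (lin_comp (top_is_lin f t) (fbr_linl u)) (@lin_0 _ _ _))
    (malg_lspanT v) _.
  by move=> _ [w ->]; rewrite top_brl !IH op_0 subr0.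
- move=> u v _ IH f t.
  apply: (lin_eq (lin_comp (top_is_lin f t) (fbr_linr u)) (@lin_0 _ _ _))
    (malg_lspanT v) _.
  by move=> _ [w ->]; rewrite top_brr !IH op_0 subr0.
Qed.

Definition tact (f : Q -> K) (x : L) (t : T) : T := top f (rp x) t.

Lemma tact_pr f u t : tact f (pr theta dg rel u) t = top f u t.
Proof.
have h : pr theta dg rel (rp (pr theta dg rel u)) = pr theta dg rel u by apply: rpK.
have := top_ideal ((pr_eq _ _ _ _ _).1 h) f t.
by rewrite -scaleN1r addrC top_lin scaleN1r addrC => /subr0_eq.
Qed.

Lemma tact_linl f c x y t : tact f (c *: x + y) t = c *: tact f x t + tact f y t.
Proof. by rewrite -[x]rpK -[y]rpK -pr_lin !tact_pr top_lin. Qed.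

Lemma tact_pmon f w t : tact f (pmon w) t = f (mdeg w) *: op w t.
Proof. by rewrite tact_pr topU. Qed.

Definition act := tact (fun=> 1).

Lemma act_pmon w t : act (pmon w) t = op w t.
Proof. by rewrite /act tact_pmon scale1r. Qed.

Lemma act_linr x c s t : act x (c *: s + t) = c *: act x s + act x t.
Proof.
have l1 : lin (fun x => act x (c *: s + t)) by move=> a u v; apply: tact_linl.
have l2 : lin (fun x => c *: act x s + act x t).
  by apply: lin_comb => a u v; apply: tact_linl.
apply: (lin_eq l1 l2) (presented_lspan x) _ => _ [w ->].
by rewrite !act_pmon op_lin.
Qed.

Lemma act_br a b x y t : graded_part (eq^~ a) x -> graded_part (eq^~ b) y ->
  act (br x y) t = act x (act y t) - theta a b *: act y (act x t).
Proof.
move=> /gradedP hx /gradedP hy.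
have la t' : lin (fun x => act x t') by move=> a' u v; apply: tact_linl.
have lr x' : lin (fun t => act x' t) by move=> a' u v; apply: act_linr.
have lbl y' : lin (fun x => br x y') by move=> a' u v; apply: bracketPl.
have lbr x' : lin (fun y => br x' y) by move=> a' u v; apply: bracketPr.
have l1 y' : lin (fun x => - theta a b *: act y' (act x t) + act x (act y' t)).
  by apply: lin_comb => //; apply: lin_comp.
have l2 x' : lin (fun y => - theta a b *: act y (act x' t) + act x' (act y t)).
  by apply: lin_comb => //; apply: lin_comp.
rewrite addrC -scaleNr.
apply: (lin_eq (lin_comp (la t) (lbl _)) (l1 y)) hx _ => _ [v hv ->].
apply: (lin_eq (lin_comp (la t) (lbr _)) (l2 _)) hy _ => _ [w hw ->].
by rewrite pmon_br 5!act_pmon /= -hv -hw scaleNr addrC.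
Qed.

(** An element lying in two graded parts on which a twist takes different constants must act by
    zero; this separates graded parts inside the quotient. *)
Lemma tact_graded (f : Q -> K) (P : Q -> Prop) c x t : (forall q, P q -> f q = c) ->
  graded_part P x -> tact f x t = c *: act x t.
Proof.
move=> h /gradedP hx.
apply: (lin_eq (g := fun x => tact f x t) (g' := fun x => c *: act x t) _ _ hx)
  => [||_ [w /h hw ->]].
- by move=> a u v; apply: tact_linl.
- by move=> a u v; rewrite /act tact_linl scalerDr !scalerA [c * a]mulrC.
- by rewrite tact_pmon act_pmon hw.
Qed.

End Action.
End Presented.

(** * The action on the tensor algebra *)

Section Commutator.
Variables (K : numFieldType) (Q : zmodType) (th : Q -> Q -> K).
Hypothesis thDl : forall a b c, th (a + b) c = th a c * th b c.
Hypothesis thDr : forall a b c, th a (b + c) = th a b * th a c.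
Hypothesis thC : forall a b, th a b * th b a = 1.
Variable T : lmodType K.
Implicit Types (A B C : T -> T) (a b c : Q).

Definition cm a b A B (t : T) := A (B t) - th a b *: B (A t).

Lemma th0l a : th 0 a = 1.
Proof.
have h := thDl 0 0 a; rewrite addr0 in h.
have n0 : th 0 a != 0.
  by apply/eqP => e; have := thC 0 a; rewrite e mul0r => /esym/eqP; rewrite oner_eq0.
by apply: (mulfI n0); rewrite mulr1.
Qed.

Lemma th0r a : th a 0 = 1.
Proof. by have := thC 0 a; rewrite th0l mul1r. Qed.

Lemma thN a b : th (- a) b * th a b = 1.
Proof. by rewrite -thDl addNr th0l. Qed.

Lemma lin0 A : lin A -> A 0 = 0.
Proof. by move=> lA; have := lA (-1) 0 0; rewrite scaler0 addr0 scaleN1r addNr. Qed.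

Lemma linZ A (k : K) t : lin A -> A (k *: t) = k *: A t.
Proof. by move=> lA; have := lA k t 0; rewrite !addr0 lin0 // addr0. Qed.

Lemma linD A s t : lin A -> A (s + t) = A s + A t.
Proof. by move=> lA; rewrite -[s]scale1r lA !scale1r. Qed.

Lemma linB A s t : lin A -> A (s - t) = A s - A t.
Proof. by move=> lA; rewrite -scaleN1r addrC lA scaleN1r addrC. Qed.

Lemma cm_lin a b A B : lin A -> lin B -> lin (cm a b A B).
Proof.
move=> lA lB k s t; rewrite /cm lB !lA lB scalerDr scalerA opprD addrACA.
by rewrite scalerBr !scalerA [_ * k]mulrC.
Qed.

Lemma cm_jacobi a b c A B C t : lin A -> lin B -> lin C ->
  cm a (b + c) A (cm b c B C) t =
  cm (a + b) c (cm a b A B) C t + th a b *: cm b (a + c) B (cm a c A C) t.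
Proof.
move=> lA lB lC; rewrite /cm (linB _ _ lA) (linB _ _ lB) (linB _ _ lC).
rewrite (linZ _ _ lA) (linZ _ _ lB) (linZ _ _ lC) thDl 2!thDr.
exact: jacobi_vectors.
Qed.

Lemma cm_skew a b A B t : cm b a B A t = - (th b a *: cm a b A B t).
Proof. by rewrite /cm scalerBr scalerA thC scale1r opprB. Qed.

End Commutator.

Section Words.
Variables (K : numFieldType) (Q : zmodType) (th : Q -> Q -> K).
Variables (X : choiceType) (ldeg : X -> Q).
Local Notation T := {malg K[seq X]}.
Local Notation W w := (<< 1 *g w >> : T).
Local Notation cm := (cm th).
Implicit Types (t : T) (w : seq X) (x : X) (q : Q) (c : Q -> K).

Definition wdeg w : Q := \sum_(x <- w) ldeg x.

Definition consx x : T -> T := lift (fun w => W (x :: w)).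

(** For an additive character c this is the shape of the action of a Cartan element. *)
Definition diag c : T -> T := lift (fun w => c (wdeg w) *: W w).

Variables (q : Q) (delta : X -> T -> T).
Fixpoint derw w : T :=
  if w is x :: w' then
    delta x (W w') + th q (ldeg x) *: consx x (derw w')
  else 0.

(* The colored derivation of degree [q], except that [delta x] need not be left
   multiplication by an element. *)
Definition der : T -> T := lift derw.

Lemma consx_lin x : lin (consx x). Proof. by move=> a u v; apply: lift_lin. Qed.
Lemma diag_lin c : lin (diag c). Proof. by move=> a u v; apply: lift_lin. Qed.
Lemma der_lin : lin der. Proof. by move=> a u v; apply: lift_lin. Qed.

Lemma consxW x w : consx x (W w) = W (x :: w). Proof. exact: liftU. Qed.
Lemma diagW c w : diag c (W w) = c (wdeg w) *: W w. Proof. exact: liftU. Qed.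
Lemma der_nil : der (W [::]) = 0. Proof. exact: liftU. Qed.

Lemma wdeg_cons x w : wdeg (x :: w) = ldeg x + wdeg w.
Proof. exact: big_cons. Qed.

Lemma wdeg_nil : wdeg [::] = 0.
Proof. exact: big_nil. Qed.

Hypothesis delta_lin : forall x, lin (delta x).

Lemma der_cons x t : der (consx x t) = delta x t + th q (ldeg x) *: consx x (der t).
Proof.
move: t; apply: lift_ext => [a u v|a u v|w].
- by rewrite (consx_lin x a u v) der_lin.
- rewrite delta_lin der_lin (consx_lin x a) scalerDr addrACA; congr (_ + _).
  by rewrite scalerDr !scalerA mulrC.
- by rewrite consxW /der !liftU.
Qed.

Lemma der_cm x t : cm q (ldeg x) der (consx x) t = delta x t.
Proof. by rewrite /cm der_cons addrK. Qed.

Definition additive_char c := forall a b, c (a + b) = c a + c b.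

Lemma diag_cons c x t : additive_char c ->
  diag c (consx x t) = c (ldeg x) *: consx x t + consx x (diag c t).
Proof.
move=> hc; move: t; apply: lift_ext.
- exact: (lin_comp (diag_lin c) (consx_lin x)).
- exact: (lin_comb _ (consx_lin x) (lin_comp (consx_lin x) (diag_lin c))).
- move=> w; rewrite consxW !diagW wdeg_cons hc scalerDl.
  by rewrite (linZ _ _ (consx_lin x)) consxW.
Qed.

(** Degree a, tested by commutation with the diagonal operators of additive characters: the form in
    which the degree enters the relations with h_i and d_i. *)
Definition homog a (Z : T -> T) := forall c t, additive_char c ->
  diag c (Z t) = c a *: Z t + Z (diag c t).

Lemma homog_consx x : homog (ldeg x) (consx x).
Proof. by move=> c t; apply: diag_cons. Qed.

Lemma homog_cm a b A B : lin A -> lin B -> homog a A -> homog b B ->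
  homog (a + b) (cm a b A B).
Proof.
move=> lA lB hA hB c t hc; rewrite /cm (linB _ _ (diag_lin c)) (linZ _ _ (diag_lin c)).
rewrite (hA _ (B t) hc) (hB _ t hc) (hB _ (A t) hc) (hA _ t hc) hc.
rewrite (linD _ _ lA) (linZ _ _ lA) (linD _ _ lB) (linZ _ _ lB).
rewrite !addrA -2!scalerDl [c b + c a]addrC scalerDr opprD addrACA.
by rewrite scalerA [_ * (c a + _)]mulrC -scalerA -scalerBr addrA.
Qed.

Lemma word_eq (f g : T -> T) : lin f -> lin g -> f (W [::]) = g (W [::]) ->
  (forall x t, f t = g t -> f (consx x t) = g (consx x t)) -> f =1 g.
Proof.
move=> lf lg h0 hx; apply: lift_ext => //.
by elim=> // x w IH; rewrite -consxW; apply: hx.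
Qed.

(** Every word arises from the empty one by left multiplications, with which Z commutes up to a
    color. Vanishing relations between operators are checked this way. *)
Lemma word_zero a (Z : T -> T) : lin Z -> Z (W [::]) = 0 ->
  (forall x t, cm a (ldeg x) Z (consx x) t = 0) -> forall t, Z t = 0.
Proof.
move=> lZ h0 hx; apply: word_eq => //; first exact: lin_0.
move=> x t h; have := hx x t; rewrite /cm h (lin0 (consx_lin x)) scaler0 subr0.
by [].
Qed.

Lemma homog_der : (forall x, homog (q + ldeg x) (delta x)) -> homog q der.
Proof.
move=> hd c t hc; move: t; apply: word_eq.
- exact: (lin_comp (diag_lin c) der_lin).
- exact: (lin_comb _ der_lin (lin_comp der_lin (diag_lin c))).
- rewrite der_nil diagW (linZ _ _ der_lin) der_nil !scaler0.
  by rewrite (lin0 (diag_lin c)) addr0.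
move=> x t IH; rewrite !der_cons (diag_cons _ _ hc) (linD _ _ (diag_lin c)).
rewrite (linZ _ _ (diag_lin c)) (hd x c t hc) (diag_cons _ _ hc) IH.
rewrite (linD _ _ der_lin) (linZ _ _ der_lin) !der_cons.
rewrite (linD _ _ (consx_lin x)) (linZ _ _ (consx_lin x)) hc.
rewrite !scalerDl !scalerDr !scalerA [th _ _ * c q]mulrC [th _ _ * c _]mulrC.
rewrite -!addrA; congr (_ + _); rewrite [RHS]addrCA; congr (_ + _).
by rewrite addrCA [RHS]addrCA; congr (_ + _); rewrite addrCA.
Qed.

End Words.

Section Operators.
Variables (K : numFieldType) (Q : zmodType) (th : Q -> Q -> K).
Hypothesis thDl : forall a b c, th (a + b) c = th a c * th b c.
Hypothesis thDr : forall a b c, th a (b + c) = th a b * th a c.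
Hypothesis thC : forall a b, th a b * th b a = 1.
Variables (mm : idx -> nat) (al : idx -> Q).
Local Notation "'i0'" := idxN1.
Local Notation al0 := (al idxN1).
Hypothesis th_al0 : th al0 al0 = 1.
Variable chi : idx -> Q -> K.
Hypothesis chiD : forall i, additive_char (chi i).
Hypothesis chi_al : forall i j, chi i (al j) = (monster_A i j)%:~R.

Definition absx (j : idx) : nat := `|val j|%N.

(** The bound on the second entry mirrors the Serre relation (ad f_{-1})^j f_{jk} = 0, where j = 1 -
    a_{-1,j}. *)
Definition valid (p : idx * nat * nat) : bool :=
  [&& 1 <= val p.1.1, (p.1.2 < absx p.1.1)%N & (p.2 < mm p.1.1)%N].

(* ((j, l), k) stands for the letter (ad f_{-1})^l f_{jk}. *)
Definition uletter : choiceType := {p : idx * nat * nat | valid p}.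

Definition pdeg (p : idx * nat * nat) : Q := - (al p.1.1 + al0 *+ p.1.2).
Definition udeg (x : uletter) : Q := pdeg (val x).

Local Notation T := {malg K[seq uletter]}.
Local Notation W w := (<< 1 *g w >> : T).
Local Notation cm := (cm th).
Local Notation consx := (@consx K uletter).
Local Notation der := (der th udeg).
Local Notation diag := (@diag K Q uletter udeg).
Local Notation homog := (@homog K Q uletter udeg).

(** The value 0 on invalid triples lets a raised index run past j - 1 without a case distinction. *)
Definition cons3 p : T -> T :=
  if insub p is Some x then consx x else fun=> 0.

(* The actions of f_{-1}, e_{-1} and e_{ik}: the letters (j, l, k) with j, k fixed
   form the irreducible sl_2-module of dimension j, and the value of e_{ik} on
   (i, l, k) is forced by its commutation with f_{-1}. *)
Definition opF : T -> T :=
  der (- al0) (fun x => cons3 ((val x).1.1, (val x).1.2.+1, (val x).2)).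

(** The coefficient is that of e f^l v = l (j - l) f^(l-1) v for a vector v killed by e and of
    weight j - 1. At l = 0 it is 0 and hides the truncated predecessor. *)
Definition opE : T -> T :=
  der al0 (fun x t => ((val x).1.2 * (absx (val x).1.1 - (val x).1.2))%N%:R *:
     cons3 ((val x).1.1, (val x).1.2.-1, (val x).2) t).

(** If e_{ik} commutes with f = f_{-1}, then [e_{ik}, [f, u]] = th [f, [e_{ik}, u]]. Starting from
    h_i this gives th [f, h_i], a multiple of f by a_{i,-1}, and from there on 0 because [f, f] =
    0. *)
Definition opEk_letter (i : idx) (k : nat) (x : uletter) (t : T) : T :=
  if ((val x).1.1 == i) && ((val x).2 == k) then
    match (val x).1.2 with
    | 0 => diag (chi i) t
    | 1 => (th (al i) (- al0) * chi i al0) *: opF t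
    | _ => 0
    end
  else 0.

Definition opEk i k : T -> T := der (al i) (opEk_letter i k).

Lemma cons3_lin p : lin (cons3 p).
Proof. by rewrite /cons3; case: insub => [x|]; [apply: consx_lin|apply: lin_0]. Qed.

Lemma cons3_val x : cons3 (val x) = consx x.
Proof. by rewrite /cons3 valK. Qed.

Lemma cons3_invalid p t : ~~ valid p -> cons3 p t = 0.
Proof. by move=> h; rewrite /cons3 insubN. Qed.

Lemma cons3P p : valid p -> exists2 x : uletter, val x = p & cons3 p = consx x.
Proof. by move=> h; exists (Sub p h); rewrite ?SubK // -cons3_val SubK. Qed.

Lemma pdegS j l k : - al0 + pdeg (j, l, k) = pdeg (j, l.+1, k).
Proof. by rewrite /pdeg /= mulrS -opprD addrCA. Qed.

Lemma pdegP j l k : (0 < l)%N -> al0 + pdeg (j, l, k) = pdeg (j, l.-1, k).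
Proof. by case: l => // l _; rewrite -pdegS addrA subrr add0r. Qed.

Lemma homog_cons3 p : homog (pdeg p) (cons3 p).
Proof.
have [h|h] := boolP (valid p).
  by have [x <- ->] := cons3P h; apply: homog_consx.
move=> c t hc; rewrite !cons3_invalid // scaler0 addr0.
exact: lin0 (diag_lin _ _).
Qed.

Lemma homog0 a : homog a (fun _ : T => 0 : T).
Proof. by move=> c t hc; rewrite scaler0 addr0; apply: lin0 (diag_lin _ _). Qed.

Lemma homog_diag c0 : homog 0 (diag c0).
Proof.
move=> c t hc.
have c00 : c 0 = 0.
  by have /eqP := hc 0 0;
    rewrite addr0 -subr_eq0 opprD addrA subrr sub0r oppr_eq0 => /eqP.
rewrite c00 scale0r add0r; move: t; apply: lift_ext.
- exact: (lin_comp (diag_lin _ c) (diag_lin _ c0)).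
- exact: (lin_comp (diag_lin _ c0) (diag_lin _ c)).
- by move=> w; rewrite !diagW !(linZ _ _ (diag_lin _ _)) !diagW !scalerA mulrC.
Qed.

Lemma homogZ a (Z : T -> T) s : homog a Z -> homog a (fun t => s *: Z t).
Proof.
move=> hZ c t hc; rewrite (linZ _ _ (diag_lin _ _)) hZ // scalerDr !scalerA.
by rewrite mulrC.
Qed.

Lemma opF_lin : lin opF. Proof. exact: der_lin. Qed.
Lemma opE_lin : lin opE. Proof. exact: der_lin. Qed.
Lemma opEk_lin i k : lin (opEk i k). Proof. exact: der_lin. Qed.

Lemma linZf (g : T -> T) s : lin g -> lin (fun t => s *: g t).
Proof. by move=> h c u v; rewrite h scalerDr !scalerA mulrC. Qed.

Lemma opEk_letter_lin i k x : lin (opEk_letter i k x).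
Proof.
rewrite /opEk_letter; case: (_ && _); last exact: lin_0.
case: (val x).1.2 => [|[|l]]; [exact: diag_lin|exact/linZf/opF_lin|exact: lin_0].
Qed.

Lemma homog_opF : homog (- al0) opF.
Proof.
apply: homog_der => [x|x]; first exact: cons3_lin.
by case: x => [[[j l] k] h] /=; rewrite /udeg /= pdegS; apply: homog_cons3.
Qed.

Lemma homog_opE : homog al0 opE.
Proof.
apply: homog_der => [x|x]; first exact/linZf/cons3_lin.
case: x => [[[j [|l]] k] h] /=.
  have -> : (fun t : T => (0 * (absx j - 0))%N%:R *: cons3 (j, 0%N, k) t) = fun=> 0.
    by apply: funext => t; rewrite mul0n scale0r.
  exact: homog0.
by rewrite /udeg /= pdegP //; apply/homogZ/homog_cons3.
Qed.

Lemma homog_opEk i k : homog (al i) (opEk i k).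
Proof.
apply: homog_der => [x|x]; first exact: opEk_letter_lin.
rewrite /opEk_letter; case: x => [[[j l] k'] h] /=; rewrite /udeg /=.
have [->|_] := eqVneq j i; last exact: homog0.
case: (k' == k); last exact: homog0.
case: l h => [|[|l]] h; last exact: homog0.
  by rewrite /pdeg /= mulr0n addr0 subrr; apply: homog_diag.
by rewrite /pdeg /= mulr1n opprD addrA subrr add0r; apply/homogZ/homog_opF.
Qed.

Lemma der_cons3 q (delta : uletter -> T -> T) p t : (forall x, lin (delta x)) ->
  cm q (pdeg p) (der q delta) (cons3 p) t =
  if insub p is Some x then delta x t else 0.
Proof.
move=> ld; rewrite /cons3; case: insubP => [x _ <-|_]; first exact: der_cm.
by rewrite /cm (lin0 (der_lin _ _ _ _)) scaler0 subr0.
Qed.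

Lemma F_cons3 j l k t :
  cm (- al0) (pdeg (j, l, k)) opF (cons3 (j, l, k)) t = cons3 (j, l.+1, k) t.
Proof.
rewrite der_cons3; last by move=> x; apply: cons3_lin.
case: insubP => [x _ -> //|h]; rewrite cons3_invalid //.
by apply: contra h; rewrite /valid /= => /and3P[-> h ->]; rewrite (ltnW h).
Qed.

Lemma E_cons3 j l k t :
  cm al0 (pdeg (j, l, k)) opE (cons3 (j, l, k)) t =
  if valid (j, l, k) then (l * (absx j - l))%N%:R *: cons3 (j, l.-1, k) t else 0.
Proof.
rewrite der_cons3; last by move=> x; apply/linZf/cons3_lin.
by case: insubP => [x -> -> //|/negPf ->].
Qed.

Lemma Ek_cons3 i k j l k' t :
  cm (al i) (pdeg (j, l, k')) (opEk i k) (cons3 (j, l, k')) t =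
  if insub (j, l, k') is Some x then opEk_letter i k x t else 0.
Proof. by rewrite der_cons3 // => x; apply: opEk_letter_lin. Qed.

Lemma cm_ext a b (A B A' B' : T -> T) t : A =1 A' -> B =1 B' ->
  cm a b A B t = cm a b A' B' t.
Proof. by move=> hA hB; rewrite /cm hB hA hA hB. Qed.

Lemma cmZr a b (A B : T -> T) s t : lin A -> cm a b A (fun u => s *: B u) t =
  s *: cm a b A B t.
Proof. by move=> lA; rewrite /cm (linZ _ _ lA) scalerBr !scalerA [th _ _ * s]mulrC. Qed.

Lemma thN0 : th (- al0) al0 = 1.
Proof. by have := thN thDl thC al0 al0; rewrite th_al0 mulr1. Qed.

Lemma th0N : th al0 (- al0) = 1.
Proof. by have := thC al0 (- al0); rewrite thN0 mulr1. Qed.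

Lemma chi0 i : chi i 0 = 0.
Proof.
by have /eqP := chiD i 0 0;
    rewrite addr0 -subr_eq0 opprD addrA subrr sub0r oppr_eq0 => /eqP.
Qed.

Lemma chiN i a : chi i (- a) = - chi i a.
Proof. by apply/eqP; rewrite -addr_eq0 -chiD addNr chi0. Qed.

Lemma chiMn i a n : chi i (a *+ n) = chi i a *+ n.
Proof. by elim: n => [|n IH]; rewrite ?chi0 // !mulrS chiD IH. Qed.

Lemma absxE j : 1 <= val j -> (absx j)%:Z = val j.
Proof. by move=> h; rewrite /absx gez0_abs // (le_trans _ h). Qed.

Lemma A0E j : 1 <= val j -> monster_A i0 j = 1 - (absx j)%:Z.
Proof. by move=> h; rewrite /monster_A absxE //; rewrite opprD opprK. Qed.

Lemma A00 : monster_A i0 i0 = 2.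
Proof. by []. Qed.

Lemma chi_udeg x : chi i0 (udeg x) =
  ((absx (val x).1.1)%:R - 1 - (val x).1.2%:R *+ 2).
Proof.
have /and3P[h1 _ _] := valP x; move: h1.
rewrite /udeg /pdeg; case: (val x) => [[j l] k]; rewrite [_.1.1]/= [_.1.2]/= => hj.
by rewrite chiN chiD chiMn !chi_al A0E // A00 -[in RHS]mulr_natr; ring.
Qed.

Lemma opF_nil : opF (W [::]) = 0. Proof. exact: der_nil. Qed.
Lemma opE_nil : opE (W [::]) = 0. Proof. exact: der_nil. Qed.
Lemma opEk_nil i k : opEk i k (W [::]) = 0. Proof. exact: der_nil. Qed.

Lemma FE_cons3 j l k t : valid (j, l, k) ->
  cm (- al0) (al0 + pdeg (j, l, k)) opF
    (cm al0 (pdeg (j, l, k)) opE (cons3 (j, l, k))) t =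
  (l * (absx j - l))%N%:R *: cons3 (j, l, k) t.
Proof.
move=> hv.
have e u : cm al0 (pdeg (j, l, k)) opE (cons3 (j, l, k)) u =
    (l * (absx j - l))%N%:R *: cons3 (j, l.-1, k) u by rewrite E_cons3 hv.
rewrite (cm_ext _ _ _ (frefl opF) e) (cmZr _ _ _ _ _ opF_lin).
case: l {hv e} => [|l]; first by rewrite mul0n !scale0r.
by rewrite pdegP // F_cons3.
Qed.

Lemma EF_cons3 j l k t : valid (j, l, k) ->
  cm al0 (- al0 + pdeg (j, l, k)) opE
    (cm (- al0) (pdeg (j, l, k)) opF (cons3 (j, l, k))) t =
  (l.+1 * (absx j - l.+1))%N%:R *: cons3 (j, l, k) t.
Proof.
move=> hv; rewrite (cm_ext _ _ _ (frefl opE) (F_cons3 j l k)) pdegS E_cons3.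
case: ifP => // /negbT h; rewrite (_ : (absx j - l.+1)%N = 0%N) ?muln0 ?scale0r //.
move: hv h; rewrite /valid /= => /and3P[-> h1 ->].
by rewrite andbT -leqNgt => h2; apply/eqP; rewrite subn_eq0.
Qed.

(** Both sides kill the empty word, so the commutators with the letters decide: on (j, l, k) they
    are scalars, and (l + 1)(j - l - 1) - l (j - l) = j - 1 - 2 l is the weight of the letter under
    h_{-1}. *)
Lemma EF t : cm al0 (- al0) opE opF t = diag (chi i0) t.
Proof.
have lEF := cm_lin th al0 (- al0) opE_lin opF_lin.
move: t; apply: word_eq => //; first exact: diag_lin.
  by rewrite /cm opF_nil opE_nil (lin0 opE_lin) (lin0 opF_lin) scaler0 subr0
    diagW wdeg_nil chi0 scale0r.
move=> x t IH; rewrite (diag_cons _ _ _ (chiD i0)) -IH.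
have ex := chi_udeg x; move: ex (valP x).
rewrite -cons3_val /udeg; case: (val x) => [[j l] k].
rewrite [_.1.1]/= [_.1.2]/= => ex hv.
have := cm_jacobi thDl thDr thC (al0) (- al0) (pdeg (j, l, k)) t
   opE_lin opF_lin (cons3_lin (j, l, k)).
rewrite FE_cons3 // EF_cons3 // addrN th0N scale1r {1}/cm (th0l thDl thC) scale1r.
move/eqP; rewrite -subr_eq -scalerBl => /eqP h; apply/eqP; rewrite -subr_eq -h.
apply/eqP; congr (_ *: _).
rewrite ex; have /and3P[_ lj _] := hv; rewrite [_.1.1]/= [_.1.2]/= in lj.
rewrite !natrM !natrB ?(ltnW lj) // -[in RHS]mulr_natr -[l.+1]addn1 natrD; ring.
Qed.

Lemma EkF i k t : cm (al i) (- al0) (opEk i k) opF t = 0.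
Proof.
have lEF := cm_lin th (al i) (- al0) (@opEk_lin i k) opF_lin.
move: t; apply: (word_zero (th := th) (ldeg := udeg) (a := al i - al0)) => //.
  by rewrite /cm opF_nil opEk_nil (lin0 (@opEk_lin i k)) (lin0 opF_lin) scaler0 subr0.
move=> x t; move: (valP x).
have -> : consx x = cons3 (val x) by rewrite cons3_val.
rewrite /udeg; case exv: (val x) => [[j l] k'] hv.
have ins : insub (j, l, k') = Some x by rewrite -exv valK.
have := cm_jacobi thDl thDr thC (al i) (- al0) (pdeg (j, l, k')) t
   (@opEk_lin i k) opF_lin (cons3_lin (j, l, k')).
rewrite (cm_ext _ _ _ (frefl (opEk i k)) (F_cons3 j l k')) pdegS Ek_cons3.
have e u : cm (al i) (pdeg (j, l, k')) (opEk i k) (cons3 (j, l, k')) u =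
    opEk_letter i k x u by rewrite Ek_cons3 ins.
rewrite (cm_ext _ _ _ (frefl opF) e) => /eqP; rewrite -subr_eq => /eqP <-.
apply/eqP; rewrite subr_eq0; apply/eqP.
have {}e u : opEk_letter i k x u = if (j == i) && (k' == k) then
    match l with 0 => diag (chi i) u | 1 => (th (al i) (- al0) * chi i al0) *: opF u
    | _ => 0 end else 0 by rewrite /opEk_letter exv.
case: (boolP ((j == i) && (k' == k))) => [/andP[/eqP ej /eqP ek]|ne]; last first.
  rewrite (cm_ext _ _ _ (frefl opF) (B' := fun _ : T => 0 : T)); last first.
    by move=> u; rewrite e (negPf ne).
  rewrite /cm (lin0 opF_lin) scaler0 subr0 scaler0.
  by case: insubP => // y _ ey; rewrite /opEk_letter ey (negPf ne).
case: l hv exv ins e => [|[|l]] hv exv ins e.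
- rewrite (cm_ext _ _ _ (frefl opF) (B' := diag (chi i))); last first.
    by move=> u; rewrite e ej ek !eqxx.
  have h0 : al i + pdeg (j, 0%N, k') = 0.
    by rewrite /pdeg /= mulr0n addr0 ej subrr.
  rewrite h0 /cm (th0r thDl thC) scale1r (homog_opF _ (chiD i)).
  rewrite opprD addrCA subrr addr0.
  rewrite chiN scaleNr opprK scalerA.
  case: insubP => [y _ ey|h]; first by rewrite /opEk_letter ey ej ek !eqxx.
  (* For j = 1 no letter (j, 1, k) exists that could take up the scalar, but then a_{1,-1} = 0 makes
     the scalar vanish. *)
  move: h hv; rewrite /valid /= => h /and3P[h1 h2 h3]; move: h; rewrite h1 h3 andbT /=.
  rewrite -leqNgt => h4; have j1 : absx j = 1%N by apply/eqP; rewrite eqn_leq h4.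
  have -> : chi i al0 = 0.
    rewrite chi_al -ej; have /(congr1 (fun z : int => (z%:~R : K))) := A0E h1.
    by rewrite j1 subrr /monster_A addrC.
  by rewrite mulr0 scale0r.
- rewrite (cm_ext _ _ _ (frefl opF)
    (B' := fun u => (th (al i) (- al0) * chi i al0) *: opF u)); last first.
    by move=> u; rewrite e ej ek !eqxx.
  have h0 : al i + pdeg (j, 1%N, k') = - al0.
    by rewrite /pdeg /= mulr1n ej opprD addrA subrr add0r.
  rewrite h0 (cmZr _ _ _ _ _ opF_lin) /cm.
  have -> : th (- al0) (- al0) = 1
    by have := thN thDl thC al0 (- al0); rewrite th0N mulr1.
  rewrite scale1r subrr !scaler0.
  by case: insubP => // y _ ey; rewrite /opEk_letter ey; case: ifP.
- rewrite (cm_ext _ _ _ (frefl opF) (B' := fun _ : T => 0 : T)); last first.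
    by move=> u; rewrite e; case: ifP.
  rewrite /cm (lin0 opF_lin) scaler0 subr0 scaler0.
  by case: insubP => // y _ ey; rewrite /opEk_letter ey; case: ifP.
Qed.

Lemma cm0r a b A t : lin A -> cm a b A (fun _ : T => 0 : T) t = 0.
Proof. by move=> lA; rewrite /cm (lin0 lA) scaler0 subrr. Qed.

Lemma cm0l a b B t : lin B -> cm a b (fun _ : T => 0 : T) B t = 0.
Proof. by move=> lB; rewrite /cm (lin0 lB) scaler0 subrr. Qed.

(** * The Serre relations for the raising operators *)

Section Serre.
Variables (i : idx) (k : nat).
Hypothesis i1 : 1 <= val i.

Definition sdeg p : Q := iter p (+%R al0) (al i).

Fixpoint adE p : T -> T :=
  if p is p'.+1 then cm al0 (sdeg p') opE (adE p') else opEk i k.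

Lemma adE_lin p : lin (adE p).
Proof.
by elim: p => [|p IH]; [apply: opEk_lin|apply: cm_lin => //; apply: opE_lin].
Qed.

Lemma homog_adE p : homog (sdeg p) (adE p).
Proof.
elim: p => [|p IH]; first exact: homog_opEk.
by apply: homog_cm => //; [apply: opE_lin|apply: adE_lin|apply: homog_opE].
Qed.

Lemma adE_nil p : adE p (W [::]) = 0.
Proof.
elim: p => [|p IH]; first exact: opEk_nil.
by rewrite /= /cm IH opE_nil (lin0 opE_lin) (lin0 (adE_lin p)) scaler0 subrr.
Qed.

Lemma chi_sdeg p : chi i0 (sdeg p) = p%:R *+ 2 + (1 - (absx i)%:R).
Proof.
elim: p => [|p IH].
  by rewrite mul0rn add0r /sdeg /= chi_al A0E // rmorphB.
rewrite [sdeg _]/(al0 + sdeg p) chiD IH chi_al A00 addrA; congr (_ + _).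
by rewrite -[p.+1%:R]natr1 mulrnDl addrC.
Qed.

(* For p = i this shows that (ad e_{-1})^i e_{ik} commutes with f_{-1}. *)
Lemma F_adE p t : cm (- al0) (sdeg p) opF (adE p) t =
  (p%:R * ((absx i)%:R - p%:R)) *: adE p.-1 t.
Proof.
elim: p t => [|p IH] t.
  by rewrite (cm_skew thC) EkF scaler0 oppr0 mul0r scale0r.
rewrite [adE _]/(cm al0 (sdeg p) opE (adE p)).
rewrite (cm_jacobi thDl thDr thC _ _ _ _ opF_lin opE_lin (adE_lin p)).
rewrite (cm_ext _ _ _ (frefl opE) IH) (cmZr _ _ _ _ _ opE_lin).
have -> : (p%:R * ((absx i)%:R - p%:R)) *: cm al0 (- al0 + sdeg p) opE (adE p.-1) t
    = (p%:R * ((absx i)%:R - p%:R)) *: adE p t.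
  case: p {IH} => [|p]; first by rewrite mul0r !scale0r.
  by rewrite [sdeg _]/(al0 + sdeg p) addKr.
have FE u : cm (- al0) al0 opF opE u = - diag (chi i0) u.
  by rewrite (cm_skew thC) thN0 scale1r EF.
rewrite (cm_ext _ _ _ FE (frefl (adE p))) addNr /cm (th0l thDl thC) scale1r.
rewrite thN0 scale1r.
rewrite (homog_adE _ _ (chiD i0)) -[- diag _ _]scaleN1r (linZ _ _ (adE_lin p)) scaleN1r.
rewrite opprK opprD subrK -scaleNr -scalerDl chi_sdeg; congr (_ *: _).
by rewrite -[p.+1%:R]natr1 -mulr_natr; ring.
Qed.

(** Since e_{-1} commutes with f_{j'k'}, the iterated ad of e_{-1} only hits [e_{ik}, f_{j'k'}],
    which is h_i or 0; [e_{-1}, h_i] is a multiple of e_{-1}, and one more bracket gives 0. *)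
Lemma adE_f p j' k' t :
  cm (sdeg p) (pdeg (j', 0%N, k')) (adE p) (cons3 (j', 0%N, k')) t =
  (if [&& j' == i, k' == k & valid (j', 0%N, k')] then
    match p with
    | 0 => diag (chi i) t
    | 1 => - chi i al0 *: opE t
    | _ => 0
    end else 0).
Proof.
have step q u : cm (sdeg q.+1) (pdeg (j', 0%N, k')) (adE q.+1) (cons3 (j', 0%N, k')) u
   = cm al0 (sdeg q + pdeg (j', 0%N, k')) opE
       (cm (sdeg q) (pdeg (j', 0%N, k')) (adE q) (cons3 (j', 0%N, k'))) u.
  rewrite (cm_jacobi thDl thDr thC _ _ _ _ opE_lin (adE_lin q) (cons3_lin _)).
  rewrite (cm_ext _ _ _ (frefl (adE q)) (B' := fun _ : T => 0 : T)); last first.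
    by move=> v; rewrite E_cons3 mul0n scale0r; case: ifP.
  by rewrite (cm0r _ _ _ (adE_lin q)) scaler0 addr0.
have base u : cm (sdeg 0) (pdeg (j', 0%N, k')) (adE 0) (cons3 (j', 0%N, k')) u =
    if [&& j' == i, k' == k & valid (j', 0%N, k')] then diag (chi i) u else 0.
  rewrite Ek_cons3; case: insubP => [x hv ex|/negPf ->]; last by rewrite !andbF.
  by rewrite hv andbT /opEk_letter ex.
have [hc|hc] := boolP [&& j' == i, k' == k & valid (j', 0%N, k')]; last first.
  elim: p t => [|p IH] t; first by rewrite base (negPf hc).
  by rewrite step (cm_ext _ _ _ (frefl opE) IH) cm0r //; apply: opE_lin.
have /and3P[/eqP ej _ _] := hc.
have d0 : sdeg 0 + pdeg (j', 0%N, k') = 0.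
  by rewrite /sdeg /pdeg /= mulr0n addr0 ej subrr.
have {}base u : cm (sdeg 0) (pdeg (j', 0%N, k')) (adE 0) (cons3 (j', 0%N, k')) u =
    diag (chi i) u by rewrite base hc.
have one u : cm (sdeg 1) (pdeg (j', 0%N, k')) (adE 1) (cons3 (j', 0%N, k')) u =
    - chi i al0 *: opE u.
  rewrite step (cm_ext _ _ _ (frefl opE) base) d0 /cm (th0r thDl thC) scale1r.
  by rewrite (homog_opE _ (chiD i)) opprD addrCA subrr addr0 scaleNr.
case: p => [|[|p]]; [exact: base|exact: one|].
elim: p t => [|p IH] t; rewrite step.
  rewrite (cm_ext _ _ _ (frefl opE) one) (cmZr _ _ _ _ _ opE_lin).
  rewrite -[sdeg 1]/(al0 + sdeg 0) -addrA d0 addr0.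
  by rewrite /cm th_al0 scale1r subrr scaler0.
by rewrite (cm_ext _ _ _ (frefl opE) IH) cm0r //; apply: opE_lin.
Qed.

(** The operator commutes with f_{-1}, because p (i - p) vanishes at p = i, and with every f_{jk'}.
    By Jacobi it then commutes with all letters, and it kills the empty word. *)
Lemma serre_e t : adE (absx i) t = 0.
Proof.
have lZ := adE_lin (absx i).
have ZF u : cm (sdeg (absx i)) (- al0) (adE (absx i)) opF u = 0.
  by rewrite (cm_skew thC) F_adE subrr mulr0 scale0r scaler0 oppr0.
have Zc j l k' u :
    cm (sdeg (absx i)) (pdeg (j, l, k')) (adE (absx i)) (cons3 (j, l, k')) u = 0.
  elim: l u => [|l IH] u.
    (* For i at least 2 the value is 0 outright; for i = 1 it is a multiple of e_{-1} by a_{1,-1} =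
       0. *)
    rewrite adE_f; case: ifP => // _; have := absxE i1.
    case ei: (absx i) => [|[|n]] // e1; first by move: i1; rewrite -e1.
    by rewrite chi_al /monster_A -e1 oppr0 scale0r.
  rewrite -pdegS -(cm_ext _ _ _ (frefl (adE (absx i))) (F_cons3 j l k')).
  rewrite (cm_jacobi thDl thDr thC _ _ _ _ lZ opF_lin (cons3_lin _)).
  rewrite (cm_ext _ _ _ ZF (frefl _)) (cm0l _ _ _ (cons3_lin _)) add0r.
  by rewrite (cm_ext _ _ _ (frefl opF) IH) (cm0r _ _ _ opF_lin) scaler0.
apply: (word_zero (th := th) (ldeg := udeg) (a := sdeg (absx i)) lZ (adE_nil _)).
by move=> x u; rewrite -cons3_val /udeg; case: (val x) => [[j l] k']; apply: Zc.
Qed.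

End Serre.

End Operators.

(** * The defining relations hold *)

Section LatticeSum.
Variable I : choiceType.
Implicit Types (q : {malg int[I]}) (f : I -> int).

Definition lsum f q : int := \sum_(j <- msupp q) q@_j * f j.

Lemma lsumEw f (d : {fset I}) q : (msupp q `<=` d)%fset ->
  lsum f q = \sum_(j <- d) q@_j * f j.
Proof.
move=> le; rewrite /lsum (big_fset_incl _ le) //= => j _ /mcoeff_outdom ->.
by rewrite mul0r.
Qed.

Lemma lsumD f q1 q2 : lsum f (q1 + q2) = lsum f q1 + lsum f q2.
Proof.
pose d := (msupp (q1 + q2) `|` (msupp q1 `|` msupp q2))%fset.
have h0 : (msupp (q1 + q2) `<=` d)%fset by rewrite fsubsetUl.
have h1 : (msupp q1 `<=` d)%fset.
  by apply: fsubset_trans (fsubsetUr _ _); rewrite fsubsetUl.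
have h2 : (msupp q2 `<=` d)%fset.
  by apply: fsubset_trans (fsubsetUr _ _); rewrite fsubsetUr.
rewrite (lsumEw _ h0) (lsumEw _ h1) (lsumEw _ h2) -big_split /=.
by apply: eq_bigr => j _; rewrite mcoeffD mulrDl.
Qed.

Lemma lsum_sroot f i : lsum f (sroot i) = f i.
Proof.
rewrite (lsumEw _ (d := [fset i]%fset)) ?msuppU_le // big_seq_fset1.
by rewrite mcoeffUU mul1r.
Qed.

Lemma lsum0 f : lsum f 0 = 0.
Proof. by rewrite /lsum msupp0 big_seq_fset0. Qed.

Lemma lsumN f q : lsum f (- q) = - lsum f q.
Proof. by apply/eqP; rewrite -addr_eq0 -lsumD addNr lsum0. Qed.

End LatticeSum.

Section Monster.
Variables (K : numFieldType) (F : qseries) (C : idx -> idx -> K).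
Hypothesis hC : coloring F C.
Local Notation Q := (rootlattice idx).
Local Notation th := (theta C).
Local Notation mm := (monster_m F).
Local Notation al := (@sroot idx).
Local Notation al0 := (al idxN1).
Local Notation gen := (gen mm).
Local Notation mdeg := (Defs.mdeg (@gdeg idx mm)).

Lemma coloring_neq0 i j : C i j != 0.
Proof.
case: hC => h _; apply/eqP => e; have := h i j.
by rewrite e mul0r => /esym/eqP; rewrite oner_eq0.
Qed.

Lemma thDl (a b c : Q) : th (a + b) c = th a c * th b c.
Proof. exact: thetaDl coloring_neq0 a b c. Qed.

Lemma thDr (a b c : Q) : th a (b + c) = th a b * th a c.
Proof. exact: thetaDr coloring_neq0 a b c. Qed.

Lemma thC (a b : Q) : th a b * th b a = 1.
Proof.
rewrite /theta [X in _ * X]exchange_big -big_split big1 //= => i _.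
rewrite -big_split big1 //= => j _; rewrite [b@_j * _]mulrC -expfzMl.
by case: hC => -> _; rewrite exp1rz.
Qed.

Lemma th_al0 : th al0 al0 = 1.
Proof. by rewrite theta_sroot; case: hC => _ /(_ idxN1)[-> //]; rewrite qcoefN1. Qed.

Definition chi (i : idx) (q : Q) : K := (lsum (monster_A i) q)%:~R.

Lemma chiD i : additive_char (chi i).
Proof. by move=> a b; rewrite /chi lsumD rmorphD. Qed.

Lemma chi_al i j : chi i (al j) = (monster_A i j)%:~R.
Proof. by rewrite /chi lsum_sroot. Qed.

Definition chid (i : idx) (q : Q) : K := (lsum (fun j => (i == j)%:R) q)%:~R.

Lemma chidD i : additive_char (chid i).
Proof. by move=> a b; rewrite /chid lsumD rmorphD. Qed.

Lemma chid_al i j : chid i (al j) = (i == j)%:R.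
Proof. by rewrite /chid lsum_sroot; case: eqP. Qed.

Local Notation uletter := (uletter mm).
Local Notation T := {malg K[seq uletter]}.
Local Notation udeg := (@udeg Q mm al).
Local Notation diag := (@diag K Q uletter udeg).
Local Notation homog := (@homog K Q uletter udeg).
Local Notation opE := (@opE K Q th mm al).
Local Notation opF := (@opF K Q th mm al).
Local Notation opEk := (@opEk K Q th mm al chi).
Local Notation cons3 := (@cons3 K mm).
Local Notation cm := (cm th).

Definition opg (g : gen) : T -> T :=
  match g with
  | GenH i => diag (chi i)
  | GenD i => diag (chid i)
  | GenE i k => if i == idxN1 then opE else opEk i k
  | GenF i k => if i == idxN1 then opF else cons3 (i, 0%N, k : nat)
  end.

Lemma opg_lin g c s t : opg g (c *: s + t) = c *: opg g s + opg g t.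
Proof.
case: g => [i|i|i k|i k] /=.
- exact: diag_lin.
- exact: diag_lin.
- by case: (i == _); [apply: opE_lin|apply: opEk_lin].
- by case: (i == _); [apply: opF_lin|apply: cons3_lin].
Qed.

Lemma homog_opg g : homog (gdeg g) (opg g).
Proof.
case: g => [i|i|i k|i k] /=; try exact: homog_diag.
- by case: eqP => [->|_]; [apply: homog_opE|apply: homog_opEk].
- case: eqP => [->|_]; first exact: homog_opF.
  have -> : - al i = pdeg al (i, 0%N, k : nat) by rewrite /pdeg mulr0n addr0.
  exact: homog_cons3.
Qed.

Local Notation op := (@op K Q th gen (@gdeg idx mm) T opg).
Local Notation top := (@top K Q th gen (@gdeg idx mm) T opg).

Lemma idx_cases (i : idx) : i != idxN1 -> 1 <= val i.
Proof.
by move=> ne; have := valP i => /orP[/eqP e|//]; case/eqP: ne; apply: val_inj.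
Qed.

Lemma absx_gt0 (i : idx) : i != idxN1 -> (0 < absx i)%N.
Proof. by move=> /idx_cases h; have := h; rewrite -absxE. Qed.

(** A twist scales different degrees differently, so the two terms of a relator must have equal
    degrees unless the second one is absent; the latter happens for [e_{ik}, f_{jl}] with distinct
    indices. *)
Lemma top_sub0 f (a b : magma gen) (c : K) t :
  (c = 0 \/ mdeg a = mdeg b) -> op a t = c *: op b t ->
  top f (<< 1 *g a >> - c *: << 1 *g b >>) t = 0.
Proof.
move=> hc e; rewrite -scaleNr addrC top_lin 2!topU e.
case: hc => [->|->]; first by rewrite oppr0 !scale0r scaler0 addr0.
by rewrite !scalerA mulNr mulrC scaleNr addNr.
Qed.

Lemma top_mon0 f (a : magma gen) t : op a t = 0 -> top f << 1 *g a >> t = 0.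
Proof. by move=> e; rewrite topU e scaler0. Qed.

Lemma diag_comm (g : gen) (c : Q -> K) (a : gen) t : additive_char c ->
  opg a = diag c -> gdeg a = 0 ->
  op (Node (Leaf a) (Leaf g)) t = c (gdeg g) *: op (Leaf g) t.
Proof.
move=> hc ea da; rewrite /= ea da (th0l thDl thC) scale1r.
by rewrite (homog_opg _ _ hc) addrK.
Qed.

Lemma additive0 (c : Q -> K) : additive_char c -> c 0 = 0.
Proof.
by move=> hc; have /eqP := hc 0 0;
  rewrite addr0 -subr_eq0 opprD addrA subrr sub0r oppr_eq0 => /eqP.
Qed.

Lemma additiveN (c : Q -> K) a : additive_char c -> c (- a) = - c a.
Proof. by move=> hc; apply/eqP; rewrite -addr_eq0 -hc addNr additive0. Qed.

Lemma op_serre_e (k : 'I_(mm idxN1)) (j : idx) (l : 'I_(mm j)) n t : j != idxN1 ->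
  mdeg (iter n (Node (Leaf (GenE k))) (Leaf (GenE l))) = sdeg al j n /\
  op (iter n (Node (Leaf (GenE k))) (Leaf (GenE l))) t =
  adE th al chi j l n t.
Proof.
move=> jn; elim: n t => [|n IH] t; first by rewrite /= (negPf jn).
have [d e] := IH t; split; first by rewrite /= d.
by rewrite iterS [op _ _]/= d (IH (opE t)).2 e.
Qed.

Lemma op_serre_f (k : 'I_(mm idxN1)) (j : idx) (l : 'I_(mm j)) n t : j != idxN1 ->
  mdeg (iter n (Node (Leaf (GenF k))) (Leaf (GenF l))) = pdeg al (j, n, l : nat) /\
  op (iter n (Node (Leaf (GenF k))) (Leaf (GenF l))) t = cons3 (j, n, l : nat) t.
Proof.
move=> jn; elim: n t => [|n IH] t.
  by rewrite /= (negPf jn) /pdeg /= mulr0n addr0.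
have [d e] := IH t; split; first by rewrite /= d pdegS.
by rewrite -(F_cons3 th al) iterS [op _ _]/= d (IH (opF t)).2 e.
Qed.

Lemma A_self i : monster_A i i = 2 -> i = idxN1.
Proof.
move=> e; apply/eqP; have [//|/idx_cases h] := eqVneq i idxN1.
by move: e h; rewrite /monster_A; lia.
Qed.

(** The sum i + j vanishes only for the indices -1 and 1. Up to skew-symmetry the orthogonality
    relations are thus Serre relations with exponent 1, and are verified as such. *)
Lemma A_orth i j : monster_A i j = 0 ->
  (i = idxN1 /\ val j = 1) \/ (j = idxN1 /\ val i = 1).
Proof.
have [->|/idx_cases hi] := eqVneq i idxN1.
  have [-> //|/idx_cases hj] := eqVneq j idxN1; rewrite /monster_A => e; left.
  by split=> //; move: e; rewrite [val idxN1]/=; lia.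
have [->|/idx_cases hj] := eqVneq j idxN1; rewrite /monster_A => e.
  by right; split=> //; move: e; rewrite [val idxN1]/=; lia.
by move: e hi hj; lia.
Qed.

Lemma serre_len j : j != idxN1 -> `|1 - monster_A idxN1 j|%N = absx j.
Proof. by move=> /idx_cases h; rewrite A0E // subKr. Qed.

Lemma cons3_top j l t : cons3 (j, absx j, l) t = 0.
Proof. by apply: cons3_invalid; rewrite /valid ltnn andbF. Qed.

Lemma absx1 j : val j = 1 -> absx j = 1%N.
Proof. by rewrite /absx => ->. Qed.

Lemma neq_idx1 j : val j = 1 -> j != idxN1.
Proof. by move=> e; apply/eqP => ej; move: e; rewrite ej. Qed.

Lemma op_skew0 a b t : (forall s, op (Node a b) s = 0) -> op (Node b a) t = 0.
Proof.
move=> h; have := op_skew (@gdeg idx mm) thC opg b a t; rewrite h scaler0 addr0.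
by [].
Qed.

Lemma ef_rel i (k : 'I_(mm i)) j (l : 'I_(mm j)) t :
  op (Node (Leaf (GenE k)) (Leaf (GenF l))) t =
  ((i == j) && (k == l :> nat))%:R *: diag (chi i) t.
Proof.
have m0 (k0 : 'I_(mm idxN1)) : k0 = 0%N :> nat.
  by case: k0 => n /=; rewrite /monster_m qcoefN1; case: n.
have aj : - al j = pdeg al (j, 0%N, l : nat) by rewrite /pdeg mulr0n addr0.
have [ei|ni] := eqVneq i idxN1; have [ej|nj] := eqVneq j idxN1.
- subst i j; rewrite !m0 /= scale1r.
  exact: (EF thDl thDr thC th_al0 chiD chi_al).
- subst i; rewrite eq_sym (negPf nj) scale0r [op _ _]/= (negPf nj) aj.
  by rewrite -/(cm _ _ _ _ _) E_cons3 mul0n scale0r; case: ifP.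
- subst j; rewrite (negPf ni) scale0r [op _ _]/= (negPf ni).
  exact: (EkF thDl thDr thC th_al0 chiD chi_al).
- rewrite [op _ _]/= (negPf ni) (negPf nj) aj -/(cm _ _ _ _ _).
  rewrite Ek_cons3; case: insubP => [x _ ex|].
    rewrite /opEk_letter ex /= [j == i]eq_sym [(l : nat) == k]eq_sym.
    by case: (_ && _); rewrite ?scale1r ?scale0r.
  by rewrite /valid /= (idx_cases nj) ltn_ord andbT (absx_gt0 nj).
Qed.

Lemma op_rel u f t : bkm_rel monster_A u -> top f u t = 0.
Proof.
case=> {u}.
- move=> i j; rewrite fbrUU; apply: top_mon0.
  by rewrite (diag_comm _ _ (chiD i)) //= (additive0 (chiD i)) scale0r.
- move=> i j; rewrite fbrUU; apply: top_mon0.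
  by rewrite (diag_comm _ _ (chiD i)) //= (additive0 (chiD i)) scale0r.
- move=> i j; rewrite fbrUU; apply: top_mon0.
  by rewrite (diag_comm _ _ (chidD i)) //= (additive0 (chidD i)) scale0r.
- move=> i j l; rewrite fbrUU; apply: top_sub0; first by right; rewrite /= add0r.
  by rewrite (diag_comm _ _ (chiD i)) // -chi_al.
- move=> i j l; rewrite fbrUU -[X in _ + X]opprK -scaleNr; apply: top_sub0.
    by right; rewrite /= add0r.
  by rewrite (diag_comm _ _ (chiD i)) // -chi_al -(additiveN _ (chiD i)).
- move=> i j l; rewrite fbrUU; apply: top_sub0; first by right; rewrite /= add0r.
  by rewrite (diag_comm _ _ (chidD i)) // -chid_al.
- move=> i j l; rewrite fbrUU -[X in _ + X]opprK -scaleNr; apply: top_sub0.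
    by right; rewrite /= add0r.
  by rewrite (diag_comm _ _ (chidD i)) // -chid_al -(additiveN _ (chidD i)).
- move=> i k j l; rewrite fbrUU; apply: top_sub0; last exact: ef_rel.
  have [ij|_] := eqVneq i j; last by left.
  by right; rewrite /= ij subrr.
- move=> i k j l /A_self ei ij; subst i; rewrite iter_fbrUU; apply: top_mon0.
  have jn : j != idxN1 by rewrite eq_sym.
  rewrite (op_serre_e k l _ t jn).2 serre_len //.
  exact: (serre_e thDl thDr thC th_al0 chiD chi_al _ (idx_cases jn)).
- move=> i k j l /A_self ei ij; subst i; rewrite iter_fbrUU; apply: top_mon0.
  have jn : j != idxN1 by rewrite eq_sym.
  by rewrite (op_serre_f k l _ t jn).2 serre_len // cons3_top.
- have Ee (k : 'I_(mm idxN1)) (j : idx) (l : 'I_(mm j)) s : val j = 1 ->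
      op (Node (Leaf (GenE k)) (Leaf (GenE l))) s = 0.
    move=> hj; have jn := neq_idx1 hj.
    rewrite -[Node _ _]/(iter 1 (Node (Leaf (GenE k))) (Leaf (GenE l))).
    rewrite (op_serre_e k l _ s jn).2 -(absx1 hj).
    exact: (serre_e thDl thDr thC th_al0 chiD chi_al _ (idx_cases jn)).
  move=> i k j l /A_orth [[ei ej]|[ej ei]]; rewrite fbrUU; apply: top_mon0.
    by subst i; apply: Ee.
  by subst j; apply: op_skew0 => s; apply: Ee.
- have Ff (k : 'I_(mm idxN1)) (j : idx) (l : 'I_(mm j)) s : val j = 1 ->
      op (Node (Leaf (GenF k)) (Leaf (GenF l))) s = 0.
    move=> hj; have jn := neq_idx1 hj.
    rewrite -[Node _ _]/(iter 1 (Node (Leaf (GenF k))) (Leaf (GenF l))).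
    by rewrite (op_serre_f k l _ s jn).2 -(absx1 hj) cons3_top.
  move=> i k j l /A_orth [[ei ej]|[ej ei]]; rewrite fbrUU; apply: top_mon0.
    by subst i; apply: Ff.
  by subst j; apply: op_skew0 => s; apply: Ff.
Qed.

End Monster.

Lemma IIdegE q : IIdeg q = (lsum (fun=> 1) q, lsum (fun j : idx => val j) q).
Proof. by congr pair; apply: eq_bigr => j _; rewrite mulr1. Qed.

(** * Triangular decomposition *)

Section Decomposition.
Variables (K : numFieldType) (mm : idx -> nat).
Local Notation Q := (rootlattice idx).
Local Notation al := (@sroot idx).
Local Notation gen := (gen mm).
Variables (L : lmodType K) (br : L -> L -> L) (th : Q -> Q -> K).
Variable hom : Q -> L -> Prop.
Hypothesis CL : colored_lie br th hom.
Variable pm : magma gen -> L.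
Local Notation mdeg := (Defs.mdeg (@gdeg idx mm)).

Definition sgen (s : bool) i (k : 'I_(mm i)) : L :=
  pm (Leaf (if s then GenE k else GenF k)).

Definition sal (s : bool) (i : idx) : Q := if s then al i else - al i.

Definition cartan (g : gen) : bool :=
  match g with GenH _ | GenD _ => true | _ => false end.

Hypothesis pm_br : forall a b, br (pm a) (pm b) = pm (Node a b).
Hypothesis hom_pm : forall w, hom (mdeg w) (pm w).
Hypothesis cartan_sgen : forall g s i (k : 'I_(mm i)), cartan g ->
  exists c, br (pm (Leaf g)) (sgen s k) = c *: sgen s k.
Hypothesis cartan_comm : forall g g', cartan g -> cartan g' ->
  br (pm (Leaf g)) (pm (Leaf g')) = 0.
Hypothesis sgen_opp : forall s i (k : 'I_(mm i)) j (l : 'I_(mm j)),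
  exists c, br (sgen s k) (sgen (~~ s) l) = c *: pm (Leaf (GenH mm i)) /\
    (c = 0 \/ i = j).

Lemma hom_sgen s i (k : 'I_(mm i)) : hom (sal s i) (sgen s k).
Proof.
by case: s; [exact: (hom_pm (Leaf (GenE k)))|exact: (hom_pm (Leaf (GenF k)))].
Qed.

Lemma hom_cartan g : cartan g -> hom 0 (pm (Leaf g)).
Proof.
by case: g => // i _;
  [exact: (hom_pm (Leaf (GenH mm i)))|exact: (hom_pm (Leaf (GenD mm i)))].
Qed.

Inductive nil (s : bool) : Q -> L -> Prop :=
| nil_gen i (k : 'I_(mm i)) : nil s (sal s i) (sgen s k)
| nil_ad i (k : 'I_(mm i)) q z : nil s q z -> nil s (sal s i + q) (br (sgen s k) z)
| nil_0 q : nil s q 0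
| nil_lin c q y z : nil s q y -> nil s q z -> nil s q (c *: y + z).

Inductive car : Q -> L -> Prop :=
| car_gen g : cartan g -> car 0 (pm (Leaf g))
| car_0 q : car q 0
| car_lin c q y z : car q y -> car q z -> car q (c *: y + z).

Inductive nilcar (s : bool) : Q -> L -> Prop :=
| nilcar_n q z : nil s q z -> nilcar s q z
| nilcar_c q z : car q z -> nilcar s q z
| nilcar_lin c q y z : nilcar s q y -> nilcar s q z -> nilcar s q (c *: y + z).

Inductive tri : Q -> L -> Prop :=
| tri_n s q z : nil s q z -> tri q z
| tri_c q z : car q z -> tri q z
| tri_lin c q y z : tri q y -> tri q z -> tri q (c *: y + z).

Lemma nilZ s c q z : nil s q z -> nil s q (c *: z).
Proof. by move=> h; rewrite -[_ *: _]addr0; apply: nil_lin => //; apply: nil_0. Qed.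

Lemma carZ c q z : car q z -> car q (c *: z).
Proof. by move=> h; rewrite -[_ *: _]addr0; apply: car_lin => //; apply: car_0. Qed.

Lemma nil_cartan s q z g : cartan g -> nil s q z -> nil s q (br (pm (Leaf g)) z).
Proof.
move=> cg; elim=> {q z}.
- move=> i k; have [c ->] := cartan_sgen s k cg; exact/nilZ/nil_gen.
- move=> i k q z hz IH; have [c e] := cartan_sgen s k cg.
  rewrite (cl_jacobi CL _ (hom_cartan cg) (hom_sgen s k)) e (brZl CL).
  apply: nil_lin; first exact: nil_ad.
  exact/nilZ/nil_ad.
- by move=> q; rewrite (br0r CL); apply: nil_0.
- by move=> c q y z _ h1 _ h2; rewrite (cl_brPr CL); apply: nil_lin.
Qed.

Lemma nil_car s q z i (k : 'I_(mm i)) : car q z ->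
  nil s (sal s i + q) (br (sgen s k) z).
Proof.
elim=> {q z}.
- move=> g cg; have [c e] := cartan_sgen s k cg.
  rewrite (cl_skew CL (hom_sgen s k) (hom_cartan cg)) e -scaleNr addr0.
  exact/nilZ/nilZ/nil_gen.
- by move=> q; rewrite (br0r CL); apply: nil_0.
- by move=> c q y z _ h1 _ h2; rewrite (cl_brPr CL); apply: nil_lin.
Qed.

Lemma sal_opp s i : sal s i + sal (~~ s) i = 0.
Proof. by case: s; rewrite /= ?subrr ?addNr. Qed.

(** Jacobi moves the generator past the leading factor. The contraction of the two is a multiple of
    some h_i, which preserves the nilpotent part; the rest is a shorter bracket. *)
Lemma nil_opp s q z i (k : 'I_(mm i)) : nil (~~ s) q z ->
  nilcar (~~ s) (sal s i + q) (br (sgen s k) z).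
Proof.
elim=> {q z}.
- move=> j l; have [c [-> hc]] := sgen_opp s k l; apply: nilcar_c.
  case: hc => [->|<-]; first by rewrite scale0r; apply: car_0.
  by rewrite sal_opp; apply/carZ/car_gen.
- move=> j l q z hz IH.
  rewrite (cl_jacobi CL _ (hom_sgen s k) (hom_sgen (~~ s) l)) [X in nilcar _ _ X]addrC.
  apply: nilcar_lin.
    rewrite [sal s i + _]addrCA; elim: IH => {hz z} [q' z hz|q' z hz|c q' y z _ h1 _ h2].
    + exact/nilcar_n/nil_ad.
    + exact/nilcar_n/nil_car.
    + by rewrite (cl_brPr CL); apply: nilcar_lin.
  have [c [-> hc]] := sgen_opp s k l; rewrite (brZl CL).
  case: hc => [->|<-]; first by rewrite scale0r; apply/nilcar_n/nil_0.
  by rewrite addrA sal_opp add0r; apply/nilcar_n/nilZ/nil_cartan.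
- by move=> q; rewrite (br0r CL); apply/nilcar_n/nil_0.
- by move=> c q y z _ h1 _ h2; rewrite (cl_brPr CL); apply: nilcar_lin.
Qed.

Lemma tri_ad g q z : tri q z -> tri (gdeg g + q) (br (pm (Leaf g)) z).
Proof.
have nct s q' z' : nilcar s q' z' -> tri q' z'.
  elim=> {q' z'} [q' z' h|q' z' h|c q' y z' _ h1 _ h2]; [exact: tri_n h|exact: tri_c|].
  exact: tri_lin.
have [cg|ncg] := boolP (cartan g).
  have -> : gdeg g = 0 by case: (g) cg.
  rewrite add0r; elim=> {q z}.
  - by move=> s q z h; apply: (tri_n (s := s)); apply: nil_cartan.
  - move=> q z h; apply: tri_c; elim: h => {q z}.
    + by move=> g' cg'; rewrite cartan_comm //; apply: car_0.
    + by move=> q; rewrite (br0r CL); apply: car_0.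
    + by move=> c q y z _ h1 _ h2; rewrite (cl_brPr CL); apply: car_lin.
  - by move=> c q y z _ h1 _ h2; rewrite (cl_brPr CL); apply: tri_lin.
have [s [i [k [-> ->]]]] : exists s i (k : 'I_(mm i)),
    gdeg g = sal s i /\ pm (Leaf g) = sgen s k.
  by case: (g) ncg => // i k _; [exists true|exists false]; exists i, k.
elim=> {q z}.
- move=> s' q z h; have [es|es] := eqVneq s' s.
    by apply: (tri_n (s := s)); apply: nil_ad; rewrite -es.
  have {}es : s' = ~~ s by case: (s') (s) es => -[].
  by apply: (nct (~~ s)); apply: nil_opp; rewrite -es.
- by move=> q z h; apply: (tri_n (s := s)); apply: nil_car.
- by move=> c q y z _ h1 _ h2; rewrite (cl_brPr CL); apply: tri_lin.
Qed.

Lemma tri_stab w q z : tri q z -> tri (mdeg w + q) (br (pm w) z).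
Proof.
elim: w q z => [g|a IHa b IHb] q z hz; first exact: tri_ad.
rewrite -pm_br (br_assoc CL _ (hom_pm a) (hom_pm b)) [X in tri _ X]addrC -scaleNr.
apply: tri_lin; last by rewrite /= -addrA; apply/IHa/IHb.
by rewrite /= [mdeg a + mdeg b]addrC -addrA; apply/IHb/IHa.
Qed.

Lemma tri_pm w : tri (mdeg w) (pm w).
Proof.
elim: w => [g|a IHa b IHb]; last by rewrite -pm_br; apply: tri_stab.
case: g => [i|i|i k|i k].
- exact/tri_c/car_gen.
- exact/tri_c/car_gen.
- exact: (tri_n (nil_gen true k)).
- exact: (tri_n (nil_gen false k)).
Qed.

Definition ht1 : Q -> int := lsum (fun=> 1).

Lemma ht1_sal s i : ht1 (sal s i) = if s then 1 else -1.
Proof. by case: s; rewrite /ht1 ?lsumN lsum_sroot. Qed.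

Lemma nil_sign s q z : nil s q z -> z = 0 \/ if s then 0 < ht1 q else ht1 q < 0.
Proof.
elim=> {q z}.
- by move=> i k; right; rewrite ht1_sal; case: s.
- move=> i k q z _ [->|h]; first by left; rewrite (br0r CL).
  right; move: h; rewrite [ht1 (_ + _)]lsumD -/(ht1 _) -/(ht1 _) ht1_sal.
  by case: s; lia.
- by left.
- move=> c q y z _ [->|h] _ [->|h']; try by right.
  by left; rewrite scaler0 addr0.
Qed.

Lemma car_sign q z : car q z -> z = 0 \/ q = 0.
Proof.
elim=> {q z}; [by right|by left|].
by move=> c q y z _ [->|h] _ [->|h']; try (by right); left; rewrite scaler0 addr0.
Qed.

(** The positive part is nonzero only where the first coordinate is positive, and the Cartan part
    only in degree 0, so their components vanish here. *)
Lemma tri_neg q z : tri q z -> ht1 q < 0 -> nil false q z.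
Proof.
elim=> {q z}.
- move=> [] q z h hq //; have [->|h'] := nil_sign h; first exact: nil_0.
  by move: hq h'; lia.
- move=> q z /car_sign[->|->] hq; first exact: nil_0.
  by move: hq; rewrite /ht1 lsum0.
- by move=> c q y z _ h1 _ h2 hq; apply: nil_lin; [apply: h1|apply: h2].
Qed.

(** Each factor lowers the first coordinate by one, so a nonzero proper bracket has first coordinate
    at most -2. *)
Lemma nil_one q z : nil false q z -> ht1 q = -1 ->
  lspan (fun y => exists i (k : 'I_(mm i)), q = - al i /\ y = sgen false k) z.
Proof.
elim=> {q z}.
- by move=> i k _; apply: lspan_in; exists i, k.
- move=> i k q z /nil_sign[->|h]; first by rewrite (br0r CL) => *; apply: lspan_0.
  by rewrite [ht1 (_ + _)]lsumD -/(ht1 _) -/(ht1 _) ht1_sal; move: h; lia.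
- by move=> q _; apply: lspan_0.
- by move=> c q y z _ h1 _ h2 hq; apply: lspan_lin; [apply: h1|apply: h2].
Qed.

End Decomposition.

Lemma lspan_fam (K : fieldType) (V : lmodType K) n (b : 'I_n -> V) z :
  lspan (fun y => exists i, y = b i) z -> exists c : 'I_n -> K, z = \sum_i c i *: b i.
Proof.
elim=> [y [i ->]||a y1 y2 _ [c1 ->] _ [c2 ->]].
- exists (fun j => (j == i)%:R); rewrite (bigD1 i) //= eqxx scale1r big1 ?addr0 //.
  by move=> j /negPf ->; rewrite scale0r.
- by exists (fun=> 0); rewrite big1 // => i _; rewrite scale0r.
- exists (fun i => a * c1 i + c2 i); rewrite scaler_sumr -big_split /=.
  by apply: eq_bigr => i _; rewrite scalerA scalerDl.
Qed.

Lemma indep_monomials (K : fieldType) (X : choiceType) (ws : seq X) : uniq ws ->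
  indep [seq (<< 1 *g w >> : {malg K[X]}) | w <- ws].
Proof.
move=> u c hc i; pose b w := << 1 *g w >> : {malg K[X]}.
have iw (j : 'I_(size [seq b w | w <- ws])) : (j < size ws)%N.
  by rewrite -[X in (_ < X)%N](size_map b).
case: ws u c hc i iw => [_ _ _ [] //|w0 ws'] u c hc i iw.
have : \sum_j c j * (j == i)%:R = 0.
  have h := congr1 (mcoeff (nth w0 (w0 :: ws') i)) hc; rewrite mcoeff0 in h.
  set w := nth w0 _ i in h *; rewrite -[RHS]h (big_morph _ (mcoeffD w) (mcoeff0 w)).
  apply: eq_bigr => j _; rewrite (nth_map w0) ?iw // mcoeffZ mcoeffU.
  by rewrite (nth_uniq w0 (iw j) (iw i) u).
rewrite (bigD1 i) //= eqxx mulr1 big1 ?addr0 // => j /negPf ->.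
by rewrite mulr0.
Qed.

(** * Counting ordered monomials and words *)

Section SizeMon.
Variables (K : numFieldType) (Q : zmodType) (L : lmodType K) (N : nat).
Variables (T : lmodType K) (act : L -> T -> T) (v0 : T).

Lemma size_mon (E : seq (letter Q L)) m n : (m + n <= N)%N ->
  (size (mon N act v0 E m n))%:R =
  cf m n (\prod_(e <- E) geo N (mono (dm e) (dn e) (1 : K))).
Proof.
elim: E m n => [|x E IH] m n hN; first by rewrite big_nil cf1 /=; case: andP.
rewrite big_cons [geo _ _ in RHS]/geo mulr_suml cf_sum.
have -> : mon N act v0 (x :: E) m n =
    flatten [seq [seq iter k (act (el x)) z
                  | z <- mon N act v0 E (m - k * dm x)%N (n - k * dn x)%N]
             | k <- iota 0 N.+1 & (k * dm x <= m)%N && (k * dn x <= n)%N] by [].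
rewrite size_flatten /shape -map_comp sumnE big_map big_filter.
rewrite -[iota 0 N.+1]/(index_iota 0 N.+1) big_mkcond big_mkord natr_sum.
apply: eq_bigr => k _; rewrite monoX expr1n cf_monoM mul1r.
case: ifP => // /andP[h1 h2]; rewrite /= size_map IH //.
by move: hN; lia.
Qed.
End SizeMon.

Section BaseWords.
Variables (K : numFieldType) (X : choiceType) (xm xn : X -> nat) (nu : X -> K).

Fixpoint words (X0 : seq X) r : seq (seq X) :=
  if r is r'.+1 then [seq x :: w | x <- X0, w <- words X0 r'] else [:: [::]].

Definition wsum (f : X -> nat) (w : seq X) := \sum_(x <- w) f x.

Lemma words_uniq X0 r : uniq X0 -> uniq (words X0 r).
Proof.
move=> u; elim: r => //= r IH; apply: allpairs_uniq => //.
by move=> [a b] [c d] _ _ /= [-> ->].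
Qed.

Lemma wordsP X0 r w : w \in words X0 r -> size w = r /\ all (mem X0) w.
Proof.
elim: r w => [|r IH] w /=; first by rewrite inE => /eqP ->.
by move=> /allpairsP [[x v] [/= xX /IH[<- h] ->]] /=; rewrite xX.
Qed.

Definition base_words X0 N m n :=
  [seq w <- flatten [seq words X0 r | r <- iota 0 N.+1]
   | (wsum xm w == m) && (wsum xn w == n)].

Lemma base_words_uniq X0 N m n : uniq X0 -> uniq (base_words X0 N m n).
Proof.
move=> u; apply: filter_uniq.
elim: N.+1 0%N => //= k IH r; rewrite cat_uniq words_uniq //= IH andbT.
apply/hasPn => w /flatten_mapP [r']; rewrite mem_iota => /andP[rr' _].
move=> /wordsP[sw _]; apply/negP => /wordsP[sw' _].
by move: rr'; rewrite -sw sw' ltnn.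
Qed.

Lemma base_wordsP X0 N m n w : w \in base_words X0 N m n ->
  [/\ all (mem X0) w, wsum xm w = m & wsum xn w = n].
Proof.
rewrite mem_filter => /andP[/andP[/eqP h1 /eqP h2] /flatten_mapP [r _ /wordsP[_ h]]].
by split.
Qed.

Lemma pow_words X0 r :
  (\sum_(x <- X0) mono (xm x) (xn x) (nu x)) ^+ r =
  \sum_(w <- words X0 r) mono (wsum xm w) (wsum xn w) (\prod_(x <- w) nu x).
Proof.
elim: r => [|r IH]; first by rewrite big_seq1 /wsum !big_nil mono1.
rewrite exprS IH big_distrl /= big_allpairs_dep; apply: eq_bigr => x _.
rewrite big_distrr /=; apply: eq_bigr => w _.
by rewrite monoM /wsum !big_cons.
Qed.

End BaseWords.

Lemma size_base_words (K : numFieldType) (X : choiceType) (xm xn : X -> nat)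
    (X0 : seq X) N m n :
  (size (base_words xm xn X0 N m n))%:R =
  cf m n (geo N (\sum_(x <- X0) mono (xm x) (xn x) (1 : K))).
Proof.
rewrite /geo cf_sum size_filter -sum1_count big_flatten big_map natr_sum.
rewrite -[iota 0 N.+1]/(index_iota 0 N.+1) big_mkord; apply: eq_bigr => r _.
rewrite pow_words cf_sum big_mkcond natr_sum; apply: eq_bigr => w _.
rewrite cf_mono [m == _]eq_sym [n == _]eq_sym; case: andP => //= _.
by rewrite big1.
Qed.

(** * Traces of triangular maps *)

(** Schur triangularization, dimension 0 being treated apart. The rows of P form the new basis, in
    which D is lower triangular. *)
Lemma trigonalization (K : numClosedFieldType) n (M : 'M[K]_n) :
  exists P Pi D : 'M[K]_n, [/\ P *m Pi = 1%:M, Pi *m P = 1%:M, P *m M = D *m P &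
    forall i j : 'I_n, (i < j)%N -> D i j = 0].
Proof.
case: n M => [|n] M.
  by exists 0, 0, 0; split; [apply/matrixP => -[]|apply/matrixP => -[]|
    apply/matrixP => -[]|case].
have [P uP] := @Schur _ _ M isT; have Pu := unitarymx_unit uP.
move=> /is_trig_mxP ht; exists P, (invmx P), (conjmx P M); split=> //.
- exact: mulmxV.
- exact: mulVmx.
- by rewrite conjumx // mulmxKV.
Qed.

Lemma sum_mulmx (K : fieldType) (V : lmodType K) n (A B : 'M[K]_n) (v : 'I_n -> V) i :
  \sum_k A i k *: \sum_j B k j *: v j = \sum_j (A *m B) i j *: v j.
Proof.
under eq_bigr do rewrite scaler_sumr.
rewrite exchange_big /=; apply: eq_bigr => j _.
under eq_bigr do rewrite scalerA.
by rewrite -scaler_suml mxE.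
Qed.

Lemma sum_mulmx1 (K : fieldType) (V : lmodType K) n (A B : 'M[K]_n) (v : 'I_n -> V) i :
  A *m B = 1%:M -> \sum_k A i k *: \sum_j B k j *: v j = v i.
Proof.
move=> e; rewrite sum_mulmx e (bigD1 i) //= mxE eqxx scale1r big1 ?addr0 // => j ji.
by rewrite mxE eq_sym (negPf ji) scale0r.
Qed.

Section TriangularTrace.
Variables (K : fieldType) (L : lmodType K) (phi : L -> L) (I : eqType).
Variables (i0 : I) (B : seq I) (b : I -> L) (w : I -> nat) (lm : I -> K).
Variable W : set L.
Local Notation bs := [seq b i | i <- B].
Hypothesis WB : forall i, i \in B -> W (b i).
Hypothesis spanB : forall x, W x -> lspan (fun y => exists2 i, i \in B & y = b i) x.
Hypothesis indB : indep bs.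
Hypothesis triB : forall i, i \in B ->
  lspan (fun y => exists2 j, j \in B & (w i < w j)%N /\ y = b j)
    (phi (b i) - lm i *: b i).

(** The difference phi b_i - lm_i b_i involves only basis vectors of weight above that of b_i, hence
    not b_i itself; the diagonal entries are the lm_i, whatever the order of the basis. *)
Lemma is_trace_triangular : is_trace W phi (\sum_(i <- B) lm i).
Proof.
pose bb (i : 'I_(size bs)) := bs`_i.
pose ii (i : 'I_(size bs)) := nth i0 B i.
have lt_ii (i : 'I_(size bs)) : (i < size B)%N by rewrite -(size_map b).
have mem_ii i : ii i \in B by apply: mem_nth.
have bbE i : bb i = b (ii i) by rewrite /bb (nth_map i0).
(* Coordinates together with a control of their support, from which the diagonal entry is read
   off. *)
have coord (P : I -> Prop) z : (forall i, P i -> i \in B) ->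
    lspan (fun y => exists2 i, P i & y = b i) z ->
    exists c : 'I_(size bs) -> K, z = \sum_i c i *: bb i /\
      forall i, ~ P (ii i) -> c i = 0.
  move=> PB; elim=> [y [i Pi ->]||a y1 y2 _ [c1 [-> h1]] _ [c2 [-> h2]]].
  - have si : (index i B < size bs)%N by rewrite size_map index_mem PB.
    have e : ii (Ordinal si) = i by rewrite /ii /= nth_index ?PB.
    exists (fun k => (k == Ordinal si)%:R); split=> [|k nP].
      rewrite (bigD1 (Ordinal si)) //= eqxx scale1r bbE e big1 ?addr0 // => k.
      by move=> /negPf ->; rewrite scale0r.
    by case: eqP => // ek; case: nP; rewrite ek e.
  - by exists (fun=> 0); split=> //; rewrite big1 // => k _; rewrite scale0r.
  - exists (fun k => a * c1 k + c2 k); split=> [|k nP].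
      rewrite scaler_sumr -big_split /=; apply: eq_bigr => k _.
      by rewrite scalerA scalerDl.
    by rewrite h1 // h2 // mulr0 addr0.
have /choice [M hM] : forall j, exists c : 'I_(size bs) -> K,
    phi (bb j) = \sum_i c i *: bb i /\ c j = lm (ii j).
  move=> j; pose Pj i := i \in B /\ (w (ii j) < w i)%N.
  have [c [e h]] : exists c : 'I_(size bs) -> K,
      phi (bb j) - lm (ii j) *: bb j = \sum_i c i *: bb i /\
      forall i, ~ Pj (ii i) -> c i = 0.
    apply: (@coord Pj) => [i []//|]; rewrite bbE.
    apply: lspan_sub (triB (mem_ii j)) => y [i iB [hw ->]].
    by exists i.
  exists (fun i => (i == j)%:R * lm (ii j) + c i); split; last first.
    by rewrite eqxx mul1r h ?addr0 // => -[_]; rewrite ltnn.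
  rewrite -[LHS](subrK (lm (ii j) *: bb j)) e.
  under [RHS]eq_bigr do rewrite scalerDl.
  rewrite big_split /= addrC; congr (_ + _).
  rewrite (bigD1 j) //= eqxx mul1r big1 ?addr0 // => k.
  by move=> /negPf ->; rewrite mul0r scale0r.
exists (size bs), bb, (\matrix_(i, j) M j i); split.
- split=> [i|x Wx]; first by rewrite bbE; apply: WB.
  have [|c [e _]] := @coord (fun i => i \in B) x _ (spanB Wx); first by [].
  exists c; split=> // c' e'; apply: funext => i.
  apply/eqP; rewrite -subr_eq0; apply/eqP; move: i; apply: indB.
  under eq_bigr do rewrite scalerBl.
  by rewrite sumrB -[X in X - _]e -[X in _ - X]e' subrr.
- by move=> j; rewrite (hM j).1; apply: eq_bigr => i _; rewrite mxE.
- rewrite (big_nth i0) -(size_map b) big_mkord; apply: eq_bigr => i _.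
  by rewrite mxE (hM i).2.
Qed.

End TriangularTrace.

Lemma lspanD (K : fieldType) (V : lmodType K) (P : V -> Prop) y z :
  lspan P y -> lspan P z -> lspan P (y + z).
Proof. by move=> h1 h2; rewrite -[y]scale1r; apply: lspan_lin. Qed.

Lemma indep_image (K : fieldType) (V W : lmodType K) (I : Type) (f : V -> W)
    (g : I -> V) (s : seq I) :
  (forall c x y, f (c *: x + y) = c *: f x + f y) ->
  indep [seq f (g i) | i <- s] -> indep [seq g i | i <- s].
Proof.
move=> lf /indepP h; apply/indepP => c; rewrite size_map => sz e.
apply: h; first by rewrite size_map.
have f0 : f 0 = 0 by have := lf (-1) 0 0; rewrite scaler0 addr0 scaleN1r addNr.
suff -> : lcomb c [seq f (g i) | i <- s] = f (lcomb c [seq g i | i <- s]) by rewrite e.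
elim: s c sz {e} => [|i s IH] [|a c] //=; first by rewrite /lcomb !big_ord0.
by move=> [sz]; rewrite !lcomb_cons lf IH.
Qed.

(** * Traces on the free part *)

Lemma moebius_sqr p d : prime p -> (0 < d)%N -> (p * p %| d)%N -> moebius d = 0.
Proof.
move=> pp d0 pd; rewrite /moebius; case: allP => // h.
have dp : (p %| d)%N := dvdn_trans (dvdn_mulr p (dvdnn p)) pd.
have := h p; rewrite mem_primes pp d0 dp => /(_ isT)/eqP e.
by move: pd; rewrite -[(p * p)%N]/(p ^ 2)%N pfactor_dvdn // e.
Qed.

Lemma moebiusM p d : prime p -> (0 < d)%N -> ~~ (p %| d)%N ->
  moebius (p * d) = - moebius d.
Proof.
move=> pp d0 pd; have p0 := prime_gt0 pp.
have pm : perm_eq (primes (p * d)) (p :: primes d).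
  apply: uniq_perm; rewrite ?primes_uniq //=.
    by rewrite mem_primes (negPf pd) !andbF primes_uniq.
  by move=> q; rewrite primesM // primes_prime // !inE.
rewrite /moebius (perm_all _ pm) (perm_size pm) /= lognM // logn_prime // eqxx.
rewrite (_ : logn p d = 0%N) /=; last first.
  by apply/eqP; rewrite -leqn0 leqNgt logn_gt0 mem_primes (negPf pd) !andbF.
rewrite (eq_in_all (a2 := fun q => logn q d == 1%N)); last first.
  move=> q qd; rewrite lognM // logn_prime // (_ : (q == p) = false) //.
  by apply: contraNF pd => /eqP <-; move: qd; rewrite mem_primes => /and3P[].
by case: ifP; rewrite ?oppr0 // exprS mulN1r.
Qed.

(** Let p be the least prime factor of n. Divisors divisible by p^2 contribute 0, and the others are
    paired as d and p d with opposite values. *)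
Lemma moebius_sum n : (0 < n)%N -> \sum_(d <- divisors n) moebius d = (n == 1%N)%:R.
Proof.
move=> n0; have [->|n1] := eqVneq n 1%N; first by rewrite big_seq1.
have pp : prime (pdiv n) by rewrite pdiv_prime // ltn_neqAle eq_sym n1.
set p := pdiv n in pp; have pn : (p %| n)%N := pdiv_dvd n.
have dpos d : d \in divisors n -> (0 < d)%N.
  by rewrite -dvdn_divisors // => /(dvdn_gt0 n0).
rewrite (bigID (fun d => p * p %| d)%N) /= big_seq_cond big1 ?add0r => [|d]; last first.
  by move=> /andP[/dpos h1 h2]; apply: moebius_sqr h2.
rewrite (bigID (fun d => p %| d)%N) /=.
rewrite -big_filter (perm_big [seq (p * d)%N | d <- divisors n & ~~ (p %| d)%N]) /=.
  rewrite big_map big_filter [X in _ + X](eq_bigl (fun d => ~~ (p %| d)%N)); last first.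
    move=> d; case: (boolP (p %| d)%N); rewrite ?andbF ?andbT //.
    by apply: contra => h; apply: dvdn_trans h; apply: dvdn_mulr.
  rewrite -big_split big_seq_cond big1 // => d /andP[dn pd].
  by rewrite (moebiusM pp (dpos _ dn) pd); apply: addNr.
have p0 := prime_gt0 pp.
apply: uniq_perm.
- exact/filter_uniq/divisors_uniq.
- rewrite map_inj_uniq; first exact/filter_uniq/divisors_uniq.
  by move=> a b /eqP; rewrite eqn_pmul2l // => /eqP.
move=> d; rewrite mem_filter; apply/andP/mapP => [[/andP[h1 /dvdnP[e h2]] h3]|[e]].
  exists e; last by rewrite mulnC.
  rewrite mem_filter -!dvdn_divisors // in h3 *; rewrite h2 in h1 h3.
  by rewrite dvdn_pmul2r // in h1; rewrite h1; apply: dvdn_trans h3; apply: dvdn_mulr.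
rewrite mem_filter -!dvdn_divisors // => /andP[h1 h2] ->; split.
  by rewrite dvdn_pmul2l // h1 dvdn_mulr.
by rewrite Gauss_dvd ?pn // prime_coprime.
Qed.

Lemma divisors_sum (V : nmodType) (F : nat -> nat -> V) g : (0 < g)%N ->
  \sum_(d <- divisors g) \sum_(e <- divisors (g %/ d)) F d (d * e)%N =
  \sum_(D <- divisors g) \sum_(d <- divisors D) F d D.
Proof.
move=> g0.
have e1 D : D \in divisors g ->
    \sum_(d <- divisors D) F d D = \sum_(d <- divisors g | (d %| D)%N) F d D.
  rewrite -dvdn_divisors // => Dg; rewrite -[RHS]big_filter; apply: perm_big.
  apply: uniq_perm; rewrite ?filter_uniq ?divisors_uniq // => d.
  rewrite mem_filter -!dvdn_divisors //; last exact: dvdn_gt0 Dg.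
  by case dD: (d %| D)%N => //=; rewrite (dvdn_trans dD Dg).
rewrite [RHS]big_seq (eq_bigr _ e1) -big_seq.
rewrite (exchange_big_dep xpredT) //= big_seq [RHS]big_seq; apply: eq_bigr => d.
rewrite -dvdn_divisors // => dg; have d0 := dvdn_gt0 g0 dg.
rewrite -[RHS]big_filter -(big_map (fun e => d * e)%N xpredT (F d)).
apply: perm_big; apply: uniq_perm; rewrite ?filter_uniq ?divisors_uniq //.
  rewrite map_inj_uniq ?divisors_uniq // => a b /eqP.
  by rewrite eqn_pmul2l // => /eqP.
move=> D; rewrite mem_filter; apply/mapP/andP => [[e + ->]|[/dvdnP[e ->]]].
  rewrite -!dvdn_divisors ?divn_gt0 ?(dvdn_leq g0 dg) // => he.
  by rewrite dvdn_mulr // -[X in (_ %| X)%N](divnK dg) mulnC dvdn_pmul2r.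
rewrite -!dvdn_divisors // => he; exists e; last by rewrite mulnC.
rewrite -dvdn_divisors ?divn_gt0 ?(dvdn_leq g0 dg) //.
by rewrite -(dvdn_pmul2r d0) divnK.
Qed.

Section MoebiusInversion.
Variables (K : numFieldType) (t Phi : nat -> nat -> nat -> K).
Variables (m n : nat).
Hypothesis m0 : (0 < m)%N.
Hypothesis PhiE : forall d, (d %| gcdn m n)%N ->
  Phi d (m %/ d)%N (n %/ d)%N = \sum_(k <- divisors (gcdn m n %/ d))
    k%:R^-1 * t (k * d)%N (m %/ d %/ k)%N (n %/ d %/ k)%N.

(** Inserting the hypothesis for every d and collecting the terms with D = k d, the coefficient of
    t_D(m / D, n / D) is 1 / D times the sum of the Moebius function over the divisors of D. *)
Lemma moebius_inversion :
  t 1%N m n = \sum_(d <- divisors (gcdn m n)) d%:R^-1 * (moebius d)%:~R *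
    Phi d (m %/ d)%N (n %/ d)%N.
Proof.
have g0 : (0 < gcdn m n)%N by rewrite gcdn_gt0 m0.
pose F d D : K := (moebius d)%:~R * (D%:R^-1 * t D (m %/ D)%N (n %/ D)%N).
transitivity (\sum_(d <- divisors (gcdn m n))
    \sum_(e <- divisors (gcdn m n %/ d)) F d (d * e)%N); last first.
  rewrite big_seq [RHS]big_seq; apply: eq_bigr => d; rewrite -dvdn_divisors // => dg.
  rewrite PhiE // mulr_sumr; apply: eq_bigr => k _; rewrite /F natrM invfM !divnMA.
  by rewrite [(k * d)%N]mulnC; ring.
rewrite divisors_sum // (bigD1_seq 1%N) ?divisors_uniq //=; last first.
  by rewrite -dvdn_divisors.
rewrite big_seq1 /F /= !divn1 invr1 !mul1r big_seq_cond big1 ?addr0 //.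
move=> D /andP[]; rewrite -dvdn_divisors // => Dg D1.
have D0 := dvdn_gt0 g0 Dg.
by rewrite -mulr_suml -rmorph_sum /= moebius_sum // (negPf D1) mul0r.
Qed.

End MoebiusInversion.

Lemma sum_divisors_pair (K : fieldType) m n i j k (F : nat -> K) :
  (0 < m)%N -> (0 < n)%N -> m = (k * i)%N -> n = (k * j)%N ->
  \sum_(d <- divisors (gcdn m n) | (i == m %/ d)%N && (j == n %/ d)%N) F d = F k.
Proof.
move=> m0 n0 em en; have g0 : (0 < gcdn m n)%N by rewrite gcdn_gt0 m0.
have [k0 i0] : (0 < k)%N /\ (0 < i)%N by move: m0; rewrite em muln_gt0 => /andP.
rewrite big_mkcond (bigD1_seq k) ?divisors_uniq //=; last first.
  by rewrite -dvdn_divisors // dvdn_gcd em en !dvdn_mulr.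
rewrite em en !mulKn // !eqxx /= big_seq_cond big1 ?addr0 // => d /andP[].
rewrite -em -en -dvdn_divisors // dvdn_gcd => /andP[dm dn] dk.
case: andP => // -[/eqP ei _]; case/eqP: dk; apply/eqP.
by rewrite -(eqn_pmul2r i0) -em {1}ei mulnC divnK.
Qed.

Lemma sum_divisors_pair0 (K : fieldType) m n i j (F : nat -> K) :
  (0 < m)%N -> (0 < n)%N -> (forall k, (m == k * i)%N && (n == k * j)%N = false) ->
  \sum_(d <- divisors (gcdn m n) | (i == m %/ d)%N && (j == n %/ d)%N) F d = 0.
Proof.
move=> m0 n0 h; have g0 : (0 < gcdn m n)%N by rewrite gcdn_gt0 m0.
rewrite big_seq_cond big1 // => d /andP[]; rewrite -dvdn_divisors // dvdn_gcd.
move=> /andP[dm dn] /andP[/eqP ei /eqP ej]; have := h d.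
by rewrite ei ej ![(d * _)%N]mulnC !divnK // !eqxx.
Qed.

(** The series is the sum over r of j c^r x^(r i) y^(r j), and at r = k division by n = k j leaves
    c^k / k. *)
Lemma cf_dlog_mono (K : numFieldType) N i j (c : K) m n : (0 < n)%N -> (n <= N)%N ->
  (forall k, m = (k * i)%N -> n = (k * j)%N ->
     n%:R^-1 * cf m n (dlog N (mono i j c)) = k%:R^-1 * c ^+ k) /\
  ((forall k, (m == k * i)%N && (n == k * j)%N = false) ->
     cf m n (dlog N (mono i j c)) = 0).
Proof.
move=> n0 nN.
have e : cf m n (dlog N (mono i j c)) =
    \sum_(r < N.+1) (j%:R * c ^+ r.+1) *+ ((m == r.+1 * i)%N && (n == r.+1 * j)%N).
  rewrite /dlog euler_mono -mulrA /geo mulr_sumr mulr_sumr cf_sum.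
  apply: eq_bigr => r _; rewrite -exprS monoX.
  have -> : (j%:R : {poly {poly K}}) = mono 0 0 (j%:R).
    by rewrite /mono !expr0 mulr1 alg_polyC -!polyC_natr.
  by rewrite monoM !add0n cf_mono.
split=> [k em en|h]; rewrite e; last by rewrite big1 // => r _; rewrite h.
have [k0 j0] : (0 < k)%N /\ (0 < j)%N by move: n0; rewrite en muln_gt0 => /andP.
have kN : (k.-1 < N.+1)%N.
  by have := leq_pmulr k j0; move: nN; rewrite en; lia.
rewrite (bigD1 (Ordinal kN)) //= prednK // -em -en !eqxx mulr1n big1 ?addr0.
  rewrite {1}en natrM invfM mulrA -[k%:R^-1 / _ * _]mulrA mulVf ?mulr1 //.
  by rewrite pnatr_eq0 -lt0n.
move=> r rk; case: andP => // -[_ /eqP h]; case/eqP: rk; apply: val_inj => /=.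
by move: h => /eqP; rewrite en eqn_pmul2r // => /eqP ->.
Qed.

(** * Supertraces of the basis and the logarithmic derivative *)

Section KeyIdentity.
Variables (K : numFieldType) (Q : zmodType) (L : lmodType K).
Variables (br : L -> L -> L) (th : Q -> Q -> K) (hom : Q -> L -> Prop).
Hypothesis CL : colored_lie br th hom.
Local Notation letter := (letter Q L).

(** The sign turns a sum of eigenvalues into a supertrace, and like the eigenvalue it is
    multiplicative under brackets. *)
Definition nu d (a : letter) : K := th (qd a) (qd a) * lam a ^+ d.

Lemma nuM d x y : nu d (lcom br x y) = nu d x * nu d y.
Proof. by rewrite /nu (th_double CL) exprMn mulrACA. Qed.

Definition strace E d i j : K :=
  \sum_(e <- plus br th E | (dm e == i) && (dn e == j)) nu d e.

(* An odd letter contributes - 1 / k, and its square 2 / k for even k; together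
   (- 1)^k / k. *)
Lemma strace_elimination N A E d m n : elimination br N A E ->
  (forall a, a \in A -> (0 < ht a)%N) ->
  (0 < m)%N -> (0 < n)%N -> (m + n <= N)%N ->
  \sum_(k <- divisors (gcdn m n)) k%:R^-1 * strace E (k * d)%N (m %/ k)%N (n %/ k)%N =
  n%:R^-1 * cf m n (dlog N (gf (nu d) A)).
Proof.
move=> hE hA m0 n0 hN.
have [_ h] := gf_elimination (nuM d) hE hA.
rewrite (eqtr_cf h hN) cf_sum mulr_sumr.
under eq_bigr do rewrite /strace big_mkcond sum_plus mulr_sumr.
rewrite exchange_big /=; apply: eq_bigr => e _.
set i := dm e; set j := dn e.
pose F k := k%:R^-1 * nu (k * d)%N e.
pose G k := k%:R^-1 * nu (k * d)%N (sq br e).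
transitivity (\sum_(k <- divisors (gcdn m n) | (i == m %/ k)%N && (j == n %/ k)%N) F k
  + if is_odd th e then
      \sum_(k <- divisors (gcdn m n) | (i + i == m %/ k)%N && (j + j == n %/ k)%N) G k
    else 0).
  case: (is_odd th e).
    rewrite [X in _ = X + _]big_mkcond [X in _ = _ + X]big_mkcond -big_split.
    apply: eq_bigr => k _ /=.
    by rewrite mulrDr; congr (_ + _); case: ifP; rewrite ?mulr0.
  rewrite addr0 [RHS]big_mkcond; apply: eq_bigr => k _ /=.
  by rewrite addr0; case: ifP; rewrite ?mulr0.
have [hmu1 hmu0] := @cf_dlog_mono K N i j (nu d e) m n n0 (leq_trans (leq_addl _ _) hN).
have [[k [em en]]|no] := pselect (exists k, m = (k * i)%N /\ n = (k * j)%N); last first.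
  have no' k : (m == k * i)%N && (n == k * j)%N = false.
    by apply/andP => -[/eqP h1 /eqP h2]; case: no; exists k.
  rewrite hmu0 // mulr0 sum_divisors_pair0 // add0r; case: ifP => // _.
  apply: sum_divisors_pair0 => // k; apply/andP => -[/eqP h1 /eqP h2].
  by case: no; exists (k * 2)%N; rewrite h1 h2; split; ring.
rewrite (hmu1 k em en) (sum_divisors_pair _ m0 n0 em en).
have k0 : (0 < k)%N by move: m0; rewrite em muln_gt0 => /andP[].
rewrite /F /nu exprMn -exprM [(d * k)%N]mulnC.
have nuG k1 : nu k1 (sq br e) = lam e ^+ (2 * k1).
  rewrite /nu /= (th_double CL) -!expr2 -exprM.
  by case: (th_self CL (qd e)) => ->; rewrite ?sqrrN expr1n mul1r.
have [eo|eo] := boolP (is_odd th e); last first.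
  have -> : th (qd e) (qd e) = 1.
    by case: (th_self CL (qd e)) eo => // h'; rewrite /is_odd h' eqxx.
  by rewrite expr1n addr0.
rewrite (eqP eo); have [ko|ke] := boolP (odd k).
  rewrite sum_divisors_pair0 ?addr0 //; first by rewrite -signr_odd ko expr1.
  move=> k1; apply/andP => -[/eqP h1 _].
  have : (k == k1 * 2)%N.
    have i0 : (0 < i)%N by move: m0; rewrite em muln_gt0 => /andP[].
    by rewrite -(eqn_pmul2r i0) -em h1; apply/eqP; ring.
  by move/eqP => e'; move: ko; rewrite e' oddM andbF.
have ek : k = (k./2 * 2)%N by rewrite muln2 even_halfK.
have em' : m = (k./2 * (i + i))%N by rewrite em {1}ek -mulnA mul2n addnn.
have en' : n = (k./2 * (j + j))%N by rewrite en {1}ek -mulnA mul2n addnn.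
rewrite (sum_divisors_pair _ m0 n0 em' en') /G nuG mulnA [(2 * _)%N]mulnC -ek.
rewrite -signr_odd (negPf ke) expr0 mul1r mulN1r mulrN.
have -> : k%:R^-1 = (k./2)%:R^-1 / 2%:R :> K by rewrite {1}ek natrM invfM.
have h0 : (k./2)%:R != 0 :> K.
  by rewrite pnatr_eq0 -lt0n; move: k0; rewrite {1}ek muln_gt0 => /andP[].
have h2 : 2%:R != 0 :> K by rewrite pnatr_eq0.
by field.
Qed.

End KeyIdentity.

(** * The sum over families *)

(** Permutations are sorted by their first letter x; removing it divides the product of factorials
    by the multiplicity of x, and the multiplicities sum to the length. *)
Lemma size_permutations_count (X : eqType) (D s : seq X) : uniq D -> {subset s <= D} ->
  (size (permutations s) * \prod_(x <- D) (count_mem x s)`! = (size s)`!)%N.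
Proof.
move=> uD; move e: (size s) => n; elim: n s e => [|n IH] s e sD.
  by rewrite (size0nil e) /= big1 // => x _.
have s0 : (0 < size s)%N by rewrite e.
rewrite (perm_size (permutationsE s0)) size_allpairs_dep sumnE big_map big_distrl /=.
transitivity (\sum_(x <- undup s) count_mem x s * n`!)%N.
  rewrite big_seq [RHS]big_seq; apply: eq_bigr => x; rewrite mem_undup => xs.
  rewrite -(IH (rem x s)); first last.
  - by move=> y /mem_rem /sD.
  - by rewrite size_rem // e.
  rewrite mulnCA; congr (_ * _)%N.
  rewrite (bigD1_seq x) ?sD //= [in RHS](bigD1_seq x) ?sD //=.
  have c y : count_mem y s = ((x == y) + count_mem y (rem x s))%N.
    by rewrite (permP (perm_to_rem xs)).
  rewrite mulnA; congr (_ * _)%N; first by rewrite c eqxx.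
  by apply: eq_bigr => y yx; rewrite c eq_sym (negPf yx).
rewrite -big_distrl /= factS; congr (_ * _)%N; rewrite -e -[RHS]sum1_size.
rewrite -[RHS]big_undup_iterop_count; apply: eq_bigr => x _.
by elim: (count_mem x s) => [|[|k] IHk] //=; rewrite -add1n {1}IHk.
Qed.

Lemma mem_words (X : choiceType) (D : seq X) r w :
  (w \in words D r) = (size w == r) && all (mem D) w.
Proof.
apply/idP/andP => [/wordsP[-> ->] //|[/eqP <-]].
elim: w => //= x w IH /andP[xD /IH hw].
by apply/allpairsP; exists (x, w).
Qed.

Section FamilyWords.
Implicit Types (s : fam) (w : seq (nat * nat)).

(** A family is a multiset of pairs; T(m, n) becomes the set of words of bidegree (m, n) up to the
    order of their letters. *)
Definition fam_word s := flatten [seq nseq (s p) p | p <- finsupp s].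

Definition word_fam w : fam :=
  [fsfun p in seq_fset tt w => count_mem p w].

Lemma word_famE w p : word_fam w p = count_mem p w.
Proof.
rewrite fsfun_fun seq_fsetE; case: ifP => // pw.
by apply/esym/count_memPn; rewrite pw.
Qed.

Lemma big_fam_word (R : Type) (idx : R) (op : Monoid.law idx) (f : nat * nat -> R) s :
  \big[op/idx]_(x <- fam_word s) f x =
  \big[op/idx]_(p <- finsupp s) iter (s p) (op (f p)) idx.
Proof.
rewrite big_flatten big_map; apply: eq_bigr => p _.
by elim: (s p) => [|k IH] /=; rewrite ?big_nil // big_cons IH.
Qed.

Lemma count_fam_word s p : count_mem p (fam_word s) = s p.
Proof.
rewrite -sum1_count big_mkcond big_fam_word /=.
have e (k q : nat) : iter k (addn q) 0%N = (k * q)%N by elim: k => //= k ->.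
under eq_bigr do rewrite e.
have [ps|ps] := boolP (p \in finsupp s).
  rewrite (big_fsetD1 p) //= eqxx muln1 big1_fset ?addn0 // => q.
  by rewrite !inE => /andP[/negPf -> _]; rewrite muln0.
rewrite big1_fset ?fsfun_dflt // => q qs _.
by case: eqP => [eq|]; rewrite ?muln0 //; rewrite -eq qs in ps.
Qed.

Lemma word_famP s w : (word_fam w == s) = perm_eq w (fam_word s).
Proof.
apply/eqP/idP => [<-|h].
  by apply/allP => p _ /=; rewrite count_fam_word word_famE.
by apply/fsfunP => p; rewrite word_famE (permP h) count_fam_word.
Qed.

Lemma wsum_fam_word f s : wsum f (fam_word s) = (\sum_(p <- finsupp s) s p * f p)%N.
Proof.
rewrite /wsum big_fam_word; apply: eq_bigr => p _ /=.
by elim: (s p) => //= k ->.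
Qed.

Lemma size_fam_word s : size (fam_word s) = fam_size s.
Proof.
rewrite -sum1_size -[LHS]/(wsum (fun=> 1%N) _) wsum_fam_word /fam_size.
by apply: eq_bigr => p _; rewrite muln1.
Qed.

Lemma size_permutations_fam s :
  (size (permutations (fam_word s)) * fam_fact s = (fam_size s)`!)%N.
Proof.
rewrite -size_fam_word -(@size_permutations_count _ (finsupp s)).
- by congr (_ * _)%N; apply: eq_bigr => p _; rewrite count_fam_word.
- exact: fset_uniq.
- move=> p /flatten_mapP[q qs]; rewrite mem_nseq => /andP[_ /eqP ->].
  exact: qs.
Qed.

End FamilyWords.

Definition pairs N : seq (nat * nat) := [seq (i, j) | i <- iota 1 N, j <- iota 1 N].

Lemma mem_pairs N p : (p \in pairs N) = [&& 0 < p.1, p.1 <= N, 0 < p.2 & p.2 <= N]%N.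
Proof.
case: p => i j; apply/allpairsP/idP => [[[i' j'] /= [hi hj [-> ->]]]|].
  by move: hi hj; rewrite !mem_iota; lia.
by move=> /= h; exists (i, j); split=> //=; rewrite mem_iota; move: h; lia.
Qed.

Lemma pairs_uniq N : uniq (pairs N).
Proof. by apply: allpairs_uniq; rewrite ?iota_uniq // => -[a b] [c d]. Qed.

Section Multinomial.
Variables (K : numFieldType) (u : nat * nat -> K) (N m n : nat).
Hypotheses (m0 : (0 < m)%N) (n0 : (0 < n)%N) (hN : (m + n <= N)%N).

Definition pair_series := \sum_(p <- pairs N) mono p.1 p.2 (u p).

(** The length bound N + 1 matches the powers of v up to v^(N+1) to which the terms of [dlog N v]
    correspond. *)
Definition words_to := base_words fst snd (pairs N) N.+1 m n.

Lemma words_to_uniq : uniq words_to.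
Proof. exact/base_words_uniq/pairs_uniq. Qed.

Lemma mem_words_to w : (w \in words_to) = [&& all (mem (pairs N)) w,
  (size w <= N.+1)%N, wsum fst w == m & wsum snd w == n].
Proof.
rewrite mem_filter; apply/andP/and4P => [[/andP[h1 h2] /flatten_mapP[r]]|[h1 h2 h3 h4]].
  by rewrite mem_iota mem_words ltnS => hr /andP[/eqP e hw]; rewrite e.
split; first by rewrite h3.
apply/flatten_mapP; exists (size w); last by rewrite mem_words eqxx.
by rewrite mem_iota ltnS.
Qed.

(** The Euler operator takes v^(r+1) to (r + 1) v^r times the Euler derivative of v, and multiplies
    the coefficient at y^n by n. Dividing by n thus recovers the coefficients of v^(r+1) / (r + 1)
    without forming a logarithm. *)
Lemma cf_dlog_words : n%:R^-1 * cf m n (dlog N pair_series) =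
  \sum_(w <- words_to) (size w)%:R^-1 * \prod_(p <- w) u p.
Proof.
rewrite /dlog /geo mulr_sumr cf_sum mulr_sumr.
rewrite /words_to big_filter big_flatten big_map -[iota 0 _]/(0%N :: iota 1 N.+1) big_cons.
(* The empty word is excluded because m is positive. *)
rewrite [X in _ = X + _](_ : _ = 0) ?add0r; last first.
  by rewrite big_mkcond big_seq1 /wsum !big_nil eq_sym gtn_eqF.
rewrite -[iota 1 _]/(index_iota 1 N.+2) big_add1 /= big_mkord; apply: eq_bigr => r _.
have -> : cf m n (euler pair_series * pair_series ^+ r) =
    n%:R / r.+1%:R * cf m n (pair_series ^+ r.+1).
  have r0 : r.+1%:R != 0 :> K by rewrite pnatr_eq0.
  apply: (mulfI r0); rewrite mulrA [_%:R * (_ / _)]mulrCA divff // mulr1 -cf_euler.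
  rewrite /euler deriv_exp -mulrnAr mulrA.
  by rewrite /cf mulrnAr !coefMn mulr_natl.
rewrite mulrA [n%:R^-1 * _]mulrA mulVf ?pnatr_eq0 -?lt0n // mul1r.
rewrite pow_words cf_sum mulr_sumr [RHS]big_mkcond big_seq [RHS]big_seq.
apply: eq_bigr => w; rewrite mem_words => /andP[/eqP sw _].
rewrite cf_mono [m == _]eq_sym [n == _]eq_sym sw.
by case: andP; rewrite ?mulr0.
Qed.

Lemma fam_size_bound s : s \in Tset m n -> (0 < fam_size s <= N.+1)%N.
Proof.
rewrite inE => -[pos [sm sn]].
have h p : p \in finsupp s -> (s p <= s p * p.1)%N.
  by move=> /pos /andP[p1 _]; rewrite leq_pmulr.
have hm : (fam_size s <= m)%N.
  rewrite -sm /fam_size !big_seq; apply: leq_sum => p; exact: h.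
apply/andP; split; last by move: hm hN; lia.
rewrite lt0n; apply/eqP => e; move: m0; rewrite -sm big_seq big1 // => p ps.
have : (s p <= fam_size s)%N by rewrite /fam_size (big_fsetD1 p) //= leq_addr.
by rewrite e leqn0 => /eqP ->.
Qed.

Lemma Tset_bound s p : s \in Tset m n -> p \in finsupp s ->
  (0 < p.1 <= m)%N && (0 < p.2 <= n)%N.
Proof.
rewrite inE => -[pos [sm sn]] ps; have /andP[p1 p2] := pos _ ps; rewrite p1 p2.
have sp : (0 < s p)%N by rewrite lt0n -mem_finsupp.
have h1 : (s p * p.1 <= m)%N by rewrite -sm (big_fsetD1 p) //= leq_addr.
have h2 : (s p * p.2 <= n)%N by rewrite -sn (big_fsetD1 p) //= leq_addr.
by rewrite (leq_trans (leq_pmull p.1 sp) h1) (leq_trans (leq_pmull p.2 sp) h2).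
Qed.

Lemma fam_word_to s : s \in Tset m n -> fam_word s \in words_to.
Proof.
move=> hs; have hb := fam_size_bound hs; have := hs; rewrite inE => -[_ [sm sn]].
rewrite mem_words_to size_fam_word (andP hb).2 !wsum_fam_word sm sn !eqxx !andbT.
apply/allP => p /flatten_mapP[q qs]; rewrite mem_nseq => /andP[_ /eqP ->] /=.
have /andP[/andP[q1 h1] /andP[q2 h2]] := Tset_bound hs (p := q) qs.
rewrite mem_pairs q1 q2 (leq_trans h1 (leq_trans (leq_addr _ _) hN)).
by rewrite (leq_trans h2 (leq_trans (leq_addl _ _) hN)).
Qed.

Lemma word_fam_to w : w \in words_to -> word_fam w \in Tset m n.
Proof.
rewrite mem_words_to => /and4P[hw _ /eqP hm /eqP hn].
have pw : perm_eq w (fam_word (word_fam w)) by rewrite -word_famP.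
rewrite inE; split; last first.
  by rewrite -!wsum_fam_word -hm -hn /wsum -!(perm_big _ pw).
move=> p; rewrite mem_finsupp word_famE -lt0n -has_count => /hasP[q qw /eqP <-].
by have := allP hw _ qw; rewrite /= mem_pairs => /and4P[-> _ ->].
Qed.

(** Words are grouped by their family: |s|! / s! words belong to s, each with coefficient 1 /
    |s|. *)
Lemma multinomial_dlog : n%:R^-1 * cf m n (dlog N pair_series) =
  \sum_(s \in Tset m n) (((fam_size s).-1)`!%:R / (fam_fact s)%:R *
     \prod_(p <- finsupp s) u p ^+ s p).
Proof.
rewrite cf_dlog_words fsbig_finite /=; last exact: finite_Tset.
set S := fset_set _.
have memS s : (s \in S) = (s \in Tset m n) by rewrite in_fset_set //; apply: finite_Tset.
transitivity (\sum_(s <- S) \sum_(w <- words_to | word_fam w == s)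
    (size w)%:R^-1 * \prod_(p <- w) u p).
  under [RHS]eq_bigr do rewrite big_mkcond.
  rewrite exchange_big /= big_seq [RHS]big_seq; apply: eq_bigr => w hw.
  have wS : word_fam w \in S by rewrite memS; apply: word_fam_to.
  rewrite (big_fsetD1 (word_fam w)) //= eqxx big1_fset ?addr0 // => s.
  by rewrite !inE eq_sym => /andP[/negPf ->].
rewrite big_seq [RHS]big_seq; apply: eq_bigr => s; rewrite memS => hs.
have pp : perm_eq [seq w <- words_to | word_fam w == s] (permutations (fam_word s)).
  apply: uniq_perm => [||w]; [exact/filter_uniq/words_to_uniq|exact: permutations_uniq|].
  rewrite mem_filter mem_permutations word_famP.
  case pw: (perm_eq w _) => //=; have := fam_word_to hs.
  rewrite !mem_words_to (perm_all _ pw) (perm_size pw) /wsum.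
  by rewrite -!(perm_big _ pw).
transitivity (\sum_(w <- permutations (fam_word s)) (size w)%:R^-1 * \prod_(p <- w) u p).
  by rewrite -(perm_big _ pp) big_filter.
rewrite big_seq.
have e : forall w, w \in permutations (fam_word s) ->
    (size w)%:R^-1 * \prod_(p <- w) u p =
    (fam_size s)%:R^-1 * \prod_(p <- finsupp s) u p ^+ s p.
  move=> w; rewrite mem_permutations => pw; rewrite (perm_size pw) size_fam_word.
  congr (_ * _); rewrite (perm_big _ pw) big_fam_word; apply: eq_bigr => p _.
  by elim: (s p) => [|k IH]; rewrite ?expr0 // exprS /= IH.
rewrite (eq_bigr _ e) -[LHS]big_seq big_const_seq count_predT.
rewrite iter_addr_0 -[LHS]mulr_natl mulrA; congr (_ * _).
have s0 : (fam_size s != 0)%N by have := fam_size_bound hs; rewrite lt0n => /andP[].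
have f0 : (fam_fact s)%:R != 0 :> K.
  by rewrite pnatr_eq0 -lt0n; apply: prodn_gt0 => p; apply: fact_gt0.
apply: (mulIf f0); rewrite mulfVK // mulrAC -natrM size_permutations_fam.
have : (0 < fam_size s)%N by rewrite lt0n.
case: (fam_size s) => // k _; rewrite factS natrM mulrAC mulfV ?mul1r //.
by rewrite pnatr_eq0.
Qed.

End Multinomial.

Section SeriesComplements.
Variables (K : fieldType) (N : nat).
Implicit Types p q : {poly {poly K}}.

Lemma cfM m n p q : cf m n (p * q) =
  \sum_(k < n.+1) \sum_(i < m.+1) cf i k p * cf (m - i) (n - k) q.
Proof. by rewrite /cf coefM coef_sum; apply: eq_bigr => k _; rewrite coefM. Qed.

Lemma eqtr_euler p q : eqtr N p q -> eqtr N (euler p) (euler q).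
Proof.
move=> /vanish_euler; rewrite /eqtr (_ : euler (p - q) = euler p - euler q) //.
by rewrite /euler derivB mulrBr.
Qed.

Lemma eqtr_dlog p q : eqtr N p q -> eqtr N (dlog N p) (dlog N q).
Proof.
move=> h; apply: eqtrM; first exact: eqtr_euler.
rewrite /geo; elim: N.+1 => [|k IH]; first by rewrite !big_ord0; apply: eqtr_refl.
rewrite !big_ord_recr /=; apply: eqtrD => //.
by elim: k {IH} => [|k IH]; [exact: eqtr_refl|rewrite !exprS; apply: eqtrM].
Qed.

(** As p is divisible by x, products of the Euler derivative with positive powers of p are divisible
    by x^2. *)
Lemma cf_dlog1 n p : (forall j, cf 0 j p = 0) ->
  cf 1 n (dlog N p) = n%:R * cf 1 n p.
Proof.
move=> h; rewrite /dlog /geo big_ord_recl expr0 mulrDr mulr1 cfD cf_euler.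
have -> : \sum_(i < N) p ^+ fintype.lift ord0 i = p * \sum_(i < N) p ^+ i.
  by rewrite mulr_sumr; apply: eq_bigr => i _; rewrite -exprS.
rewrite cfM big1 ?addr0 // => k _; rewrite !big_ord_recl big_ord0 addr0.
by rewrite !cf_euler h mulr0 mul0r add0r /= cfM big1 ?mulr0 // => j _;
  rewrite big_ord_recl big_ord0 h mul0r addr0.
Qed.

End SeriesComplements.

Lemma cf_pair_series (K : numFieldType) (u : nat * nat -> K) N i j : (i + j <= N)%N ->
  cf i j (pair_series u N) = if (0 < i)%N && (0 < j)%N then u (i, j) else 0.
Proof.
move=> hN; rewrite /pair_series cf_sum.
under eq_bigr => p _ do rewrite cf_mono.
case: ifP => [/andP[i0 j0]|h].
  rewrite (bigD1_seq (i, j)) ?pairs_uniq //=; last first.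
    by rewrite mem_pairs /= i0 j0 !(leq_trans _ hN) ?leq_addr ?leq_addl.
  rewrite !eqxx mulr1n big1 ?addr0 // => -[a b] /= ne.
  by case: andP => // -[/eqP ea /eqP eb]; case/eqP: ne; rewrite ea eb.
rewrite big_seq big1 // => -[a b]; rewrite mem_pairs /= => /and4P[a0 _ b0 _].
by case: andP => // -[/eqP ea /eqP eb]; move: h; rewrite ea eb a0 b0.
Qed.

(** * The letters of the monstrous algebra *)

Section Model.
Variables (K : numClosedFieldType) (mm : idx -> nat).
Local Notation Q := (rootlattice idx).
Local Notation al := (@sroot idx).
Local Notation al0 := (al idxN1).
Local Notation gen := (gen mm).
Variables (L : lmodType K) (br : L -> L -> L) (th : Q -> Q -> K).
Variable hom : Q -> L -> Prop.
Hypothesis CL : colored_lie br th hom.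
Hypothesis th_al0 : th al0 al0 = 1.
Variable pm : magma gen -> L.
Local Notation mdeg := (Defs.mdeg (@gdeg idx mm)).
Local Notation sgen := (sgen pm).
Hypothesis hom_pm : forall w, hom (mdeg w) (pm w).
Variable k0 : 'I_(mm idxN1).
Hypothesis k0_uniq : forall k : 'I_(mm idxN1), k = k0.
Local Notation f0 := (sgen false k0).
Hypothesis serre_f : forall j (k : 'I_(mm j)), j != idxN1 ->
  iter (absx j) (br f0) (sgen false k) = 0.

Local Notation nil := (nil br pm false).
Local Notation uletter := (uletter mm).
Local Notation udeg := (@udeg Q mm al).
Local Notation pdeg := (pdeg al).
Local Notation valid := (valid mm).

Variables (P Pi D : forall j, 'M[K]_(mm j)).
Hypothesis PPi : forall j, Pi j *m P j = 1%:M.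

(** A row of P gives a vector of the basis of V_j in which the automorphism is triangular. The index
    is a natural number with default value 0, so that it can be the last entry of a triple. *)
Definition ybase j (k : nat) : L :=
  if insub k is Some k1 then \sum_k2 P j k1 k2 *: sgen false k2 else 0.

Definition yeig j (k : nat) : K :=
  if insub k is Some k1 then D j k1 k1 else 0.

Definition uel (p : idx * nat * nat) : L :=
  iter p.1.2 (br f0) (ybase p.1.1 p.2).

(** D being lower triangular, the image of the k-th vector involves those of index at most k, which
    must get larger weights. The exponent of ad f_{-1} does not enter, as f_{-1} is fixed. *)
Definition uwt (p : idx * nat * nat) : nat := (mm p.1.1 - p.2)%N.

Definition base_letter (x : uletter) : letter Q L :=
  Letter (uel (val x)) (udeg x) (val x).1.2.+1 (absx (val x).1.1 - (val x).1.2)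
    (uwt (val x)) (yeig (val x).1.1 (val x).2).

Definition ixn (j : nat) : idx := insubd idxN1 (j%:Z).

(** The bound j < N says that the height j + 1 is at most N. *)
Definition uletters N : seq uletter :=
  undup (pmap insub (flatten [seq flatten [seq [seq (ixn j, l, k)
    | k <- iota 0 (mm (ixn j))] | l <- iota 0 j] | j <- iota 1 N & (j < N)%N])).

Lemma ixn_absx j : 1 <= val j -> ixn (absx j) = j.
Proof.
move=> h; apply: val_inj; rewrite /ixn val_insubd absxE // h orbT.
by [].
Qed.

Lemma mem_uletters N x : (x \in uletters N) = (absx (val x).1.1 < N)%N.
Proof.
have /and3P[h1 h2 h3] := valP x.
rewrite mem_undup mem_pmap; apply/mapP/idP => [[p]|hN].
  move=> /flatten_mapP[j]; rewrite mem_filter mem_iota => /andP[jN /andP[j1 _]].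
  move=> /flatten_mapP[l _ /mapP[k _ ep]] /(congr1 (omap val)) /=.
  case: insubP => //= y _ ey [] exy; rewrite exy ey ep /=.
  suff -> : absx (ixn j) = j by [].
  by rewrite /absx /ixn val_insubd lez_nat j1 orbT.
exists (val x); last by rewrite valK.
apply/flatten_mapP; exists (absx (val x).1.1).
  rewrite mem_filter hN mem_iota add1n ltnS (ltnW hN) andbT.
  by rewrite -lez_nat absxE.
apply/flatten_mapP; exists (val x).1.2; first by rewrite mem_iota.
rewrite ixn_absx //; apply/mapP; exists (val x).2; first by rewrite mem_iota.
by case: (val x) => [[]].
Qed.

Definition ht2 : Q -> int := lsum (fun j : idx => val j).
Definition htq (q : Q) : int := - (ht1 q + ht2 q).

Lemma ht1D a b : ht1 (a + b) = ht1 a + ht1 b. Proof. exact: lsumD. Qed.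
Lemma ht2D a b : ht2 (a + b) = ht2 a + ht2 b. Proof. exact: lsumD. Qed.

Lemma htqD a b : htq (a + b) = htq a + htq b.
Proof. by rewrite /htq ht1D ht2D addrACA opprD. Qed.

Lemma ht1_pdeg p : ht1 (pdeg p) = - (p.1.2.+1)%:Z.
Proof.
rewrite /ht1 /pdeg lsumN lsumD lsum_sroot; congr (- _).
elim: p.1.2 => [|l IH]; first by rewrite mulr0n lsum0.
by rewrite mulrS lsumD lsum_sroot addrCA IH -[l.+2]add1n PoszD.
Qed.

Lemma ht2_pdeg p : ht2 (pdeg p) = - (val p.1.1 - p.1.2%:Z).
Proof.
rewrite /ht2 /pdeg lsumN lsumD lsum_sroot; congr (- (_ + _)).
elim: p.1.2 => [|l IH]; first by rewrite mulr0n lsum0.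
by rewrite mulrS lsumD lsum_sroot IH -[l.+1]add1n PoszD opprD.
Qed.

Lemma hom_f0 : hom (- al0) f0. Proof. exact: (hom_sgen hom_pm). Qed.

Lemma hom_ybase j k : hom (- al j) (ybase j k).
Proof.
rewrite /ybase; case: insub => [k1|]; last exact: (cl_hom0 CL).
elim: (index_enum _) => [|k2 s IH]; first by rewrite big_nil; apply: (cl_hom0 CL).
by rewrite big_cons; apply: (cl_hom_lin CL) => //; apply: (hom_sgen hom_pm).
Qed.

Lemma hom_uel p : hom (pdeg p) (uel p).
Proof.
case: p => [[j l] k]; rewrite /uel /=; elim: l => [|l IH].
  by rewrite /pdeg /= mulr0n addr0; apply: hom_ybase.
by rewrite -pdegS iterS; apply: (cl_hom_br CL) => //; apply: hom_f0.
Qed.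

Lemma iter_br0 l : iter l (br f0) 0 = 0.
Proof. by elim: l => //= l ->; rewrite (br0r CL). Qed.

Lemma iter_br_lin l c y z :
  iter l (br f0) (c *: y + z) = c *: iter l (br f0) y + iter l (br f0) z.
Proof. by elim: l => //= l ->; rewrite (cl_brPr CL). Qed.

Lemma uel_invalid j l k : j != idxN1 -> ~~ valid (j, l, k) -> uel (j, l, k) = 0.
Proof.
move=> jn; rewrite /valid /= (idx_cases jn) /= negb_and -!leqNgt => /orP[hl|hk].
  rewrite /uel /= -(subnK hl) iterD.
  have -> : iter (absx j) (br f0) (ybase j k) = 0; last exact: iter_br0.
  rewrite /ybase; case: insub => [k1|]; last exact: iter_br0.
  elim: (index_enum _) => [|k2 s IH]; first by rewrite big_nil iter_br0.
  by rewrite big_cons iter_br_lin IH serre_f // scaler0 addr0.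
by rewrite /uel /= /ybase insubN ?iter_br0 // -leqNgt.
Qed.

(** * The negative part as the line of f_{-1} plus the subalgebra of the letters *)

Section Height.
Variable N : nat.
Local Notation A0 := [seq base_letter x | x <- uletters N].
Local Notation fil := (fil br hom N htq).
Local Notation wf := (wf hom htq).

Lemma ht_base x : ht (base_letter x) = (absx (val x).1.1).+1.
Proof.
have /and3P[_ h2 _] := valP x.
by rewrite /ht /= addSn subnKC // ltnW.
Qed.

Lemma htq_base x : htq (udeg x) = (ht (base_letter x))%:Z.
Proof.
have /and3P[h1 h2 _] := valP x.
rewrite ht_base /htq ht1_pdeg ht2_pdeg -absxE //.
by move: (absx _) h2 => a; move: (val x).1.2 => l; lia.
Qed.

Lemma wf_base x : wf (base_letter x).
Proof. by split; [apply: hom_uel|apply: htq_base|rewrite ht_base]. Qed.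

Lemma wfA0 a : a \in A0 -> wf a.
Proof. by move=> /mapP[x _ ->]; apply: wf_base. Qed.

Lemma fil_uel j l k w : j != idxN1 -> (w <= mm j - k)%N ->
  fil A0 (pdeg (j, l, k)) w (uel (j, l, k)).
Proof.
move=> jn hw; have [hv|hv] := boolP (valid (j, l, k)); last first.
  by rewrite uel_invalid //; apply: fil_0.
have [x ex] : exists x : uletter, val x = (j, l, k).
  by exists (Sub _ hv); rewrite SubK.
rewrite -ex -/(udeg x); have [hN|hN] := ltnP (absx j) N.
  apply: (@fil_let _ _ _ _ _ _ _ _ (base_letter x)); last by rewrite /= /uwt ex.
  by apply: map_f; rewrite mem_uletters ex.
apply: fil_big; first exact: hom_uel.
by rewrite htq_base ht_base ex ltz_nat.
Qed.

Lemma fil_f0_base x w : (w <= wt (base_letter x))%N ->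
  fil A0 (- al0 + qd (base_letter x)) w (br f0 (el (base_letter x))).
Proof.
rewrite -[qd _]/(pdeg (val x)) -[el _]/(uel (val x)) -[wt _]/(uwt (val x)).
have /and3P[h1 _ _] := valP x; move: h1; rewrite /uwt.
case: (val x) => [[j l] k] h1 hw.
rewrite pdegS -[br _ _]/(uel (j, l.+1, k)); apply: fil_uel => //.
by apply/eqP => ej; move: h1; rewrite ej.
Qed.

(** On letters ad f_{-1} raises l, or gives 0 by the Serre relation, without changing the weight.
    Since f_{-1} has height 0, the truncated part is preserved as well. *)
Lemma fil_f0 q w z : fil A0 q w z -> fil A0 (- al0 + q) w (br f0 z).
Proof.
have h0 : htq (- al0) = 0.
  by rewrite /htq /ht1 /ht2 !lsumN !lsum_sroot.
elim=> {q w z}.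
- by move=> a w /mapP[x _ ->]; apply: fil_f0_base.
- move=> a q w w1 z aA hz IH hw; have [ha _ _] := wfA0 aA.
  rewrite (cl_jacobi CL _ hom_f0 ha) [X in fil _ _ _ X]addrC.
  apply: fil_lin; first by rewrite addrCA; apply: (fil_ad aA IH).
  rewrite addrA; apply: (fil_br CL htqD wfA0 _ hz hw).
  by move: aA => /mapP[x _ ->]; apply: fil_f0_base.
- by move=> c q w y z _ h1 _ h2; rewrite (cl_brPr CL); apply: fil_lin.
- by move=> q w; rewrite (br0r CL); apply: fil_0.
- move=> q w z hz hq; apply: fil_big; first by apply: (cl_hom_br CL) => //; apply: hom_f0.
  by rewrite htqD h0 add0r.
Qed.

Lemma ybaseE j (k1 : 'I_(mm j)) : ybase j k1 = \sum_k2 P j k1 k2 *: sgen false k2.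
Proof. by rewrite /ybase valK. Qed.

Lemma sgen_ybase j (k : 'I_(mm j)) :
  sgen false k = \sum_k1 Pi j k k1 *: ybase j k1.
Proof.
by under eq_bigr do rewrite ybaseE; rewrite (sum_mulmx1 _ k (PPi j)).
Qed.

Lemma fil_sum (I : Type) (r : seq I) (c : I -> K) (g : I -> L) q w :
  (forall i, fil A0 q w (g i)) -> fil A0 q w (\sum_(i <- r) c i *: g i).
Proof.
move=> h; elim: r => [|i r IH]; first by rewrite big_nil; apply: fil_0.
by rewrite big_cons; apply: fil_lin.
Qed.

Lemma fil_sgen j (k : 'I_(mm j)) : j != idxN1 -> fil A0 (- al j) 0 (sgen false k).
Proof.
move=> jn; rewrite sgen_ybase; apply: fil_sum => k1.
have -> : - al j = pdeg (j, 0%N, k1 : nat) by rewrite /pdeg /= mulr0n addr0.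
exact: (@fil_uel j 0 k1).
Qed.

Lemma sgen_f0 (k : 'I_(mm idxN1)) : sgen false k = f0.
Proof. by rewrite (k0_uniq k). Qed.

Inductive nilfil : Q -> L -> Prop :=
| nilfil_f : nilfil (- al0) f0
| nilfil_fil q z : fil A0 q 0 z -> nilfil q z
| nilfil_lin c q y z : nilfil q y -> nilfil q z -> nilfil q (c *: y + z).

(** The sum is stable under every f_{ik}: [f_{-1}, f_{-1}] = 0 because f_{-1} is even, and
    [f_{ik}, f_{-1}] is a multiple of an element obtained by applying ad f_{-1} to f_{ik}. *)
Lemma nil_nilfil q z : nil q z -> nilfil q z.
Proof.
elim=> {q z}.
- move=> i k; have [ei|ni] := eqVneq i idxN1.
    by subst i; rewrite sgen_f0; apply: nilfil_f.
  exact/nilfil_fil/fil_sgen.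
- move=> i k q z _; elim=> {q z}.
  + have [ei|ni] := eqVneq i idxN1.
      subst i; rewrite sgen_f0 (br_even CL hom_f0); first exact/nilfil_fil/fil_0.
      rewrite (th_opp CL) th_al0.
      by rewrite -subr_eq0 opprK -[1 + 1]/(2%:R) pnatr_eq0.
    rewrite (cl_skew CL (hom_sgen hom_pm false k) hom_f0) -scaleNr addrC.
    apply/nilfil_fil/filZ; rewrite [sal _ _]/=.
    by have := fil_f0 (fil_sgen k ni).
  + move=> q z hz; apply: nilfil_fil; have [ei|ni] := eqVneq i idxN1.
      by subst i; rewrite sgen_f0; apply: fil_f0.
    exact: (fil_br CL htqD wfA0 (fil_sgen k ni) hz).
  + by move=> c q y z _ h1 _ h2; rewrite (cl_brPr CL); apply: nilfil_lin.
- by move=> q; apply/nilfil_fil/fil_0.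
- by move=> c q y z _ h1 _ h2; apply: nilfil_lin.
Qed.

(** The degree of f_{-1} has second coordinate 1, so f_{-1} cannot occur. *)
Lemma nilfil_neg q z : nilfil q z -> ht2 q < 0 -> fil A0 q 0 z.
Proof.
elim=> {q z} //.
- by rewrite /ht2 lsumN lsum_sroot.
- by move=> c q y z _ h1 _ h2 hq; apply: fil_lin; [apply: h1|apply: h2].
Qed.

End Height.

(** * Freeness on the letters *)

Section Freeness.
Local Notation T := {malg K[seq uletter]}.
Local Notation cons3 := (@cons3 K mm).
Local Notation opF := (@opF K Q th mm al).
Local Notation v0 := (<< 1 *g [::] >> : T).
Variable act : L -> T -> T.
Hypothesis actPl : forall c x y t, act (c *: x + y) t = c *: act x t + act y t.
Hypothesis actPr : forall c x s t, act x (c *: s + t) = c *: act x s + act x t.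
Hypothesis act_br : forall a b x y t, hom a x -> hom b y ->
  act (br x y) t = act x (act y t) - th a b *: act y (act x t).
Hypothesis act_f0 : forall t, act f0 t = opF t.
Hypothesis act_f : forall j (k : 'I_(mm j)) t, j != idxN1 ->
  act (sgen false k) t = cons3 (j, 0%N, k : nat) t.

Lemma act_sum (I : Type) (r : seq I) (c : I -> K) (x : I -> L) t :
  act (\sum_(i <- r) c i *: x i) t = \sum_(i <- r) c i *: act (x i) t.
Proof.
elim: r => [|i r IH]; last by rewrite !big_cons actPl IH.
by rewrite !big_nil (act0l actPl).
Qed.

Lemma act_sumr (I : Type) (r : seq I) (c : I -> K) (g : I -> T) :
  opF (\sum_(i <- r) c i *: g i) = \sum_(i <- r) c i *: opF (g i).
Proof.
have lF : lin opF := @opF_lin _ _ _ _ _.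
elim: r => [|i r IH]; last by rewrite !big_cons lF IH.
by rewrite !big_nil (lin0 lF).
Qed.

(** The commutator with the action of f_{-1} raises l in left multiplications by letters, so the
    combination given by the row of P is the same for all l. *)
Lemma act_uel j l (k1 : 'I_(mm j)) t : j != idxN1 ->
  act (uel (j, l, k1 : nat)) t = \sum_k2 P j k1 k2 *: cons3 (j, l, k2 : nat) t.
Proof.
move=> jn; elim: l t => [|l IH] t.
  rewrite -[uel _]/(ybase j k1) ybaseE act_sum.
  by apply: eq_bigr => k2 _; rewrite act_f.
rewrite -[uel _]/(br f0 (uel (j, l, k1 : nat))).
have hu := hom_uel (j, l, k1 : nat).
rewrite (act_br _ hom_f0 hu) !IH !act_f0 act_sumr.
rewrite scaler_sumr -sumrB; apply: eq_bigr => k2 _.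
by rewrite -(F_cons3 th al) /cm !scalerBr !scalerA mulrC.
Qed.

Section Words.
Variable N : nat.
Local Notation A0 := [seq base_letter x | x <- uletters N].
Local Notation prods := (prods act v0 A0).
Local Notation xm := (fun x : uletter => (val x).1.2.+1).
Local Notation xn := (fun x : uletter => (absx (val x).1.1 - (val x).1.2)%N).

Lemma prods_sum (I : Type) (r : seq I) (c : I -> K) (g : I -> T) m n :
  (forall i, prods m n (g i)) -> prods m n (\sum_(i <- r) c i *: g i).
Proof.
move=> h; elim: r => [|i r IH]; first by rewrite big_nil; apply: prods_0.
by rewrite big_cons; apply: prods_lin.
Qed.

(** Inverting P expresses left multiplication by one letter through the triangular basis letters
    with the same j and l, which have the same bidegree. *)
Lemma prods_cons x m n t : x \in uletters N -> prods m n t ->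
  prods (xm x + m)%N (xn x + n)%N (consx x t).
Proof.
rewrite mem_uletters -cons3_val => hx ht.
have /and3P[h1 h2 h3] := valP x.
move: hx h1 h2 h3; case: (val x) => [[j l] k] /= hx h1 h2 h3.
have jn : j != idxN1 by apply/eqP => ej; move: h1; rewrite ej.
have -> : cons3 (j, l, k) t =
    \sum_k1 Pi j (Ordinal h3) k1 *: act (uel (j, l, k1 : nat)) t.
  by under eq_bigr do rewrite act_uel //; rewrite (sum_mulmx1 _ (Ordinal h3) (PPi j)).
apply: prods_sum => k1.
have hv : valid (j, l, k1 : nat) by rewrite /valid /= h1 h2 ltn_ord.
have [y ey] : exists y : uletter, val y = (j, l, k1 : nat).
  by exists (Sub _ hv); rewrite SubK.
have yA : base_letter y \in A0 by apply: map_f; rewrite mem_uletters ey.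
by have := prods_act yA ht; rewrite /= ey.
Qed.

Lemma prods_word w : all (mem (uletters N)) w ->
  prods (wsum xm w) (wsum xn w) << 1 *g w >>.
Proof.
elim: w => [_|x w IH /= /andP[xU /IH hw]].
  by rewrite /wsum !big_nil; apply: prods_1.
rewrite /wsum !big_cons; have := prods_cons xU hw.
by rewrite consxW.
Qed.

Lemma elimination_base : exists E, elimination br N A0 E.
Proof.
apply: elimination_ex; apply/allP => a /mapP[x + ->]; rewrite mem_uletters => hx.
by rewrite ht_base.
Qed.

(* The ordered monomials span the words of their degree and are as many. *)
Lemma indep_plus E m n : elimination br N A0 E -> (m + n <= N)%N -> (0 < m + n)%N ->
  indep [seq act (el e) v0 | e <- plus br th E & (dm e == m) && (dn e == n)].
Proof.
move=> hE hN h0.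
have wf0 a : a \in A0 -> wf hom htq a by apply: wfA0.
have wfE e : e \in E -> wf hom htq e.
  exact: (elimination_all (wf_lcom CL htqD) hE wf0).
apply: (indep_subseq (subseq_mon v0 actPl act_br hN h0 wfE)).
apply: (indep_span (indep_monomials (base_words_uniq xm xn N m n (undup_uniq _)))).
  rewrite size_map.
  (* Both sizes are coefficients of 1 / (1 - v), where v counts the letters by bidegree, each with
     coefficient 1. *)
  apply/eqP; rewrite -(eqr_nat K); apply/eqP.
  rewrite size_base_words size_mon //.
  have nuM (x y : letter Q L) : (1 : K) = 1 * 1 by rewrite mulr1.
  have [|h _] := @gf_elimination K Q L br N (fun=> 1) nuM _ _ hE.
    by move=> a /wf0[].
  rewrite -(eqtr_cf h hN) /gf big_map; congr (cf _ _ _).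
move=> z /mapP[w /base_wordsP[h1 h2 h3] ->].
by apply: (prods_mon CL htqD actPr act_br hE) => //; rewrite -h2 -h3; apply: prods_word.
Qed.

End Words.

(** * The trace of an automorphism on the even and odd parts of a root space *)

Section Automorphism.
Variable M : forall j, 'M[K]_(mm j).
Hypothesis PM : forall j, P j *m M j = D j *m P j.
Hypothesis Dtri : forall j (i k : 'I_(mm j)), (i < k)%N -> D j i k = 0.
Variables (phi1 phid : {linear L -> L}) (d : nat).
Hypothesis phidE : forall x, phid x = iter d phi1 x.
Variable neg : L -> Prop.
Hypothesis neg_br : forall x y, neg x -> neg y -> neg (br x y).
Hypothesis neg_hom : forall q x, hom q x -> ht1 q < 0 -> neg x.
Hypothesis phi_br : forall x y, neg x -> neg y ->
  phid (br x y) = br (phid x) (phid y).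
Hypothesis phi_f0 : phid f0 = f0.
Hypothesis phi_sgen : forall j (k : 'I_(mm j)),
  phi1 (sgen false k) = \sum_k2 M j k k2 *: sgen false k2.

Lemma phi_ybase j (k : 'I_(mm j)) :
  phi1 (ybase j k) = \sum_k2 D j k k2 *: ybase j k2.
Proof.
rewrite ybaseE linear_sum; under eq_bigr do rewrite linearZ /= phi_sgen.
under [RHS]eq_bigr do rewrite ybaseE.
by rewrite 2!sum_mulmx PM.
Qed.

Local Notation below j k := (fun y => exists2 k2, (k2 < k)%N & y = ybase j k2).

Lemma phi_below j (k : 'I_(mm j)) z : lspan (below j k) z ->
  lspan (below j k) (phi1 z).
Proof.
elim=> [y [k2 h ->]||c y1 y2 _ h1 _ h2]; last first.
- by rewrite linearP; apply: lspan_lin.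
- by rewrite linear0; apply: lspan_0.
have h2 : (k2 < mm j)%N := ltn_trans h (ltn_ord k).
rewrite -[k2]/(nat_of_ord (Ordinal h2)) phi_ybase.
elim/big_ind: _ => [|y1 y2|k3 _]; [exact: lspan_0|exact: lspanD|].
have [h3|h3] := ltnP k2 k3; first by rewrite Dtri // scale0r; apply: lspan_0.
by apply/lspanZ/lspan_in; exists k3 => //; apply: leq_ltn_trans h.
Qed.

(** The span of the vectors of smaller index is stable, so powers remain triangular and their
    diagonal consists of powers: one basis serves all exponents d. *)
Lemma phid_ybase j (k : 'I_(mm j)) :
  lspan (below j k) (phid (ybase j k) - yeig j k ^+ d *: ybase j k).
Proof.
rewrite phidE; elim: d => [|n IH]; first by rewrite scale1r subrr; apply: lspan_0.
rewrite iterS; set u := _ - _ in IH.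
have -> : iter n phi1 (ybase j k) = yeig j k ^+ n *: ybase j k + u by rewrite addrC subrK.
rewrite linearP /= phi_ybase (bigD1 k) //= scalerDr scalerA.
have -> : D j k k = yeig j k by rewrite /yeig valK.
rewrite exprSr addrAC [X in X - _]addrC addrK; apply: lspanD; last exact: phi_below.
apply/lspanZ; elim/big_ind: _ => [|y1 y2|k3 k3k]; [exact: lspan_0|exact: lspanD|].
have [h3|h3] := ltnP k k3; first by rewrite Dtri // scale0r; apply: lspan_0.
by apply/lspanZ/lspan_in; exists k3 => //; rewrite ltn_neqAle k3k.
Qed.

Lemma neg_f0 : neg f0.
Proof. by apply: (neg_hom hom_f0); rewrite /ht1 lsumN lsum_sroot. Qed.

Lemma neg_uel p : neg (uel p).
Proof. by apply: (neg_hom (hom_uel p)); rewrite ht1_pdeg. Qed.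

Lemma phid_uel j l k :
  phid (uel (j, l, k)) = iter l (br f0) (phid (ybase j k)).
Proof.
elim: l => [//|l IH].
rewrite -[uel _]/(br f0 (uel (j, l, k))) phi_br ?phi_f0 ?IH //; first exact: neg_f0.
exact: neg_uel.
Qed.

Section Base.
Variable N : nat.
Local Notation A0 := [seq base_letter x | x <- uletters N].

Lemma triangular_base a : a \in A0 -> triangular br hom N htq A0 phid d neg a.
Proof.
move=> /mapP[x _ ->]; have /and3P[h1 h2 h3] := valP x.
split; first exact: neg_uel.
  rewrite -[qd _]/(pdeg (val x)) -[el _]/(uel (val x)) -[wt _]/(uwt (val x)).
  move: h1; case: (val x) => [[j l] k] h1. apply: fil_uel => //.
  by apply/eqP => ej; move: h1; rewrite ej.
rewrite -[qd _]/(pdeg (val x)) -[el _]/(uel (val x)) -[wt _]/(uwt (val x)).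
rewrite -[lam _]/(yeig (val x).1.1 (val x).2).
move: h1 h2 h3; case: (val x) => [[j l] k] h1 h2 h3.
have jn : j != idxN1 by apply/eqP => ej; move: h1; rewrite ej.
rewrite phid_uel -[uel _]/(iter l (br f0) (ybase j k)).
pose k1 := Ordinal h3; have := phid_ybase k1; rewrite -[nat_of_ord k1]/k.
set u := _ - _ => hu.
have -> : phid (ybase j k) = yeig j k ^+ d *: ybase j k + u by rewrite addrC subrK.
rewrite (iter_br_lin) addrAC subrr add0r.
elim: hu => [y [k2 h ->]||c y1 y2 _ e1 _ e2].
- rewrite -[iter _ _ _]/(uel (j, l, k2)) -[pdeg _]/(pdeg (j, l, k2)).
  by apply: fil_uel => //; move: (h) (h3); rewrite /uwt /=; lia.
- by rewrite iter_br0; apply: fil_0.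
- by rewrite (iter_br_lin); apply: fil_lin.
Qed.

Variable par : bool -> L -> Prop.
Hypothesis par_hom : forall (s : bool) q z, hom q z -> th q q = (-1) ^+ s -> par s z.
Hypothesis par0 : forall s, par s 0.
Hypothesis par_lin : forall s c x y, par s x -> par s y -> par s (c *: x + y).
Hypothesis par_act : forall x t, par false x -> par true x -> act x t = 0.
Variables (E : seq (letter Q L)) (m n : nat) (Wr : L -> Prop).
Hypothesis hE : elimination br N A0 E.
Hypothesis m0 : (0 < m)%N.
Hypothesis n0 : (0 < n)%N.
Hypothesis hN : (m + n <= N)%N.
Local Notation inW q := (ht1 q = - m%:Z /\ ht2 q = - n%:Z).
Hypothesis Wr_span : forall x, Wr x ->
  lspan (fun z => exists2 q, inW q & nil q z) x.
Hypothesis Wr_hom : forall q z, hom q z -> inW q -> Wr z.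
Local Notation plusE := (plus br th E).

Lemma plus_deg e : e \in plusE ->
  ht1 (qd e) = - (dm e)%:Z /\ ht2 (qd e) = - (dn e)%:Z.
Proof.
pose good (a : letter Q L) := ht1 (qd a) = - (dm a)%:Z /\ ht2 (qd a) = - (dn a)%:Z.
have goodM a b : good a -> good b -> good (lcom br a b).
  move=> [a1 a2] [b1 b2].
  by split; rewrite /= ?ht1D ?ht2D ?a1 ?a2 ?b1 ?b2 -opprD PoszD.
have gE a : a \in E -> good a.
  apply: (elimination_all goodM hE) => b /mapP[x _ ->].
  have /and3P[h1 h2 _] := valP x; split.
    exact: ht1_pdeg.
  rewrite [LHS]ht2_pdeg -absxE // -[dn _]/(absx (val x).1.1 - (val x).1.2)%N.
  by rewrite subzn // ltnW.
by move=> /mem_plus[b /gE hb [->|[_ ->]]]; [|apply: (goodM b b)].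
Qed.

Lemma wfE e : e \in E -> wf hom htq e.
Proof.
apply: (elimination_all (wf_lcom CL htqD) hE) => a.
exact: wfA0.
Qed.

Lemma hom_plus e : e \in plusE -> hom (qd e) (el e).
Proof. by apply: (plus_wf CL htqD hE) => a; apply: wfA0. Qed.

Local Notation B s := [seq e <- plusE | (dm e == m) && (dn e == n)
  && (th (qd e) (qd e) == (-1) ^+ (s : bool))].

Lemma mem_Bs q e : e \in plusE -> qd e = q -> inW q ->
  exists s : bool, th q q = (-1) ^+ s /\ e \in B s.
Proof.
move=> eE <- [q1 q2]; have [d1 d2] := plus_deg eE.
have em : dm e = m by apply/eqP; rewrite -eqz_nat -eqr_opp -d1 q1.
have en : dn e = n by apply/eqP; rewrite -eqz_nat -eqr_opp -d2 q2.
have [h|h] := th_self CL (qd e); [exists false|exists true];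
  by split; rewrite // mem_filter eE em en !eqxx h /= ?eqxx.
Qed.

Lemma par_B s z : lspan (fun y => exists2 e, e \in B s & y = el e) z -> par s z.
Proof.
elim=> [y [e + ->]||c y1 y2 _ h1 _ h2].
- by rewrite mem_filter => /andP[/andP[_ /eqP h] /hom_plus he]; apply: (par_hom he).
- exact: par0.
- exact: par_lin.
Qed.

Lemma lspan_B z : Wr z -> exists x y, z = x + y /\
  lspan (fun y => exists2 e, e \in B false & y = el e) x /\
  lspan (fun y => exists2 e, e \in B true & y = el e) y.
Proof.
move=> /Wr_span hz.
have {hz} : lspan (fun y => exists2 e, (e \in B false \/ e \in B true) & y = el e) z.
  apply: lspan_bind hz => y [q hq /(nil_nilfil N)].
  have [q1 q2] := hq; move=> hy.
  have hq2 : ht2 q < 0 by rewrite q2; move: n0; lia.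
  have := fil_span CL htqD hE (@wfA0 N)
    (nilfil_neg hy hq2).
  have hqN : htq q <= N%:Z by rewrite /htq q1 q2; move: hN; lia.
  move=> /(_ hqN); apply: lspan_sub => y' [e eE [eq _ ->]].
  by have [[] [_ h]] := mem_Bs eE eq hq; exists e => //; [right|left].
elim=> [y [e [h|h] ->]||c y1 y2 _ [x1 [z1 [-> [h1 k1]]]] _ [x2 [z2 [-> [h2 k2]]]]].
- exists (el e), 0; rewrite addr0; split=> //; split; last exact: lspan_0.
  by apply: lspan_in; exists e.
- exists 0, (el e); rewrite add0r; split=> //; split; first exact: lspan_0.
  by apply: lspan_in; exists e.
- by exists 0, 0; rewrite addr0; split=> //; split; apply: lspan_0.
- exists (c *: x1 + x2), (c *: z1 + z2); rewrite scalerDr addrACA; split=> //.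
  by split; apply: lspan_lin.
Qed.

Lemma indep_B s : indep [seq act (el e) v0 | e <- B s].
Proof.
have i1 := @indep_plus _ _ _ _ hE hN.
apply: indep_subseq (i1 _); last by rewrite addn_gt0 m0.
apply: map_subseq.
have -> : B s = [seq e <- [seq e <- plusE | (dm e == m) && (dn e == n)] |
   th (qd e) (qd e) == (-1) ^+ s].
  by rewrite -filter_predI; apply: eq_filter => e /=; rewrite andbC.
exact: filter_subseq.
Qed.

(** The values of the basis elements at the empty word are independent, so the value at the empty
    word determines z. *)
Lemma act_inj s z : lspan (fun y => exists2 e, e \in B s & y = el e) z ->
  act z v0 = 0 -> z = 0.
Proof.
move=> hz; set bs := [seq act (el e) v0 | e <- B s].
have [||c ->] := @lspan_seq _ _ [seq el e | e <- B s] (size bs) z.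
- by rewrite !size_map.
- by apply: lspan_sub hz => y [e eB ->]; apply: map_f.
rewrite (act_sum) => h; rewrite big1 // => i _.
suff -> : c i = 0 by rewrite scale0r.
move: i; apply: (indep_B (s := s)); rewrite -[RHS]h; apply: eq_bigr => i _.
have iB : (i < size (B s))%N by rewrite -(size_map (fun e => act (el e) v0)).
pose e0 : letter Q L := Letter 0 0 0 0 0 0.
by rewrite (nth_map e0) // (nth_map e0).
Qed.

(** Split z into an even and an odd combination. The component of the wrong parity is the difference
    of two elements of parity s, hence both even and odd; it acts by zero, and [act_inj] makes it
    vanish. *)
Lemma lspan_Bs s z : Wr z -> par s z ->
  lspan (fun y => exists2 e, e \in B s & y = el e) z.
Proof.
move=> /lspan_B [x [y [-> [hx hy]]]] hp.
have parD s' a b : par s' a -> par s' b -> par s' (a - b).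
  by move=> h1 h2; rewrite -scaleN1r addrC; apply: par_lin.
have px := par_B hx; have py := par_B hy.
case: s hp => hp.
- suff -> : x = 0 by rewrite add0r.
  apply: (act_inj hx); apply: par_act => //.
  by rewrite -[x](addrK y); apply: parD.
- suff -> : y = 0 by rewrite addr0.
  apply: (act_inj hy); apply: par_act => //.
  by rewrite -[y](addKr x) addrC; apply: parD.
Qed.

Lemma is_trace_root s :
  is_trace (fun x => Wr x /\ par s x) phid (\sum_(e <- B s) lam e ^+ d).
Proof.
have inB e : e \in B s -> [/\ e \in plusE, inW (qd e) & th (qd e) (qd e) = (-1) ^+ s].
  rewrite mem_filter => /andP[/andP[/andP[/eqP em /eqP en] /eqP h] eE].
  by split=> //; rewrite -em -en; apply: plus_deg.
apply: (is_trace_triangular (Letter 0 0 0 0 0 0) (b := @el _ _ _) (w := @wt _ _ _)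
  (lm := fun e => lam e ^+ d)).
- move=> e /inB[eE eW es]; split; first exact: (Wr_hom (hom_plus eE)).
  exact: (par_hom (hom_plus eE)).
- by move=> x [Wx px]; apply: lspan_Bs.
- have i1 := indep_B (s := s); apply: (indep_image (f := fun x => act x v0)) => //.
- move=> e eB; have [eE [q1 q2] es] := inB e eB.
  have h := triangular_plus CL htqD (@wfA0 N)
    neg_br phi_br hE triangular_base eE.
  have hqN : htq (qd e) <= N%:Z by rewrite /htq q1 q2; move: hN; lia.
  apply: lspan_sub (fil_span CL htqD hE
    (@wfA0 N) h hqN) => y [e' eE' [eq ew ->]].
  exists e' => //; have [d1 d2] := plus_deg eE'.
  move: eB; rewrite !mem_filter eq eE' => /andP[/andP[_ ->] _]; rewrite andbT.
  move: d1 d2; rewrite eq q1 q2 => /oppr_inj[->] /oppr_inj[->].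
  by rewrite !eqxx.
Qed.

End Base.

End Automorphism.
End Freeness.

(** * The formula for the supertraces read off from the basis *)

Section Formula.
Variables (N : nat) (E : seq (letter Q L)).
Local Notation A0 := [seq base_letter x | x <- uletters N].
Hypothesis hE : elimination br N A0 E.
Local Notation strace := (strace br th E).

(** The sign and the d-th powers of the eigenvalues on V_a: the coefficient of v_d, seen by
    [strace1] to be the supertrace of g^d on V_a. *)
Definition bsum d a : K := \sum_(k < mm (ixn a))
  th (al (ixn a)) (al (ixn a)) * yeig (ixn a) k ^+ d.

Lemma th_pdeg p : th (pdeg p) (pdeg p) = th (al p.1.1) (al p.1.1).
Proof.
case: p => [[j l] k]; elim: l => [|l IH].
  by rewrite /pdeg /= mulr0n addr0 (th_opp CL).
have -> : pdeg (j, l.+1, k) = - al0 + pdeg (j, l, k) by rewrite pdegS.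
rewrite (th_double CL (- al0) (pdeg (j, l, k))) (th_opp CL al0).
have mul1 (c x y : K) : c = 1 -> x = y -> c * x = y by move=> -> ->; rewrite mul1r.
exact: mul1 th_al0 IH.
Qed.

Lemma ht_A0 a : a \in A0 -> (0 < ht a)%N.
Proof. by move=> /mapP[x _ ->]; rewrite ht_base. Qed.

(** The bidegree (l + 1, j' - l) of a letter over f_{j'k} equals (i, j) exactly when j' = i + j - 1
    and l = i - 1. As f_{-1} is even, the sign of the letter is that of f_{j'k}. *)
Lemma cf_gf_base d i j : (i + j <= N)%N ->
  cf i j (gf (nu th d) A0) =
  if (0 < i)%N && (0 < j)%N then bsum d (i + j).-1 else 0.
Proof.
move=> hN; rewrite /gf big_map cf_sum.
pose G (p : idx * nat * nat) := th (al p.1.1) (al p.1.1) * yeig p.1.1 p.2 ^+ d.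
pose c (x : uletter) := (i == (val x).1.2.+1) &&
  (j == (absx (val x).1.1 - (val x).1.2)%N).
transitivity (\sum_(p <- [seq val x | x <- uletters N & c x]) G p).
  rewrite big_map big_filter [RHS]big_mkcond; apply: eq_bigr => x _.
  rewrite cf_mono -[dm _]/((val x).1.2.+1) -[dn _]/(absx (val x).1.1 - (val x).1.2)%N.
  rewrite -/(c x) /nu -[qd _]/(pdeg (val x)) th_pdeg.
  by case: (c x).
case: ifP => [/andP[i0 j0]|h]; last first.
  rewrite big_seq big1 // => p /mapP[x]; rewrite mem_filter /c => /andP[].
  have /and3P[_ h2 _] := valP x.
  move: h; case: (i) => // i'; case: (j) => // /= _ /andP[_].
  by rewrite eq_sym subn_eq0 leqNgt h2.
set J := ixn (i + j).-1.
have vJ : val J = (i + j).-1%:Z.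
  by rewrite /J /ixn val_insubd; case: ifP => // /negP []; rewrite orbC lez_nat; lia.
have aJ : absx J = (i + j).-1 by rewrite /absx vJ.
rewrite (perm_big [seq (J, i.-1, k) | k <- iota 0 (mm J)]) /=.
  rewrite big_map (_ : iota 0 _ = index_iota 0 (mm J)) ?big_mkord; last first.
    by rewrite /index_iota subn0.
  exact: eq_bigr.
apply: uniq_perm.
- by rewrite map_inj_uniq ?filter_uniq ?undup_uniq //; apply: val_inj.
- by rewrite map_inj_uniq ?iota_uniq // => a b [].
move=> p; apply/mapP/mapP => [[x]|[k]].
  rewrite mem_filter mem_uletters /c => /andP[/andP[/eqP e1 /eqP e2] h1] ->.
  have /and3P[v1 v2 v3] := valP x.
  have eJ : (val x).1.1 = J.
    by rewrite /J e1 e2 addSn /= subnKC ?(ltnW v2) // ixn_absx.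
  exists (val x).2.
    by rewrite mem_iota add0n -eJ.
  by rewrite -eJ e1 /=; case: (val x) => [[]].
rewrite mem_iota /= add0n => kJ ->.
have hv : valid (J, i.-1, k).
  by rewrite /valid /= vJ aJ kJ andbT lez_nat; apply/andP; split; lia.
have [x ex] : exists x : uletter, val x = (J, i.-1, k).
  by exists (Sub _ hv); rewrite SubK.
exists x; last by rewrite ex.
rewrite mem_filter mem_uletters /c ex /= aJ; apply/andP; split; last by lia.
by rewrite prednK // eqxx /=; apply/eqP; lia.
Qed.

Definition bpair d (p : nat * nat) := bsum d (p.1 + p.2).-1.

Lemma gf_base d : eqtr N (gf (nu th d) A0) (pair_series (bpair d) N).
Proof.
move=> m n; rewrite ltnS => hN.
by rewrite cfB cf_gf_base // cf_pair_series // subrr.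
Qed.

Lemma strace_dlog d m n : (0 < m)%N -> (0 < n)%N -> (m + n <= N)%N ->
  \sum_(k <- divisors (gcdn m n)) k%:R^-1 * strace (k * d)%N (m %/ k)%N (n %/ k)%N =
  n%:R^-1 * cf m n (dlog N (pair_series (bpair d) N)).
Proof.
move=> m0 n0 hN; rewrite (strace_elimination CL d hE ht_A0 m0 n0 hN).
by rewrite (eqtr_cf (eqtr_dlog (gf_base d)) hN).
Qed.

(** At bidegree (1, n) the gcd is 1, so the divisor sum has one term, and only the linear part of
    the logarithm contributes. *)
Lemma strace1 d n : (0 < n)%N -> (n < N)%N -> strace d 1 n = bsum d n.
Proof.
move=> n0 hN; have := @strace_dlog d 1%N n isT n0.
rewrite add1n => /(_ hN); rewrite gcd1n big_seq1 mul1n !divn1 invr1 mul1r => ->.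
rewrite cf_dlog1; last first.
  move=> j; rewrite /pair_series cf_sum big_seq big1 // => p.
  by rewrite mem_pairs cf_mono => /and4P[h _ _ _]; rewrite eq_sym -leqn0 leqNgt h.
by rewrite mulKf ?pnatr_eq0 -?lt0n // cf_pair_series // n0.
Qed.

Lemma strace_formula m n : (0 < m)%N -> (0 < n)%N -> (m + n <= N)%N ->
  strace 1 m n = \sum_(d <- divisors (gcdn m n)) d%:R^-1 * (moebius d)%:~R *
    \sum_(s \in Tset (m %/ d) (n %/ d))
      (((fam_size s).-1)`!%:R / (fam_fact s)%:R *
       \prod_(p <- finsupp s) strace d 1%N (p.1 + p.2).-1 ^+ s p).
Proof.
move=> m0 n0 hN; have g0 : (0 < gcdn m n)%N by rewrite gcdn_gt0 m0.
pose Phi d m n := n%:R^-1 * cf m n (dlog N (pair_series (bpair d) N)).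
have dvd d : d \in divisors (gcdn m n) ->
    [/\ (d %| m)%N, (d %| n)%N, (0 < m %/ d)%N, (0 < n %/ d)%N &
      (m %/ d + n %/ d <= N)%N].
  rewrite -dvdn_divisors // => dg; have d0 := dvdn_gt0 g0 dg.
  have /andP[dm dn] : (d %| m)%N && (d %| n)%N by rewrite -dvdn_gcd.
  have dm' := dvdn_leq m0 dm; have dn' := dvdn_leq n0 dn.
  split; rewrite ?divn_gt0 //.
  by apply: leq_trans hN; apply: leq_add; apply: leq_div.
rewrite (@moebius_inversion _ strace Phi) //; last first.
  move=> d; rewrite dvdn_divisors // => dg; have [dm dn h1 h2 h3] := dvd d dg.
  rewrite /Phi -strace_dlog //.
  suff -> : (gcdn m n %/ d)%N = gcdn (m %/ d)%N (n %/ d)%N by [].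
  rewrite -{1}(divnK dm) -{1}(divnK dn) -muln_gcdl mulnK //.
  by move: dg; rewrite -dvdn_divisors // => /(dvdn_gt0 g0).
rewrite big_seq [RHS]big_seq; apply: eq_bigr => d dg; congr (_ * _).
have [dm dn h1 h2 h3] := dvd d dg.
rewrite /Phi (multinomial_dlog _ h1 h2 h3); apply: eq_fsbigr => s hs.
congr (_ * _); rewrite big_seq [RHS]big_seq; apply: eq_bigr => p ps.
congr (_ ^+ _).
have /andP[/andP[p1 p1m] /andP[p2 p2n]] := Tset_bound hs ps.
rewrite /bpair strace1 //.
  by case: (p.1) p1 => // a _; rewrite addSn /= addn_gt0 p2 orbT.
have h4 : (p.1 + p.2 <= N)%N by apply: leq_trans h3; apply: leq_add.
by case: (p.1) p1 h4.
Qed.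

End Formula.

End Model.

(** * The monstrous Lie superalgebra *)

Section MonstrousModel.
Variables (K : numClosedFieldType) (F : qseries) (C : idx -> idx -> K).
Hypothesis hC : coloring F C.
Local Notation Q := (rootlattice idx).
Local Notation th := (theta C).
Local Notation mm := (monster_m F).
Local Notation al := (@sroot idx).
Local Notation gen := (gen mm).
Local Notation rel := (@bkm_rel K idx monster_A mm).
Local Notation dg := (@gdeg idx mm).
Local Notation L := (presented th dg rel).
Local Notation br := (@bracket K Q th gen dg rel).
Local Notation pmon := (@pmon K Q th gen dg rel).
Local Notation mdeg := (Defs.mdeg dg).

Definition mhom (q : Q) : L -> Prop := @graded_part K Q th gen dg rel (eq^~ q).

Lemma monster_colored : colored_lie br th mhom.
Proof. exact: presented_colored (thDl hC) (thDr hC) (thC hC). Qed.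

Let CL := monster_colored.

Local Notation sgen := (sgen pmon).

Lemma mhom_pmon w : mhom (mdeg w) (pmon w).
Proof. exact: graded_pmon. Qed.

Lemma pmon_rel (a b : magma gen) c : rel (<< 1 *g a >> - c *: << 1 *g b >>) ->
  pmon a = c *: pmon b.
Proof.
move=> r; have := pr0 th dg r.
rewrite -scaleNr addrC pr_lin scaleNr addrC => /eqP; rewrite subr_eq0.
by move/eqP.
Qed.

Lemma monster_cartan_sgen g s i (k : 'I_(mm i)) : cartan g ->
  exists c, br (pmon (Leaf g)) (sgen s k) = c *: sgen s k.
Proof.
case: g => // j _; case: s; rewrite pmon_br.
- exists (monster_A j i)%:~R; apply: pmon_rel; rewrite -fbrUU; exact: bkm_he.
- exists (- (monster_A j i)%:~R); apply: pmon_rel; rewrite scaleNr opprK -fbrUU.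
  exact: bkm_hf.
- exists (j == i)%:R; apply: pmon_rel; rewrite -fbrUU; exact: bkm_de.
- exists (- (j == i)%:R); apply: pmon_rel; rewrite scaleNr opprK -fbrUU.
  exact: bkm_df.
Qed.

Lemma pmon_rel0 (a : magma gen) : rel << 1 *g a >> -> pmon a = 0.
Proof. by move=> r; apply: pr0. Qed.

Lemma monster_cartan_comm g g' : cartan g -> cartan g' ->
  br (pmon (Leaf g)) (pmon (Leaf g')) = 0.
Proof.
have r (a b : magma gen) :
    rel (fbr << 1 *g a >> << 1 *g b >>) -> br (pmon a) (pmon b) = 0.
  by rewrite fbrUU pmon_br; apply: pmon_rel0.
case: g => // i _; case: g' => // j _.
- by apply: r; apply: bkm_hh.
- by apply: r; apply: bkm_hd.
- rewrite (cl_skew CL (mhom_pmon _) (mhom_pmon _)) r ?scaler0 ?oppr0 //.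
  exact: bkm_hd.
- by apply: r; apply: bkm_dd.
Qed.

Lemma monster_sgen_opp s i (k : 'I_(mm i)) j (l : 'I_(mm j)) :
  exists c, br (sgen s k) (sgen (~~ s) l) = c *: pmon (Leaf (GenH mm i)) /\
    (c = 0 \/ i = j).
Proof.
have r i' (k' : 'I_(mm i')) j' (l' : 'I_(mm j')) :
    br (sgen true k') (sgen false l') =
    ((i' == j') && (k' == l' :> nat))%:R *: pmon (Leaf (GenH mm i')).
  by rewrite pmon_br; apply: pmon_rel; rewrite -fbrUU; apply: bkm_ef.
case: s => /=.
  exists ((i == j) && (k == l :> nat))%:R; split; first exact: r.
  by have [|_] := eqVneq i j; [right|left].
have [ij|ne] := eqVneq j i; last first.
  exists 0; split; last by left.
  have e0 : br (sgen true l) (sgen false k) = 0 by rewrite r (negPf ne) scale0r.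
  rewrite (cl_skew CL (hom_sgen mhom_pmon false k) (hom_sgen mhom_pmon true l)).
  by rewrite e0 scaler0 oppr0 [RHS]scale0r.
exists (- (th (sal false i) (sal true j) * ((j == i) && (l == k :> nat))%:R)).
split; last by right.
have eh : pmon (Leaf (GenH mm j)) = pmon (Leaf (GenH mm i)) by rewrite ij.
rewrite (cl_skew CL (hom_sgen mhom_pmon false k) (hom_sgen mhom_pmon true l)).
by rewrite r scalerA scaleNr eh.
Qed.

Lemma graded_nil (P : Q -> Prop) (x : L) : (forall q, P q -> ht1 q < 0) ->
  graded_part P x -> lspan (fun z => exists2 q, P q & nil br pmon false q z) x.
Proof.
move=> hP /gradedP; apply: lspan_sub => z [w hw ->].
have ht := tri_pm CL (@pmon_br K Q th gen dg rel) mhom_pmon monster_cartan_sgen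
  monster_cartan_comm monster_sgen_opp w.
by exists (mdeg w) => //; apply: (tri_neg CL ht (hP _ hw)).
Qed.

Local Notation uletter := (uletter mm).
Local Notation T := {malg K[seq uletter]}.
Local Notation k0 := (Ordinal (monster_mN1 F)).
Local Notation f0 := (sgen false k0).
Local Notation opg := (@opg K F C).

Lemma k0_uniq (k : 'I_(mm idxN1)) : k = k0.
Proof.
apply: val_inj; case: k => k /=.
by rewrite {1}/monster_m qcoefN1; case: k.
Qed.

Lemma iter_pmon n a b : iter n (br (pmon a)) (pmon b) = pmon (iter n (Node a) b).
Proof. by elim: n => //= n ->; rewrite pmon_br. Qed.

Lemma monster_serre_f j (k : 'I_(mm j)) : j != idxN1 ->
  iter (absx j) (br f0) (sgen false k) = 0.
Proof.
move=> jn; rewrite iter_pmon; apply: pmon_rel0.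
rewrite -(serre_len jn) -iter_fbrUU; apply: bkm_serre_f => //.
by rewrite eq_sym.
Qed.

Definition mact : L -> T -> T := @act K Q th gen dg rel T opg.

Lemma mact_linl c x y t : mact (c *: x + y) t = c *: mact x t + mact y t.
Proof.
exact: (tact_linl (thDl hC) (thDr hC) (thC hC) (@opg_lin K F C)
  (fun u f t => @op_rel K F C hC u f t)).
Qed.

Lemma mact_linr c x s t : mact x (c *: s + t) = c *: mact x s + mact x t.
Proof.
exact: (act_linr (thDl hC) (thDr hC) (thC hC) (@opg_lin K F C)
  (fun u f t => @op_rel K F C hC u f t)).
Qed.

Lemma mact_br a b x y t : mhom a x -> mhom b y ->
  mact (br x y) t = mact x (mact y t) - th a b *: mact y (mact x t).
Proof.
exact: (act_br (thDl hC) (thDr hC) (thC hC) (@opg_lin K F C)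
  (fun u f t => @op_rel K F C hC u f t)).
Qed.

Lemma mact_pmon w t : mact (pmon w) t = op th dg opg w t.
Proof.
exact: (act_pmon (thDl hC) (thDr hC) (thC hC) (@opg_lin K F C)
  (fun u f t => @op_rel K F C hC u f t)).
Qed.

Lemma mact_f0 t : mact f0 t = opF th al t.
Proof. exact: mact_pmon. Qed.

Lemma mact_f j (k : 'I_(mm j)) t : j != idxN1 ->
  mact (sgen false k) t = cons3 (j, 0%N, k : nat) t.
Proof. by move=> jn; rewrite mact_pmon /= (negPf jn). Qed.

Definition mpar (s : bool) (x : L) : Prop :=
  graded_part (fun q => th q q = (-1) ^+ s) x.

Lemma mpar_hom (s : bool) q z : mhom q z -> th q q = (-1) ^+ s -> mpar s z.
Proof. by move=> hz e; apply: graded_sub hz => _ ->. Qed.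

Lemma mpar0 s : mpar s 0.
Proof. exact/gradedP/lspan_0. Qed.

Lemma mpar_lin s c x y : mpar s x -> mpar s y -> mpar s (c *: x + y).
Proof. by move=> /gradedP hx /gradedP hy; apply/gradedP/lspan_lin. Qed.

(* The action twisted by the indicator of the even degrees is the original one on
   the even part, and zero on the odd part. *)
Lemma mpar_act x t : mpar false x -> mpar true x -> mact x t = 0.
Proof.
pose f (q : Q) : K := (th q q == 1)%:R.
have tg := tact_graded (thDl hC) (thDr hC) (thC hC) (@opg_lin K F C)
  (fun u f t => @op_rel K F C hC u f t).
move=> h1 h2.
have e1 : tact opg f x t = 1 *: mact x t.
  by apply: tg h1 => q /= e; rewrite /f e expr0 eqxx.
have e2 : tact opg f x t = 0 *: mact x t.
  apply: tg h2 => q /= e; rewrite /f e expr1.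
  by rewrite -subr_eq0 -opprD oppr_eq0 -[1 + 1]/(2%:R) pnatr_eq0.
by rewrite -[LHS]scale1r -e1 e2; apply: scale0r.
Qed.

End MonstrousModel.

(** * Powers of an automorphism of the monstrous algebra *)

Section MonstrousAutomorphism.
Variables (K : numClosedFieldType) (F : qseries) (C : idx -> idx -> K).
Hypothesis hC : coloring F C.
Local Notation Q := (rootlattice idx).
Local Notation th := (theta C).
Local Notation mm := (monster_m F).
Local Notation gen := (gen mm).
Local Notation rel := (@bkm_rel K idx monster_A mm).
Local Notation dg := (@gdeg idx mm).
Local Notation L := (monstrous F C).
Local Notation br := (@mbr K F C).
Local Notation pmon := (@pmon K Q th gen dg rel).
Local Notation sgen := (sgen pmon).
Local Notation k0 := (Ordinal (monster_mN1 F)).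

Variable phi : nat -> {linear L -> L}.
Hypothesis phiE : forall d x, phi d x = iter d (phi 1%N) x.
Hypothesis phi_gr : forall (m n : int) (x : L),
  root_space m n x -> root_space m n (phi 1%N x).
Hypothesis phi_br : forall d (x y : L), monstrous_neg x -> monstrous_neg y ->
  phi d (br x y) = br (phi d x) (phi d y).
Hypothesis phi_f : forall d, phi d (fN1 F C) = fN1 F C.

Let CL : colored_lie br th (@mhom K F C) := monster_colored hC.

Lemma neg_hom q (x : L) : mhom q x -> ht1 q < 0 -> monstrous_neg x.
Proof. by move=> hx hq; apply: graded_sub hx => _ ->; rewrite IIdegE. Qed.

Lemma neg_br (x y : L) : monstrous_neg x -> monstrous_neg y -> monstrous_neg (br x y).
Proof.
apply: graded_br => a b; rewrite !IIdegE /= lsumD => h1 h2.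
by rewrite -oppr_gt0 opprD addr_gt0 ?oppr_gt0.
Qed.

Lemma root_hom (m n : int) q (z : L) : mhom q z -> ht1 q = m /\ ht2 q = n ->
  root_space m n z.
Proof.
by move=> hz [<- <-]; apply: graded_sub hz => _ ->; rewrite IIdegE.
Qed.

Lemma root_span (m : nat) (n : int) (x : L) : (0 < m)%N -> root_space (- m%:Z) n x ->
  lspan (fun z => exists2 q, (ht1 q = - m%:Z /\ ht2 q = n) &
    nil br pmon false q z) x.
Proof.
move=> m0 hx.
have hn q : IIdeg q = (- m%:Z, n) -> ht1 q < 0.
  by rewrite IIdegE => -[e _]; rewrite /ht1 e oppr_lt0 ltz_nat.
apply: lspan_sub (graded_nil hC hn hx) => z [q + hz]; rewrite IIdegE => -[e1 e2].
by exists q.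
Qed.

(** The gradation is preserved, and the root space of (-1, -j) is spanned by the f_{jk}: first
    coordinate -1 leaves only generators, and the second coordinate determines their index. *)
Lemma phi_sgen j : exists M : 'M[K]_(mm j), forall k,
  phi 1%N (sgen false k) = \sum_k2 M k k2 *: sgen false k2.
Proof.
suff /choice[c hc] : forall k : 'I_(mm j), exists c : 'I_(mm j) -> K,
    phi 1%N (sgen false k) = \sum_k2 c k2 *: sgen false k2.
  exists (\matrix_(k, k2) c k k2) => k; rewrite hc.
  by apply: eq_bigr => k2 _; rewrite mxE.
move=> k; apply: lspan_fam.
have hs : root_space (- 1%N%:Z) (- val j) (sgen false k).
  apply: (root_hom (hom_sgen (@mhom_pmon K F C) false k)).
  by rewrite /ht1 /ht2 !lsumN !lsum_sroot.
apply: lspan_bind (root_span (m := 1) isT (phi_gr hs)) => z [q [q1 q2] hz].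
apply: lspan_bind (nil_one CL hz q1) => y [i [k2 [eq ->]]].
have ei : i = j.
  by apply: val_inj; move: q2; rewrite eq /ht2 lsumN lsum_sroot => /oppr_inj.
by subst i; apply: lspan_in; exists k2.
Qed.

Lemma supertrace_formula m n : (0 < m)%N -> (0 < n)%N ->
  supertrace (phi 1%N) (@root_space K F C (- m%:Z) (- n%:Z)) =
  \sum_(d <- divisors (gcdn m n)) d%:R^-1 * (moebius d)%:~R *
    \sum_(s \in Tset (m %/ d) (n %/ d))
      (((fam_size s).-1)`!%:R / (fam_fact s)%:R *
       \prod_(p <- finsupp s)
         supertrace (phi d) (@Vspace K F C ((p.1 + p.2)%N%:Z - 1)) ^+ s p).
Proof.
(* This height also covers the factors on the right: V of index p.1 + p.2 - 1 sits in bidegree (1,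
   p.1 + p.2 - 1), of height p.1 + p.2, at most m + n. *)
move=> m0 n0; pose N := (m + n)%N.
pose good j (t : 'M[K]_(mm j) * 'M[K]_(mm j) * 'M[K]_(mm j) * 'M[K]_(mm j)) :=
  let: (M, P, Pi, D) := t in
  [/\ Pi *m P = 1%:M, P *m M = D *m P, forall i k : 'I_(mm j), (i < k)%N -> D i k = 0 &
    forall k, phi 1%N (sgen false k) = \sum_k2 M k k2 *: sgen false k2].
have hg j : exists t, @good j t.
  have [M hM] := phi_sgen j; have [P [Pi [D [_ h1 h2 h3]]]] := trigonalization M.
  by exists (M, P, Pi, D).
pose t j := sval (cid (hg j)).
have ht j : good j (t j) := svalP (cid (hg j)).
pose M j := (t j).1.1.1; pose P j := (t j).1.1.2.
pose Pi j := (t j).1.2; pose D j := (t j).2.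
have PPi j : Pi j *m P j = 1%:M.
  by rewrite /Pi /P; move: (ht j); case: (t j) => [[[a b] c] e] [].
have PM j : P j *m M j = D j *m P j.
  by rewrite /D /M /P; move: (ht j); case: (t j) => [[[a b] c] e] [].
have Dtri j (i k : 'I_(mm j)) : (i < k)%N -> D j i k = 0.
  by rewrite /D; move: (ht j); case: (t j) => [[[a b] c] e] [? ? h _]; apply: h.
have hM j (k : 'I_(mm j)) : phi 1%N (sgen false k) = \sum_k2 M j k k2 *: sgen false k2.
  by rewrite /M; move: (ht j); case: (t j) => [[[a b] c] e] [? ? _ h]; apply: h.
have [E hE] := elimination_base br pmon k0 P D N.
(* One choice of basis and of elimination gives the supertraces of all powers at all bidegrees
   involved, as the inversion needs. *)
have strE d i j : (0 < i)%N -> (0 < j)%N -> (i + j <= N)%N ->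
    supertrace (phi d) (@root_space K F C (- i%:Z) (- j%:Z)) = strace br th E d i j.
  move=> i0 j0 hN.
  have tr := is_trace_root CL (th_al0 hC) (@mhom_pmon K F C) (@k0_uniq F)
    (@monster_serre_f K F C) PPi (mact_linl hC) (mact_linr hC) (mact_br hC)
    (mact_f0 hC) (mact_f hC) PM Dtri (phiE d) neg_br neg_hom (@phi_br d) (phi_f d)
    hM (@mpar_hom K F C) (@mpar0 K F C) (@mpar_lin K F C) (mpar_act hC) hE i0 j0 hN
    (fun x => @root_span i (- j%:Z) x i0) (@root_hom (- i%:Z) (- j%:Z)).
  rewrite /supertrace (traceE (tr false)) (traceE (tr true)).
  rewrite !big_filter -sumrN /strace [RHS]big_mkcond /= [in LHS]big_mkcond /=.
  rewrite [X in _ + X]big_mkcond -big_split; apply: eq_bigr => e _ /=.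
  case: ((dm e == i) && (dn e == j)); rewrite ?addr0 //= /nu expr0 expr1.
  have n1 : (1 : K) != -1 by rewrite -subr_eq0 opprK -[1 + 1]/(2%:R) pnatr_eq0.
  case: (th_self CL (qd e)) => ->; rewrite ?eqxx ?(negPf n1) ?[-1 == _]eq_sym ?(negPf n1).
    by rewrite addr0 mul1r.
  by rewrite add0r mulN1r.
rewrite strE // (strace_formula CL (th_al0 hC) hE) //.
have g0 : (0 < gcdn m n)%N by rewrite gcdn_gt0 m0.
rewrite big_seq [RHS]big_seq; apply: eq_bigr => d dg; congr (_ * _).
have {dg} [d0 dm dn] : [/\ (0 < d)%N, (d %| m)%N & (d %| n)%N].
  move: dg; rewrite -dvdn_divisors // => dg; rewrite (dvdn_gt0 g0 dg).
  by move: dg; rewrite dvdn_gcd => /andP[].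
apply: eq_fsbigr => s hs; congr (_ * _); rewrite big_seq [RHS]big_seq.
apply: eq_bigr => p ps; congr (_ ^+ _).
have /andP[/andP[p1 p1m] /andP[p2 p2n]] := Tset_bound hs ps.
have hp : (p.1 + p.2 <= N)%N.
  by apply: leq_add; [apply: leq_trans p1m _|apply: leq_trans p2n _]; apply: leq_div.
rewrite -strE //; last by case: (p.1) p1 hp => // a _; rewrite addSn add1n.
  rewrite /Vspace; congr (supertrace _ (root_space _ (- _))).
  by case: (p.1) p1 => // a _; rewrite addSn; lia.
by case: (p.1) p1 => // a _; rewrite addSn /= addn_gt0 p2 orbT.
Qed.

End MonstrousAutomorphism.

Theorem proposition7p1 (R : realType) (F : qseries) (C : idx -> idx -> R[i])
    (hC : coloring F C) (G : groupType)
    (rho : G -> {linear monstrous F C -> monstrous F C})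
    (rho1 : forall x, rho 1%g x = x)
    (rhoM : forall g h x, rho (g * h)%g x = rho g (rho h x))
    (rho_gr : forall g (m n : int) x,
       root_space m n x -> root_space m n (rho g x))
    (rho_pos : forall g, superaut (@monstrous_pos _ F C) (rho g))
    (rho_neg : forall g, superaut (@monstrous_neg _ F C) (rho g))
    (rho_str : forall g (m n : nat), (0 < m)%N -> (0 < n)%N ->
       supertrace (rho g) (root_space m%:Z n%:Z) =
       supertrace (rho g) (root_space (- m%:Z) (- n%:Z)))
    (rho_f : forall g, rho g (fN1 F C) = fN1 F C)
    (rho_e : forall g, rho g (eN1 F C) = eN1 F C) :
  forall (g : G) (m n : nat), (0 < m)%N -> (0 < n)%N ->
    supertrace (rho g) (root_space m%:Z n%:Z) =
    supertrace (rho g) (root_space (- m%:Z) (- n%:Z)) /\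
    supertrace (rho g) (root_space (- m%:Z) (- n%:Z)) =
    \sum_(d <- divisors (gcdn m n))
      (d%:R)^-1 * (moebius d)%:~R *
      \sum_(s \in Tset (m %/ d) (n %/ d))
        (((fam_size s).-1)`!%:R / (fam_fact s)%:R *
         \prod_(p <- finsupp s)
           supertrace (rho (g ^+ d)%g) (Vspace ((p.1 + p.2)%N%:Z - 1)) ^+ s p).
Proof.
move=> g m n m0 n0; split; first exact: rho_str.
have := @supertrace_formula _ F C hC (fun d => rho (g ^+ d)%g).
rewrite expg1; apply=> //.
- by move=> d x; elim: d => [|d IH]; rewrite ?rho1 // expgS rhoM IH.
- by move=> m' n' x; apply: rho_gr.
- by move=> d x y hx hy; case: (rho_neg (g ^+ d)%g) => _ h _ _; apply: h.
Qed.
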